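(* Let $d$ be the mountain pass level of $J$ on $W^{2,2}_0(\Omega)$. Then $$d=\min_{v\in B}\frac{\|v\|^6}{54},\qquad B:=\Big\{v\in W^{2,2}_0(\Omega):\int_\Omega v_xv_yv_{xy}=1\Big\}.$$ Moreover, $d$ can be lower bounded in terms of the best constant for the (compact) embedding $W^{2,2}_0(\Omega)\subset W^{1,4}_0(\Omega)$, namely $$d\ge\frac{8}{27}\min_{v\in W^{2,2}_0(\Omega)\setminus\{0\}}\frac{\left(\int_\Omega|\Delta v|^2\right)^2}{\int_\Omega|\nabla v|^4}.$$
   Context: $\Omega\subset\mathbb{R}^2$ is an open, bounded, smooth domain. For $v\in W^{2,2}_0(\Omega)$, $\|v\|:=\|\Delta v\|_{L^2(\Omega)}$ and $$J(v)=\tfrac12\int_\Omega|\Delta v|^2-\int_\Omega v_xv_yv_{xy}.$$ The mountain pass level is $$d=\inf_{\gamma\in\Gamma}\max_{0\le s\le1}J(\gamma(s)),\qquad\Gamma=\{\gamma\in C([0,1],W^{2,2}_0(\Omega)):\gamma(0)=0,\ J(\gamma(1))<0\}.$$ *)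

(* Defs.v *)
From HB Require Import structures.
From mathcomp Require Import all_boot all_order all_algebra.
From mathcomp Require Import all_classical all_reals all_analysis.
Set Implicit Arguments.
Unset Strict Implicit.
Unset Printing Implicit Defensive.
Import Order.TTheory GRing.Theory Num.Theory.
Import numFieldNormedType.Exports.
Local Open Scope classical_set_scope.
Local Open Scope ring_scope.

Notation leb2 R :=
  (@lebesgue_measure R \x @lebesgue_measure R)%E (only parsing).

Section SmoothFunctions.
Context {R : realType}.

Definition dx (f : R * R -> R) : R * R -> R :=
  fun z => 'D_((1, 0) : R * R) f z.
Definition dy (f : R * R -> R) : R * R -> R :=
  fun z => 'D_((0, 1) : R * R) f z.

Definition pderiv (i j : nat) (f : R * R -> R) : R * R -> R :=
  iter i dx (iter j dy f).

Fixpoint Ck (k : nat) (f : R * R -> R) : Prop :=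
  continuous f /\
  match k with
  | 0 => True
  | k'.+1 =>
    [/\ forall z, derivable f z ((1, 0) : R * R),
        forall z, derivable f z ((0, 1) : R * R),
        Ck k' (dx f) & Ck k' (dy f)]
  end.

Definition smooth (f : R * R -> R) : Prop := forall k, Ck k f.

Definition smooth1 (g : R -> R) : Prop :=
  forall (n : nat) (x : R), derivable (derive1n n g) x 1.

Definition test_function (Omega : set (R * R)) : set (R * R -> R) :=
  [set phi | [/\ smooth phi,
     compact (closure [set z | phi z != 0]) &
     closure [set z | phi z != 0] `<=` Omega]].

End SmoothFunctions.

Section Domains.
Context {R : realType}.

(* Near each boundary point the domain lies strictly on one side of the graph
   of a smooth function of one of the two coordinates. *)
Definition smooth_boundary (Omega : set (R * R)) : Prop :=
  forall p, (closure Omega `\` interior Omega) p ->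
  exists2 g : R -> R, smooth1 g &
    [\/ \forall z \near p, Omega z <-> g z.1 < z.2,
        \forall z \near p, Omega z <-> z.2 < g z.1,
        \forall z \near p, Omega z <-> g z.2 < z.1
      | \forall z \near p, Omega z <-> z.1 < g z.2].

Definition smooth_bounded_domain (Omega : set (R * R)) : Prop :=
  [/\ open Omega, Omega !=set0, connected Omega, bounded_set Omega
    & smooth_boundary Omega].

End Domains.

(* Functions on Omega are represented by functions on the whole plane, whose
   values outside Omega are never used; elements of the function spaces are
   classes modulo equality a.e. on Omega. *)
Section Sobolev.
Context {R : realType}.
Variable Omega : set (R * R).

Definition ae_zero (v : R * R -> R) : Prop :=
  {ae leb2 R, forall z, Omega z -> v z = 0}.

Definition L2 : set (R * R -> R) :=
  [set f | (f \_ Omega) \in Lfun (leb2 R) 2%:E].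

Definition L2norm (f : R * R -> R) : R :=
  fine ('N[leb2 R]_2%:E[EFin \o (f \_ Omega)])%E.

Definition L1loc : set (R * R -> R) :=
  [set f | forall K : set (R * R), compact K -> K `<=` Omega ->
     (leb2 R).-integrable K (EFin \o f)].

Definition is_wderiv (i j : nat) (v g : R * R -> R) : Prop :=
  [/\ L1loc v, L1loc g &
    forall phi, test_function Omega phi ->
      \int[leb2 R]_(z in Omega) (v z * pderiv i j phi z) =
      (-1) ^+ (i + j) * \int[leb2 R]_(z in Omega) (g z * phi z)].

(* A representative of the weak derivative, which is unique up to a.e.
   equality on Omega; 0 if there is none. *)
Definition wderiv (i j : nat) (v : R * R -> R) : R * R -> R :=
  xget (fun=> 0) [set g | is_wderiv i j v g].

Definition W22 : set (R * R -> R) :=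
  [set v | forall i j : nat, (i + j <= 2)%N ->
     exists2 g, is_wderiv i j v g & L2 g].

Definition W22norm (v : R * R -> R) : R :=
  Num.sqrt (\sum_(i < 3) \sum_(j < 3 | (i + j <= 2)%N)
    L2norm (wderiv i j v) ^+ 2).

Definition W220 : set (R * R -> R) :=
  [set v | W22 v /\ forall eps : R, 0 < eps ->
     exists2 phi, test_function Omega phi & W22norm (v \- phi) < eps].

Definition laplacian (v : R * R -> R) : R * R -> R :=
  wderiv 2 0 v \+ wderiv 0 2 v.

Definition norm220 (v : R * R -> R) : R := L2norm (laplacian v).

Definition cubic (v : R * R -> R) : R :=
  \int[leb2 R]_(z in Omega) (wderiv 1 0 v z * wderiv 0 1 v z * wderiv 1 1 v z).

Definition J (v : R * R -> R) : R :=
  2^-1 * \int[leb2 R]_(z in Omega) (laplacian v z ^+ 2) - cubic v.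

Definition continuous_path (gamma : R -> R * R -> R) : Prop :=
  forall s, `[0, 1]%classic s ->
    norm220 (gamma t \- gamma s) @[t --> within `[0, 1] (nbhs s)] --> (0 : R).

Definition Gamma : set (R -> R * R -> R) :=
  [set gamma | [/\ forall s, `[0, 1]%classic s -> W220 (gamma s),
     continuous_path gamma, ae_zero (gamma 0) & J (gamma 1) < 0]].

(* s |-> J (gamma s) is continuous on `[0, 1], so the supremum is a maximum. *)
Definition mountain_pass_level : \bar R :=
  ereal_inf [set ereal_sup [set (J (gamma s))%:E | s in `[0, 1]]
            | gamma in Gamma].

Definition B : set (R * R -> R) := [set v | W220 v /\ cubic v = 1].

Definition embedding_quotient (v : R * R -> R) : R :=
  (\int[leb2 R]_(z in Omega) (laplacian v z ^+ 2)) ^+ 2 /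
  \int[leb2 R]_(z in Omega)
    ((wderiv 1 0 v z ^+ 2 + wderiv 0 1 v z ^+ 2) ^+ 2).

End Sobolev.

Definition is_min {R : realType} (A : set R) (m : R) : Prop :=
  A m /\ lbound A m.

(* Main.v *)
Require Import Defs.
From HB Require Import structures.
From mathcomp Require Import all_boot all_order all_algebra.
From mathcomp Require Import all_classical all_reals all_analysis.
From mathcomp Require Import measurable_realfun lra.
Import Order.TTheory GRing.Theory Num.Theory.
Import numFieldNormedType.Exports.
Local Open Scope classical_set_scope.
Local Open Scope ring_scope.
Set Implicit Arguments.
Unset Strict Implicit.
Unset Printing Implicit Defensive.

(** All functionals involved are homogeneous. Write [n v] for the norm of [v] and
    let [M] be the maximum of the cubic integral over the unit sphere of [W220].
    If [M] is attained at [v], then on the ray through [v] the energy is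
    [s ^ 2 / 2 - M * s ^ 3], negative for large [s], with maximum
    [1 / (54 * M ^ 2)] at [s = 1 / (3 * M)]: a path along this ray bounds the level
    from above. In general [J w >= n w ^ 2 / 2 - M * n w ^ 3], so an admissible
    path, which has to leave the ball of radius [1 / (2 * M)], meets the sphere of
    radius [1 / (3 * M)] at a point of energy at least [1 / (54 * M ^ 2)]. On the
    other hand [1 <= M * n w ^ 3] on [B], with equality at a multiple of [v], so
    that the minimum of [n w ^ 6 / 54] over [B] is the same number. This is the
    content of [min_B], [ray_Gamma] and [path_level]. The second part compares [M]
    with the maximum [M'] of the quartic integral on the unit sphere, whose inverse
    is the minimal embedding quotient: Cauchy-Schwarz, together with the bounds
    [2 * |v_x * v_y| <= v_x ^ 2 + v_y ^ 2] and [2 * |v_xy| <= |Laplacian v|] (the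
    latter in mean square), gives [16 * M ^ 2 <= M'].

    The existence of the two maximisers rests on estimates for test functions.
    Integration by parts bounds all second derivatives by the Laplacian in mean
    square. The value [f (x, y)] is the integral of [f_xy] over a quadrant, hence
    the unit ball is uniformly bounded and equicontinuous ([sup_bound],
    [equicont_x]) and relatively compact in the sup norm
    ([sup_cauchy_selection]). Integrating [f_x ^ 4 = f_x * f_x ^ 3] by parts bounds
    the gradient in L4 by the sup norm and the second derivatives ([ip_interp]).
    For functions of the unit ball that are uniformly close, products of first
    derivatives are therefore close in mean square ([gr_prod_small]), and since
    [f_xy] enters the cubic integral linearly, the value at a midpoint is almost at
    least the mean of the values ([cub_mid], [quart_mid]). Two near-maximisers that
    are uniformly close thus have a near-maximal midpoint, whose norm must be close
    to 1, and the parallelogram identity makes them close in norm ([maximizer]). So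
    a maximising sequence that is Cauchy in the sup norm is Cauchy in norm, and by
    completeness ([sqi_complete], [approx_of_cauchy]) it converges in [W220]. Weak
    derivatives are unique almost everywhere by [fundamental_lemma], which lets
    identities and inequalities pass from test functions to [W220]. *)

(** * Square integrable functions *)

Fact seal_key : unit. Proof. by []. Qed.

Section L2.
Context d (T : measurableType d) (R : realType).
Variables (mu : {measure set T -> \bar R}) (D : set T).
Hypothesis mD : measurable D.

Definition sqi (f : T -> R) :=
  measurable_fun D f /\ mu.-integrable D (EFin \o (fun z => f z * f z)).
(** Sealed, so that conversion compares the functions instead of unfolding the
    integrals. *)
Definition inner : (T -> R) -> (T -> R) -> R :=
  locked_with seal_key (fun f g => \int[mu]_(z in D) (f z * g z)).
Definition l2norm : (T -> R) -> R :=
  locked_with seal_key (fun f => Num.sqrt (inner f f)).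

Lemma ipE f g : inner f g = \int[mu]_(z in D) (f z * g z).
Proof. by rewrite /inner unlock. Qed.

Lemma nrmE f : l2norm f = Num.sqrt (inner f f).
Proof. by rewrite /l2norm unlock. Qed.

Lemma ip_eq (f g f' g' : T -> R) : (forall z, D z -> f z * g z = f' z * g' z) ->
  inner f g = inner f' g'.
Proof. by move=> H; rewrite !ipE; apply: eq_Rintegral => z; rewrite inE; exact: H. Qed.

Lemma integrable_le (f g : T -> R) : measurable_fun D f ->
  mu.-integrable D (EFin \o g) -> (forall z, D z -> `|f z| <= g z) ->
  mu.-integrable D (EFin \o f).
Proof.
move=> mf ig fg; apply: le_integrable ig => //; first exact/measurable_EFinP.
by move=> z Dz /=; rewrite lee_fin (le_trans (fg z Dz)) // ler_norm.
Qed.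

Lemma integrable_RD (f g : T -> R) : mu.-integrable D (EFin \o f) ->
  mu.-integrable D (EFin \o g) -> mu.-integrable D (EFin \o (fun z => f z + g z)).
Proof. by move=> fi gi; have := integrableD mD fi gi. Qed.

Lemma integrable_RZ (k : R) (f : T -> R) : mu.-integrable D (EFin \o f) ->
  mu.-integrable D (EFin \o (fun z => k * f z)).
Proof. by move=> fi; have := integrableZl mD k fi. Qed.

Lemma sqi_mul f g : sqi f -> sqi g ->
  mu.-integrable D (EFin \o (fun z => f z * g z)).
Proof.
move=> [mf fi] [mg gi].
apply: (@integrable_le _ (fun z => f z * f z + g z * g z)).
- exact: measurable_funM.
- exact: integrable_RD.
- move=> z _; have := sqr_ge0 (f z + g z); have := sqr_ge0 (f z - g z).
  by rewrite !expr2 => ? ?; rewrite ler_norml; apply/andP; split; nra.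
Qed.

Lemma sqiD f g : sqi f -> sqi g -> sqi (f \+ g).
Proof.
move=> [mf fi] [mg gi]; split; first exact: measurable_funD.
apply: (@integrable_le _ (fun z => 2 * (f z * f z) + 2 * (g z * g z))).
- by apply: measurable_funM; exact: measurable_funD.
- by apply: integrable_RD; exact: integrable_RZ.
- move=> z _ /=; have := sqr_ge0 (f z + g z); have := sqr_ge0 (f z - g z).
  by rewrite !expr2 => ? ?; rewrite ler_norml; apply/andP; split; nra.
Qed.

Lemma sqiZ k f : sqi f -> sqi (fun z => k * f z).
Proof.
move=> [mf fi]; split; first exact: measurable_funM.
apply: eq_integrable (integrable_RZ (k * k) fi) => // z _ /=.
by congr EFin; lra.
Qed.

Lemma sqiN f : sqi f -> sqi (\- f).
Proof.
have -> : \- f = (fun z => -1 * f z) by apply/funext => z /=; lra.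
exact: sqiZ.
Qed.

Lemma sqiB f g : sqi f -> sqi g -> sqi (f \- g).
Proof. by move=> sf sg; apply: sqiD => //; exact: sqiN. Qed.

Lemma sqi_norm f : sqi f -> sqi (fun z => `|f z|).
Proof.
move=> [mf fi]; split; first by apply: measurableT_comp => //.
apply: eq_integrable fi => // z _ /=.
by rewrite -normrM ger0_norm // -expr2 sqr_ge0.
Qed.

Lemma ipC f g : inner f g = inner g f.
Proof. by apply: ip_eq => z _; rewrite mulrC. Qed.

Lemma ipDl f g h : sqi f -> sqi g -> sqi h -> inner (f \+ g) h = inner f h + inner g h.
Proof.
move=> sf sg sh; rewrite !ipE -RintegralD//; last 2 first.
  exact: sqi_mul. exact: sqi_mul.
by apply: eq_Rintegral => z _ /=; rewrite mulrDl.
Qed.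

Lemma ipZl k f g : sqi f -> sqi g -> inner (fun z => k * f z) g = k * inner f g.
Proof.
move=> sf sg; rewrite !ipE -RintegralZl//; last exact: sqi_mul.
by apply: eq_Rintegral => z _ /=; rewrite mulrA.
Qed.

Lemma ipNl f g : sqi f -> sqi g -> inner (\- f) g = - inner f g.
Proof.
move=> sf sg; rewrite -mulN1r -ipZl//; congr inner.
by apply/funext => z /=; rewrite mulN1r.
Qed.

Lemma ipBl f g h : sqi f -> sqi g -> sqi h -> inner (f \- g) h = inner f h - inner g h.
Proof. by move=> sf sg sh; rewrite ipDl// ?ipNl//; exact: sqiN. Qed.

Lemma ip_ge0 f : 0 <= inner f f.
Proof. by rewrite ipE; apply: Rintegral_ge0 => z _; rewrite -expr2 sqr_ge0. Qed.

Lemma ip_sqrD f g : sqi f -> sqi g ->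
  inner (f \+ g) (f \+ g) = inner f f + 2 * inner f g + inner g g.
Proof.
move=> sf sg; have s := sqiD sf sg.
rewrite ipDl// [inner f (_ \+ _)]ipC [inner g (_ \+ _)]ipC !ipDl// (ipC g f); lra.
Qed.

Lemma ip_sqrB f g : sqi f -> sqi g ->
  inner (f \- g) (f \- g) = inner f f - 2 * inner f g + inner g g.
Proof.
move=> sf sg; have s := sqiB sf sg.
rewrite ipBl// [inner f (_ \- _)]ipC [inner g (_ \- _)]ipC !ipBl// (ipC g f); lra.
Qed.

Lemma ip_CS f g : sqi f -> sqi g -> inner f g ^+ 2 <= inner f f * inner g g.
Proof.
move=> sf sg.
have H t : 0 <= inner f f + 2 * t * inner f g + t ^+ 2 * inner g g.
  have -> : inner f f + 2 * t * inner f g + t ^+ 2 * inner g g =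
      inner (f \+ (fun z => t * g z)) (f \+ (fun z => t * g z)).
    have st := sqiZ t sg; have sp := sqiD sf st.
    rewrite ipDl// [inner f (_ \+ _)]ipC [inner (fun _ => _) (_ \+ _)]ipC.
    rewrite !ipDl// [inner f (fun z => t * g z)]ipC !ipZl//.
    by rewrite [inner g (fun z => t * g z)]ipC ipZl// (ipC g f); lra.
  exact: ip_ge0.
have [g0|g0] := eqVneq (inner g g) 0.
  rewrite g0 mulr0; have [->|n0] := eqVneq (inner f g) 0; first by rewrite expr0n.
  (* the polynomial in [t] is affine here, and takes the value -1 at [q] *)
  pose q := - (inner f f + 1) / (2 * inner f g).
  have hq : q * (2 * inner f g) = - (inner f f + 1) by rewrite divfK// mulf_neq0// pnatr_eq0.
  by have := H q; rewrite g0; lra.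
have gp : 0 < inner g g by rewrite lt_def g0 ip_ge0.
(* the minimum of the polynomial in [t] *)
pose q := - inner f g / inner g g.
have hq : q * inner g g = - inner f g by rewrite divfK.
have := mulr_ge0 (ltW gp) (H q).
have -> : inner g g * (inner f f + 2 * q * inner f g + q ^+ 2 * inner g g) =
  inner f f * inner g g + 2 * (q * inner g g) * inner f g + (q * inner g g) ^+ 2 by lra.
by rewrite hq; lra.
Qed.

Lemma nrm_ge0 f : 0 <= l2norm f. Proof. by rewrite nrmE sqrtr_ge0. Qed.
Lemma nrm_sqr f : l2norm f ^+ 2 = inner f f.
Proof. by rewrite nrmE sqr_sqrtr ?ip_ge0. Qed.

Lemma ip_le_nrm f g : sqi f -> sqi g -> `|inner f g| <= l2norm f * l2norm g.
Proof.
move=> sf sg; rewrite -(ler_pXn2r (n:=2))// ?nnegrE ?mulr_ge0 ?nrm_ge0//.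
by rewrite exprMn !nrm_sqr -normrX ger0_norm ?sqr_ge0// ip_CS.
Qed.

Lemma nrmD f g : sqi f -> sqi g -> l2norm (f \+ g) <= l2norm f + l2norm g.
Proof.
move=> sf sg; rewrite -(ler_pXn2r (n:=2))// ?nnegrE ?addr_ge0 ?nrm_ge0//.
rewrite nrm_sqr ipDl ?[inner f (_ \+ _)]ipC ?[inner g (_ \+ _)]ipC ?ipDl//; last first.
  exact: sqiD.
rewrite sqrrD !nrm_sqr (ipC g f).
have := ip_le_nrm sf sg; rewrite ler_norml => /andP[_ ?]; nra.
Qed.

Lemma nrmZ k f : sqi f -> l2norm (fun z => k * f z) = `|k| * l2norm f.
Proof.
move=> sf; rewrite !nrmE ipZl ?[inner f (fun _ => _)]ipC ?ipZl//; last exact: sqiZ.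
by rewrite mulrA -expr2 sqrtrM ?sqr_ge0// sqrtr_sqr.
Qed.

Lemma nrmN f : l2norm (\- f) = l2norm f.
Proof. by rewrite !nrmE; congr Num.sqrt; apply: ip_eq => z _ /=; lra. Qed.

Lemma nrmBC f g : l2norm (f \- g) = l2norm (g \- f).
Proof. by rewrite -nrmN; congr l2norm; apply/funext => z /=; lra. Qed.

Lemma nrm_norm f : l2norm (fun z => `|f z|) = l2norm f.
Proof.
rewrite !nrmE; congr Num.sqrt; apply: ip_eq => z _ /=.
by rewrite -normrM ger0_norm// -expr2 sqr_ge0.
Qed.

Lemma nrmB_tri f g h : sqi f -> sqi g -> sqi h ->
  l2norm (f \- h) <= l2norm (f \- g) + l2norm (g \- h).
Proof.
move=> sf sg sh; apply: le_trans (nrmD _ _); last 2 first.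
  exact: sqiB. exact: sqiB.
by rewrite le_eqVlt; apply/orP; left; apply/eqP; congr l2norm; apply/funext => z /=; lra.
Qed.

Lemma nrm_dist f g : sqi f -> sqi g -> `|l2norm f - l2norm g| <= l2norm (f \- g).
Proof.
move=> sf sg.
have H f1 g1 : sqi f1 -> sqi g1 -> l2norm f1 <= l2norm (f1 \- g1) + l2norm g1.
  move=> s1 s2; apply: le_trans (nrmD (sqiB s1 s2) s2).
  rewrite le_eqVlt; apply/orP; left; apply/eqP; congr l2norm; apply/funext => z /=; lra.
rewrite ler_norml; have := H f g sf sg; have := H g f sg sf; rewrite (nrmBC g f).
by move=> ? ?; apply/andP; split; lra.
Qed.

Lemma ip_ae_l f g h : measurable_fun D f -> measurable_fun D g ->
  measurable_fun D h ->
  {ae mu, forall z, D z -> f z = g z} -> inner f h = inner g h.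
Proof.
move=> mf mg mh fg; rewrite !ipE /Rintegral; congr fine.
apply: ae_eq_integral => //.
- by apply/measurable_EFinP; exact: measurable_funM.
- by apply/measurable_EFinP; exact: measurable_funM.
- by apply: filterS fg => z /= H Dz; rewrite H.
Qed.

Lemma nrm_ae f g : measurable_fun D f -> measurable_fun D g ->
  {ae mu, forall z, D z -> f z = g z} -> l2norm f = l2norm g.
Proof.
move=> mf mg fg; rewrite !nrmE (ip_ae_l mf mg mf fg) ipC (ip_ae_l mf mg mg fg)//.
Qed.

Lemma sqi_ae f g : sqi f -> measurable_fun D g ->
  {ae mu, forall z, D z -> f z = g z} -> sqi g.
Proof.
move=> [mf fi] mg fg; split => //.
have mff : measurable_fun D (EFin \o (fun z => f z * f z)).
  by apply/measurable_EFinP; exact: measurable_funM.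
have mgg : measurable_fun D (EFin \o (fun z => g z * g z)).
  by apply/measurable_EFinP; exact: measurable_funM.
case/integrableP: fi => _ fi; apply/integrableP; split => //.
rewrite (ae_eq_integral (fun z => `|(EFin \o (fun z => f z * f z)%R) z|)%E) //.
- exact: measurableT_comp.
- exact: measurableT_comp.
- by apply: filterS fg => z /= H Dz; rewrite H.
Qed.

Lemma nrm_eq0 f : sqi f -> l2norm f = 0 -> {ae mu, forall z, D z -> f z = 0}.
Proof.
move=> [mf fi] /eqP; rewrite nrmE sqrtr_eq0 => f0.
have mff : measurable_fun D (EFin \o (fun z => f z * f z)).
  by apply/measurable_EFinP; exact: measurable_funM.
have H : (\int[mu]_(z in D) `|(EFin \o (fun z => f z * f z)%R) z| = 0)%E.
  rewrite (eq_integral (EFin \o (fun z => f z * f z))); last first.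
    by move=> z _ /=; rewrite ger0_norm// -expr2 sqr_ge0.
  have fin := integrable_fin_num mD fi.
  rewrite -(fineK fin); congr EFin; rewrite -[fine _]/(Rintegral mu D _) -ipE.
  by apply/le_anti; rewrite f0 ip_ge0.
move/(ae_eq_integral_abs mu mD mff) : H; apply: filterS => z /= H Dz.
by have [] := H Dz => /eqP; rewrite mulf_eq0 orbb => /eqP.
Qed.

(** The weights [4 ^ k] leave the series of squared increments integrable; where
    its sum is finite, it bounds the increments by a geometric sequence. *)
Lemma sqi_rapid_cvg (h : nat -> T -> R) : (forall k, sqi (h k)) ->
  (forall k, inner (h k.+1 \- h k) (h k.+1 \- h k) <= 8^-1 ^+ k) ->
  {ae mu, forall z, D z -> cvgn (fun k => h k z)}.
Proof.
move=> sh hr.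
pose a k z := 4 ^+ k * ((h k.+1 \- h k) z * (h k.+1 \- h k) z).
have a0 k z : 0 <= a k z by rewrite mulr_ge0 ?exprn_ge0// -expr2 sqr_ge0.
have ia k : mu.-integrable D (EFin \o a k).
  by apply: integrable_RZ; apply: sqi_mul; apply: sqiB.
have ma k : measurable_fun D (EFin \o a k) by exact: measurable_int (ia k).
pose S z := (\sum_(k <oo) (a k z)%:E)%E.
have mS : measurable_fun D S.
  apply: (@ge0_emeasurable_sum _ _ _ D (fun k z => (a k z)%:E) xpredT).
  - by move=> k z Dz _; rewrite lee_fin.
  - by move=> k _; exact: ma.
have iS : (\int[mu]_(z in D) S z < +oo)%E.
  rewrite integral_nneseries//; last by move=> k z Dz; rewrite lee_fin.
  apply: (@le_lt_trans _ _ (\sum_(k <oo) ((2 / (2 ^ k.+1)%:R)%:E))%E); last first.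
    by apply: le_lt_trans (epsilon_trick0 xpredT (ler0n R 2)) _; rewrite ltry.
  apply: lee_nneseries => k _; first by move=> *; apply: integral_ge0 => z Dz; rewrite lee_fin.
  rewrite -(fineK (integrable_fin_num mD (ia k))) lee_fin.
  have -> : fine (\int[mu]_(x in D) (EFin \o a k) x)%E =
    4 ^+ k * inner (h k.+1 \- h k) (h k.+1 \- h k).
    rewrite -/(Rintegral mu D (a k)) ipE -RintegralZl//.
    by apply: sqi_mul; apply: sqiB.
  apply: le_trans (ler_wpM2l _ (hr k)) _; first exact: exprn_ge0.
  rewrite -exprMn (_ : 4 * 8^-1 = 2^-1 :> R); last by lra.
  by rewrite natrX exprS invfM mulrA divff// mul1r exprVn.
have fS : {ae mu, forall z, D z -> S z \is a fin_num}.
  apply: integrable_ae => //; apply/integrableP; split => //.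
  rewrite (eq_integral S)// => z _; rewrite gee0_abs//.
  by apply: nneseries_ge0 => k _ _; rewrite lee_fin.
apply: filterS fS => z Sz Dz; move: (Sz Dz) => {}Sz.
pose s := fine (S z).
have as_ k : a k z <= s.
  rewrite -lee_fin /s fineK//.
  apply: le_trans (nneseries_lim_ge (P := xpredT) k.+1 _); last first.
    by move=> n _ _; rewrite lee_fin.
  rewrite big_nat_recr//= leeDr// sume_ge0// => i _; by rewrite lee_fin.
have s0 : 0 <= s by apply: le_trans (as_ 0%N).
have dk k : `|h k.+1 z - h k z| <= Num.sqrt s * 2^-1 ^+ k.
  rewrite -(ler_pXn2r (n:=2))// ?nnegrE ?mulr_ge0 ?sqrtr_ge0 ?exprn_ge0//.
  rewrite exprMn sqr_sqrtr// -normrX ger0_norm ?sqr_ge0//.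
  have := as_ k; rewrite /a /= -expr2 -exprM mulnC exprM.
  have -> : (2^-1) ^+ 2 = 4^-1 :> R by lra.
  by rewrite exprVn ler_pdivlMr ?exprn_gt0// mulrC.
have cs : cvgn (series (fun k => h k.+1 z - h k z)).
  apply: normed_cvg.
  apply: (@series_le_cvg _ _ (geometric (Num.sqrt s) 2^-1)).
  - by move=> n /=.
  - by move=> n; rewrite /geometric/= mulr_ge0 ?sqrtr_ge0 ?exprn_ge0.
  - by move=> n /=; exact: dk.
  - by apply: is_cvg_geometric_series; rewrite ger0_norm//; lra.
have -> : (fun k => h k z) = (fun k => h 0%N z + series (fun k => h k.+1 z - h k z) k).
  by apply/funext => k; rewrite /series/= telescope_sumr// addrC subrK.
by apply: is_cvgD => //; exact: is_cvg_cst.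
Qed.

(** Riesz-Fischer: the limit is taken pointwise along a rapidly converging
    subsequence, and Fatou's lemma turns the Cauchy bounds into bounds on the
    distance to it. *)
Lemma sqi_complete (f : nat -> T -> R) : (forall n, sqi (f n)) ->
  (forall e, 0 < e -> exists N, forall n m, (N <= n)%N -> (N <= m)%N ->
     l2norm (f n \- f m) <= e) ->
  exists2 g, sqi g & l2norm (f n \- g) @[n --> \oo] --> (0 : R).
Proof.
move=> sf fC.
have eN k : exists N, forall n m, (N <= n)%N -> (N <= m)%N ->
    l2norm (f n \- f m) <= Num.sqrt (8^-1 ^+ k).
  by apply: fC; rewrite sqrtr_gt0 exprn_gt0// invr_gt0.
pose N k := sval (cid (eN k)); have HN k := svalP (cid (eN k)); rewrite -/(N _) in HN.
pose n_ k := (k + \sum_(j < k.+1) N j)%N.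
have n_N k : (N k <= n_ k)%N.
  by rewrite /n_ big_ord_recr/= addnA leq_addl.
have n_N1 k : (N k <= n_ k.+1)%N.
  by rewrite /n_ big_ord_recr/= big_ord_recr/= addnA (leq_trans _ (leq_addr _ _))// addnA leq_addl.
have n_k k : (k <= n_ k)%N by rewrite leq_addr.
pose h k := f (n_ k).
have hc : {ae mu, forall z, D z -> cvgn (fun k => h k z)}.
  apply: sqi_rapid_cvg => k; first exact: sf.
  rewrite -nrm_sqr -[leRHS]sqr_sqrtr ?exprn_ge0// ler_pXn2r ?nnegrE ?nrm_ge0 ?sqrtr_ge0//.
  by apply: (HN k); [exact: n_N1|exact: n_N].
(* an upper limit is measurable without reference to the set of convergence *)
pose g z := fine (limn_esup (fun k => (h k z)%:E)).
have mg : measurable_fun D g.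
  apply: measurableT_comp => //; apply: measurable_fun_limn_esup => k.
  by apply/measurable_EFinP; case: (sf (n_ k)).
have hg : {ae mu, forall z, D z -> h k z @[k --> \oo] --> g z}.
  apply: filterS hc => z H Dz; have {}H := H Dz.
  suff -> : g z = limn (fun k => h k z) by [].
  have E : (fun k => (h k z)%:E) @ \oo --> (limn (fun k => h k z))%:E.
    by apply: cvg_EFin; [exact: nearW|exact: H].
  by rewrite /g (cvg_limn_einf_sup E).2.
have fat n e : 0 < e -> (forall m, (n <= m)%N -> l2norm (f n \- f m) <= e) ->
    (\int[mu]_(z in D) ((f n z - g z) * (f n z - g z))%:E <= (e ^+ 2)%:E)%E.
  move=> e0 fe.
  pose u k z := ((f n z - h (n + k)%N z) * (f n z - h (n + k)%N z))%:E.
  have mf k : measurable_fun D (f k) by case: (sf k).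
  have mu_ k : measurable_fun D (u k).
    have m1 : measurable_fun D (f n \- h (n + k)%N).
      by apply: measurable_funB; exact: mf.
    exact/measurable_EFinP/(measurable_funM m1 m1).
  have u0 k z : (0 <= u k z)%E by rewrite lee_fin -expr2 sqr_ge0.
  have := @fatou _ _ _ mu D mD u mu_ (fun k z _ => u0 k z).
  rewrite (@ae_eq_integral _ _ _ mu D (fun z => ((f n z - g z) * (f n z - g z))%:E)) //; last 3 first.
  - rewrite /limn_einf; apply: measurableT_comp => //.
    apply: measurable_fun_limn_esup => k.
    by apply: measurableT_comp => //; exact: mu_.
  - have m1 : measurable_fun D (f n \- g) by exact: measurable_funB.
    exact/measurable_EFinP/(measurable_funM m1 m1).
  - apply: filterS hg => z H Dz; have {}H := H Dz.
    have E : (fun k => u k z) @ \oo --> ((f n z - g z) * (f n z - g z))%:E.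
      apply: cvg_EFin; first exact: nearW.
      have H' : h (n + k)%N z @[k --> \oo] --> g z.
        by apply: cvg_comp H; exact: cvg_addnl.
      by apply: cvgM; apply: cvgB => //; exact: cvg_cst.
    by rewrite (cvg_limn_einf_sup E).1.
  move=> /le_trans; apply.
  rewrite limn_einf_lim; apply: lime_le; first exact: is_cvg_einfs.
  apply: nearW => k; apply: (@le_trans _ _ (\int[mu]_(x in D) u k x)%E).
    by apply: ereal_inf_lbound; exists k => //=.
  rewrite -(fineK (integrable_fin_num mD (sqi_mul (sqiB (sf n) (sf _)) (sqiB (sf n) (sf _))))).
  rewrite lee_fin -/(Rintegral _ _ _) -ipE -nrm_sqr.
  apply: lerXn2r; rewrite ?nnegrE ?nrm_ge0 ?(ltW e0)//.
  by apply: fe; rewrite (leq_trans _ (n_k _)) ?leq_addr.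
have sfg n e : 0 < e -> (forall m, (n <= m)%N -> l2norm (f n \- f m) <= e) ->
    sqi (f n \- g) /\ l2norm (f n \- g) <= e.
  move=> e0 fe; have le := fat n e e0 fe.
  have mfg : measurable_fun D (f n \- g) by apply: measurable_funB => //; case: (sf n).
  have ifg : mu.-integrable D (EFin \o (fun z => (f n \- g) z * (f n \- g) z)).
    apply/integrableP; split.
      by apply/measurable_EFinP; exact: measurable_funM.
    rewrite (eq_integral (fun z => ((f n z - g z) * (f n z - g z))%:E)); last first.
      by move=> z _ /=; rewrite ger0_norm// -expr2 sqr_ge0.
    by apply: le_lt_trans le _; rewrite ltry.
  split; first by split.
  rewrite -(ler_pXn2r (n:=2)) ?nnegrE ?nrm_ge0 ?(ltW e0)// nrm_sqr.
  by rewrite -lee_fin ipE /Rintegral fineK //; exact: integrable_fin_num.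
have [N1 HN1] := fC 1 ltr01.
have sg : sqi g.
  have [s1 _] := sfg N1 1 ltr01 (fun m h => HN1 N1 m (leqnn _) h).
  have -> : g = (f N1) \- (f N1 \- g) by apply/funext => z /=; lra.
  exact: sqiB.
exists g => //; apply/cvgrPdist_le => e e0.
have [M HM] := fC e e0; exists M => // n /= Mn.
rewrite sub0r normrN ger0_norm ?nrm_ge0//.
by apply: (sfg n e e0 _).2 => m nm; apply: HM => //; exact: leq_trans nm.
Qed.

(** The sequence of products can only converge to the product of the limits:
    by Cauchy-Schwarz it already converges to it in mean. *)
Lemma sqi_mul_cvg (f g : nat -> T -> R) F G : sqi (cst 1) ->
  (forall n, sqi (f n)) -> (forall n, sqi (g n)) -> sqi F -> sqi G ->
  (forall n, sqi (fun z => f n z * g n z)) ->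
  l2norm (f n \- F) @[n --> \oo] --> (0 : R) ->
  l2norm (g n \- G) @[n --> \oo] --> (0 : R) ->
  (forall e, 0 < e -> exists N, forall n m, (N <= n)%N -> (N <= m)%N ->
     l2norm ((fun z => f n z * g n z) \- (fun z => f m z * g m z)) <= e) ->
  sqi (fun z => F z * G z) /\
  l2norm ((fun z => f n z * g n z) \- (fun z => F z * G z)) @[n --> \oo] --> (0 : R).
Proof.
move=> s1 sf sg sF sG sfg fF gG C.
have [H sH cH] := sqi_complete sfg C.
have mF := sF.1; have mG := sG.1; have mH := sH.1.
pose X z := `|F z * G z - H z|.
have iX : mu.-integrable D (EFin \o X).
  apply: (@integrable_le _ (fun z => `|F z| * `|G z| + `|cst 1 z| * `|H z|)).
  - by apply: measurableT_comp => //; apply: measurable_funB => //; exact: measurable_funM.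
  - by apply: integrable_RD; apply: sqi_mul; exact: sqi_norm.
  - by move=> z _ /=; rewrite normr1 mul1r normr_id (le_trans (ler_normB _ _))// normrM.
pose B n := l2norm (f n \- F) * l2norm (g n \- G) + l2norm F * l2norm (g n \- G) +
   l2norm (f n \- F) * l2norm G + l2norm (cst 1) * l2norm ((fun z => f n z * g n z) \- H).
have XB n : \int[mu]_(z in D) X z <= B n.
  have P u v : sqi u -> sqi v ->
      \int[mu]_(z in D) (`|u z| * `|v z|) <= l2norm u * l2norm v.
    move=> su sv; apply: le_trans (ler_norm _) _.
    rewrite -(nrm_norm u) -(nrm_norm v).
    have H0 := ip_le_nrm (sqi_norm su) (sqi_norm sv).
    by rewrite ipE in H0.
  have I u v : sqi u -> sqi v -> mu.-integrable D (EFin \o (fun z => `|u z| * `|v z|)).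
    by move=> su sv; apply: sqi_mul; exact: sqi_norm.
  have sfF : sqi (f n \- F) by exact: sqiB.
  have sgG : sqi (g n \- G) by exact: sqiB.
  have sH' : sqi ((fun z => f n z * g n z) \- H) by exact: sqiB.
  have I1 := I _ _ sfF sgG; have I2 := I _ _ sF sgG; have I3 := I _ _ sfF sG.
  have I4 := I _ _ s1 sH'.
  have I12 := integrable_RD I1 I2; have I123 := integrable_RD I12 I3.
  have I1234 := integrable_RD I123 I4.
  apply: (@le_trans _ _ (\int[mu]_(z in D) (`|(f n \- F) z| * `|(g n \- G) z| +
     `|F z| * `|(g n \- G) z| + `|(f n \- F) z| * `|G z| +
     `|cst 1 z| * `|((fun z => f n z * g n z) \- H) z|))).
    apply: le_Rintegral => // z _ /=; rewrite /X normr1 mul1r -!normrM.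
    have -> : F z * G z - H z = - ((f n z - F z) * (g n z - G z)) -
       (F z * (g n z - G z)) - ((f n z - F z) * G z) + (f n z * g n z - H z) by lra.
    by rewrite (le_trans (ler_normD _ _))// lerD2r (le_trans (ler_normB _ _))// lerD2r
      (le_trans (ler_normB _ _))// normrN.
  rewrite RintegralD// RintegralD// RintegralD//.
  by rewrite /B !lerD// P.
have X0 : \int[mu]_(z in D) X z = 0.
  apply/le_anti; rewrite Rintegral_ge0 ?andbT; last by move=> z _; rewrite /X.
  have B0 : B n @[n --> \oo] --> (0 * 0 + l2norm F * 0 + 0 * l2norm G + l2norm (cst 1) * 0).
    apply: cvgD; [apply: cvgD; [apply: cvgD|]|]; apply: cvgM => //; exact: cvg_cst.
  rewrite !mulr0 mul0r !addr0 in B0.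
  have := cvg_lim (@Rhausdorff R) B0 => <-.
  by apply: limr_ge; [exact: (cvgP _ B0)|apply: nearW].
have E : {ae mu, forall z, D z -> F z * G z = H z}.
  have mX : measurable_fun D (EFin \o X) by exact: measurable_int iX.
  have XX : (\int[mu]_(z in D) `|(EFin \o X) z| = 0)%E.
    rewrite (eq_integral (EFin \o X)); last first.
      by move=> z _ /=; rewrite /X normr_id.
    by rewrite -(fineK (integrable_fin_num mD iX)) -/(Rintegral mu D X) X0.
  move/(ae_eq_integral_abs mu mD mX) : XX; apply: filterS => z /= K Dz.
  by have [] := K Dz => /eqP; rewrite normr_eq0 subr_eq0 => /eqP.
have mFG : measurable_fun D (fun z => F z * G z) by exact: measurable_funM.
split.
  by apply: sqi_ae sH mFG _; apply: filterS E => z K Dz; rewrite K.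
suff -> : (fun n => l2norm ((fun z => f n z * g n z) \- (fun z => F z * G z))) =
  (fun n => l2norm ((fun z => f n z * g n z) \- H)) by [].
apply/funext => n; apply: nrm_ae => //.
- by apply: measurable_funB => //; exact: (sfg n).1.
- by apply: measurable_funB => //; exact: (sfg n).1.
- by apply: filterS E => z K Dz /=; rewrite K.
Qed.

End L2.

(** * Rectangles and iterated integrals in the plane *)

Section Plane.
Context {R : realType}.
Local Notation T2 := (measurableTypeR R * measurableTypeR R)%type.
Local Notation mu2 := (leb2 R).
Implicit Types (f g : R * R -> R) (A : set (R * R)).

Definition orect (a b c d : R) : set (R * R) :=
  [set z | (a < z.1 < b) /\ (c < z.2 < d)].
Definition crect (a b c d : R) : set (R * R) :=
  [set z | (a <= z.1 <= b) /\ (c <= z.2 <= d)].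

Lemma orectE a b c d : orect a b c d = (`]a, b[%classic `*` `]c, d[%classic).
Proof. by apply/seteqP; split => z /=; rewrite /orect /= !in_itv. Qed.

Lemma crectE a b c d : crect a b c d = (`[a, b]%classic `*` `[c, d]%classic).
Proof. by apply/seteqP; split => z /=; rewrite /crect /= !in_itv. Qed.

Lemma measurable_orect a b c d : measurable (orect a b c d : set T2).
Proof. by rewrite orectE; apply: measurableX; exact: measurable_itv. Qed.

Lemma measurable_crect a b c d : measurable (crect a b c d : set T2).
Proof. by rewrite crectE; apply: measurableX; exact: measurable_itv. Qed.

Lemma compact_crect a b c d : compact (crect a b c d).
Proof. by rewrite crectE; apply: compact_setX; exact: segment_compact. Qed.

Lemma open_rat_orect A z : open A -> A z -> exists q1 q2 q3 q4 : rat,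
  orect (ratr q1) (ratr q2) (ratr q3) (ratr q4) z /\
  crect (ratr q1) (ratr q2) (ratr q3) (ratr q4) `<=` A.
Proof.
move=> oA Az; have : nbhs z A by exact: open_nbhs_nbhs.
rewrite -nbhs_ballE => -[e /= e0 eA].
have L x : exists q : rat, x - e < ratr q < x.
  have /rat_in_itvoo[q] : x - e < x by lra.
  by rewrite inE /= => /itvP h; exists q; rewrite !h.
have U x : exists q : rat, x < ratr q < x + e.
  have /rat_in_itvoo[q] : x < x + e by lra.
  by rewrite inE /= => /itvP h; exists q; rewrite !h.
have [q1 /andP[? ?]] := L z.1; have [q2 /andP[? ?]] := U z.1.
have [q3 /andP[? ?]] := L z.2; have [q4 /andP[? ?]] := U z.2.
exists q1, q2, q3, q4; split; first by split; apply/andP; split.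
move=> w [/andP[? ?] /andP[? ?]]; apply: eA; split => /=;
  rewrite /ball /= ltr_norml; apply/andP; split; lra.
Qed.

(** Countability of this covering is what makes open sets of the plane
    measurable for the product of the two Borel structures. *)
Lemma open_bigcup_rat_orect A : open A -> A = \bigcup_(i : rat * rat * (rat * rat))
   [set z | orect (ratr i.1.1) (ratr i.1.2) (ratr i.2.1) (ratr i.2.2) z /\
      crect (ratr i.1.1) (ratr i.1.2) (ratr i.2.1) (ratr i.2.2) `<=` A].
Proof.
move=> oA; apply/seteqP; split => z.
  move=> /(open_rat_orect oA) [q1 [q2 [q3 [q4 H]]]].
  by exists ((q1, q2), (q3, q4)).
move=> [i _ [[/andP[? ?] /andP[? ?]]]]; apply; split; apply/andP; split; exact: ltW.
Qed.

Lemma open_measurable2 A : open A -> measurable (A : set T2).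
Proof.
move=> /open_bigcup_rat_orect ->; apply: countable_bigcupT_measurable => // i.
have [H|H] := pselect (crect (ratr i.1.1) (ratr i.1.2) (ratr i.2.1) (ratr i.2.2) `<=` A).
  rewrite (_ : [set z | _] = orect (ratr i.1.1) (ratr i.1.2) (ratr i.2.1) (ratr i.2.2)).
    exact: measurable_orect.
  by apply/seteqP; split => [z []|z].
rewrite (_ : [set z | _] = set0); first exact: measurable0.
by apply/seteqP; split => [z []|z].
Qed.

Lemma closed_measurable2 A : closed A -> measurable (A : set T2).
Proof.
move=> cA; rewrite -(setCK A); apply: measurableC; apply: open_measurable2.
exact: closed_openC.
Qed.

Lemma continuous_measurable2 f : continuous f -> measurable_fun setT (f : T2 -> R).
Proof.
move=> /continuousP cf; apply: (measurability _ (RGenOpens.measurableE R)).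
move=> _ [_ [a [b ->] <-]]; rewrite setTI; apply: open_measurable2.
exact/cf/interval_open.
Qed.

Lemma continuous_measurable2D f A : measurable (A : set T2) ->
  continuous f -> measurable_fun (A : set T2) (f : T2 -> R).
Proof. by move=> mA cf; apply: measurable_funTS; exact: continuous_measurable2. Qed.

Lemma mu2_crect_fin a b c d : (mu2 (crect a b c d) < +oo)%E.
Proof.
rewrite crectE product_measure1E; [|exact: measurable_itv|exact: measurable_itv].
have H (u v : R) : (lebesgue_measure (`[u, v]%classic : set R) < +oo)%E.
  by rewrite lebesgue_measure_itv /= lte_fin; case: ifP => _; rewrite ?ltry// -EFinB ltry.
apply: lte_mul_pinfty; [exact: measure_ge0| |exact: H].
by rewrite ge0_fin_numE; [exact: H|exact: measure_ge0].
Qed.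

Lemma sub_crect_fin A a b c d : measurable (A : set T2) -> A `<=` crect a b c d ->
  (mu2 A < +oo)%E.
Proof.
move=> mA sA; apply: le_lt_trans (mu2_crect_fin a b c d).
by apply: le_measure => //; rewrite inE//; exact: measurable_crect.
Qed.

Lemma continuous_bounded_rect f a b c d : continuous f ->
  exists2 M, 0 <= M & forall z, crect a b c d z -> `|f z| <= M.
Proof.
move=> cf.
have : compact (f @` crect a b c d).
  apply: continuous_compact; last exact: compact_crect.
  exact: continuous_subspaceT.
move=> /compact_bounded [M0 [_ HM]].
exists (`|M0| + 1); first by rewrite addr_ge0.
move=> z Hz; apply: (HM (`|M0| + 1)); last by exists z.
by rewrite (le_lt_trans (ler_norm _))// ltrDl.
Qed.

Lemma continuous_integrable2 f A a b c d : continuous f -> measurable (A : set T2) ->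
  A `<=` crect a b c d -> mu2.-integrable A (EFin \o f).
Proof.
move=> cf mA sA; have [M M0 HM] := continuous_bounded_rect a b c d cf.
have fA := sub_crect_fin mA sA.
apply: (@integrable_le _ T2 _ mu2 A mA _ (cst M)).
- exact: continuous_measurable2D.
- apply/integrableP; split; first exact/measurable_EFinP.
  rewrite (eq_integral (cst M%:E)); last by move=> z _ /=; rewrite ger0_norm.
  rewrite integral_cst//; apply: lte_mul_pinfty => //.
- by move=> z Az; apply: HM; exact: sA.
Qed.

Lemma continuous_x f y : continuous f -> continuous (fun x => f (x, y)).
Proof.
move=> cf x; apply: (@continuous_comp _ _ _ (fun x => (x, y)) f); last exact: cf.
exact: (@cvg_pair _ _ _ (nbhs x) (nbhs x) (nbhs y) _ _ _ id (fun _ => y) cvg_id (cvg_cst _)).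
Qed.

Lemma continuous_y f x : continuous f -> continuous (fun y => f (x, y)).
Proof.
move=> cf y; apply: (@continuous_comp _ _ _ (fun y => (x, y)) f); last exact: cf.
exact: (@cvg_pair _ _ _ (nbhs y) (nbhs x) (nbhs y) _ _ _ (fun _ => x) id (cvg_cst _) cvg_id).
Qed.

Lemma rect_fubini12 f a b c d : continuous f ->
  \int[mu2]_(z in crect a b c d) f z =
  \int[lebesgue_measure]_(x in `[a, b]) \int[lebesgue_measure]_(y in `[c, d]) f (x, y).
Proof.
move=> cf.
have mC : measurable (crect a b c d : set T2) by exact: measurable_crect.
have iC := continuous_integrable2 cf mC (@subset_refl _ _).
have iC' : mu2.-integrable setT ((EFin \o f) \_ (crect a b c d)).
  exact: (@integrable_mkcond _ T2 R mu2 (crect a b c d) (EFin \o f) mC).1 iC.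
rewrite /Rintegral integral_mkcond -integral12_prod_meas1//.
rewrite [in RHS]integral_mkcond; congr fine; apply: eq_integral => x _.
rewrite /fubini_F /patch; case: ifPn => xab; last first.
  rewrite integral0_eq// => y _; case: ifPn => //; rewrite inE => -[/= H _].
  by move: xab; rewrite notin_setE /= in_itv /= H.
have -> : (fun y => if (x, y) \in crect a b c d then (EFin \o f) (x, y) else 0%E) =
   (fun y => (f (x, y))%:E) \_ `[c, d].
  apply/funext => y; rewrite /patch; congr (if _ then _ else _).
  move: xab; rewrite inE /= in_itv/= => xab.
  apply/idP/idP; rewrite !inE /= in_itv/=; first by case.
  by move=> ?; split.
rewrite -integral_mkcond /= fineK//.
have cfx := continuous_y (x := x) cf.
apply: integrable_fin_num => //.
apply: continuous_compact_integrable; first exact: segment_compact.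
exact: continuous_subspaceT.
Qed.

Lemma rect_fubini21 f a b c d : continuous f ->
  \int[mu2]_(z in crect a b c d) f z =
  \int[lebesgue_measure]_(y in `[c, d]) \int[lebesgue_measure]_(x in `[a, b]) f (x, y).
Proof.
move=> cf.
have mC : measurable (crect a b c d : set T2) by exact: measurable_crect.
have iC := continuous_integrable2 cf mC (@subset_refl _ _).
have iC' : mu2.-integrable setT ((EFin \o f) \_ (crect a b c d)).
  exact: (@integrable_mkcond _ T2 R mu2 (crect a b c d) (EFin \o f) mC).1 iC.
rewrite /Rintegral integral_mkcond -integral21_prod_meas1//.
rewrite [in RHS]integral_mkcond; congr fine; apply: eq_integral => y _.
rewrite /fubini_G /patch; case: ifPn => xab; last first.
  rewrite integral0_eq// => x _; case: ifPn => //; rewrite inE => -[/= _ H].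
  by move: xab; rewrite notin_setE /= in_itv /= H.
have -> : (fun x => if (x, y) \in crect a b c d then (EFin \o f) (x, y) else 0%E) =
   (fun x => (f (x, y))%:E) \_ `[a, b].
  apply/funext => x; rewrite /patch; congr (if _ then _ else _).
  move: xab; rewrite inE /= in_itv/= => xab.
  apply/idP/idP; rewrite !inE /= in_itv/=; first by case.
  by move=> ?; split.
rewrite -integral_mkcond /= fineK//.
have cfx := continuous_x (y := y) cf.
apply: integrable_fin_num => //.
apply: continuous_compact_integrable; first exact: segment_compact.
exact: continuous_subspaceT.
Qed.

Lemma FTC_R (F f : R -> R) (a b : R) : a <= b -> continuous f ->
  (forall x : R, is_derive x (1:R) F (f x)) ->
  \int[lebesgue_measure]_(x in `[a, b]) f x = F b - F a.
Proof.
rewrite le_eqVlt => /orP[/eqP <-|ab] cf dF.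
  by rewrite set_itv1 Rintegral_set1 subrr.
rewrite /Rintegral (@continuous_FTC2 _ f F)//.
- exact: continuous_subspaceT.
- have cF : continuous F.
    by move=> x; apply: differentiable_continuous; apply/derivable1_diffP; case: (dF x).
  split => [x _||]; first by case: (dF x).
  + exact/cvg_at_right_filter/cF.
  + exact/cvg_at_left_filter/cF.
- by move=> x _; rewrite derive1E; case: (dF x).
Qed.

Lemma slice_x f x y : derivable f (x, y) ((1, 0) : R * R) ->
  is_derive x (1:R) (fun t => f (t, y)) (dx f (x, y)).
Proof.
have E : (fun h : R => h^-1 *: ((f \o shift ((x, y) : R * R)) (h *: ((1, 0) : R * R)) - f (x, y))) =
  (fun h : R => h^-1 *: (((fun t => f (t, y)) \o shift x) (h *: 1) - f (x, y))).
  apply/funext => h /=; congr (_ *: (f _ - _)).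
  by congr pair; rewrite /= ?scaler0 ?add0r.
rewrite /derivable /dx /derive E => H; split => //.
Qed.

Lemma slice_y f x y : derivable f (x, y) ((0, 1) : R * R) ->
  is_derive y (1:R) (fun t => f (x, t)) (dy f (x, y)).
Proof.
have E : (fun h : R => h^-1 *: ((f \o shift ((x, y) : R * R)) (h *: ((0, 1) : R * R)) - f (x, y))) =
  (fun h : R => h^-1 *: (((fun t => f (x, t)) \o shift y) (h *: 1) - f (x, y))).
  apply/funext => h /=; congr (_ *: (f _ - _)).
  by congr pair; rewrite /= ?scaler0 ?add0r.
rewrite /derivable /dy /derive E => H; split => //.
Qed.

Lemma rect_dx f a b c d : a <= b -> Ck 1 f ->
  \int[mu2]_(z in crect a b c d) dx f z =
  \int[lebesgue_measure]_(y in `[c, d]) (f (b, y) - f (a, y)).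
Proof.
move=> ab [cf [dfx dfy [cdx _] _]]; rewrite rect_fubini21//.
apply: eq_Rintegral => y _.
have H x : is_derive x (1:R) (fun t => f (t, y)) (dx f (x, y)) by exact: slice_x.
by rewrite (FTC_R ab (continuous_x (y := y) cdx) H).
Qed.

Lemma rect_dy f a b c d : c <= d -> Ck 1 f ->
  \int[mu2]_(z in crect a b c d) dy f z =
  \int[lebesgue_measure]_(x in `[a, b]) (f (x, d) - f (x, c)).
Proof.
move=> ab [cf [dfx dfy _ [cdy _]]]; rewrite rect_fubini12//.
apply: eq_Rintegral => x _.
have H y : is_derive y (1:R) (fun t => f (x, t)) (dy f (x, y)) by exact: slice_y.
by rewrite (FTC_R ab (continuous_y (x := x) cdy) H).
Qed.

Lemma rect_dydx f a b c d : a <= b -> c <= d -> Ck 2 f ->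
  \int[mu2]_(z in crect a b c d) dy (dx f) z =
  f (b, d) - f (a, d) - f (b, c) + f (a, c).
Proof.
move=> ab cd [cf [dfx dfy Hdx _]]; rewrite rect_dy//.
have c1 y : continuous (fun x => dx f (x, y)) by apply: continuous_x; case: Hdx.
have c2 : continuous (fun x => dx f (x, d) - dx f (x, c)).
  by move=> x; apply: cvgB; apply: c1.
have H x : is_derive x (1:R) (fun x => f (x, d) - f (x, c)) (dx f (x, d) - dx f (x, c)).
  by apply: is_deriveB; apply: slice_x.
by rewrite (FTC_R ab c2 H); lra.
Qed.

End Plane.

(** * Calculus of smooth functions *)

Section Smooth.
Context {R : realType}.
Implicit Types (f g : R * R -> R) (A : set (R * R)).

Lemma derive1D (f g : R -> R) (x df dg : R) : is_derive x (1:R) f df ->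
  is_derive x (1:R) g dg -> is_derive x (1:R) (fun t => f t + g t) (df + dg).
Proof. by move=> *; exact: is_deriveD. Qed.

Lemma derive1Ml (k : R) (f : R -> R) (x df : R) : is_derive x (1:R) f df ->
  is_derive x (1:R) (fun t => k * f t) (k * df).
Proof. by move=> *; exact: is_deriveZ. Qed.

Lemma derive1M (f g : R -> R) (x df dg : R) : is_derive x (1:R) f df ->
  is_derive x (1:R) g dg -> is_derive x (1:R) (fun t => f t * g t) (df * g x + f x * dg).
Proof.
move=> H1 H2; apply: (is_derive_eq (is_deriveM H1 H2)).
by rewrite /GRing.scale /=; lra.
Qed.

Lemma derive1X n (f : R -> R) (x df : R) : is_derive x (1:R) f df ->
  is_derive x (1:R) (fun t => f t ^+ n) (n%:R * f x ^+ n.-1 * df).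
Proof.
move=> H; elim: n => [|n IH].
  by rewrite !mul0r; apply: is_derive_cst.
rewrite (_ : (fun t => _) = (fun t => f t * f t ^+ n)); last first.
  by apply/funext => t; rewrite exprS.
apply: (is_derive_eq (derive1M H IH)); case: n {IH} => [|n] /=.
  by rewrite !expr0; lra.
by rewrite exprS -[in RHS]natr1; lra.
Qed.

Lemma derive1_continuous (f df : R -> R) :
  (forall x : R, is_derive x (1:R) f (df x)) -> continuous f.
Proof.
move=> H x; apply: differentiable_continuous; apply/derivable1_diffP.
by case: (H x).
Qed.

Definition has_partials f fx fy := forall x y,
  is_derive x (1:R) (fun t => f (t, y)) (fx (x, y)) /\
  is_derive y (1:R) (fun t => f (x, t)) (fy (x, y)).

Lemma slice_xP f x y (d : R) : is_derive x (1:R) (fun t => f (t, y)) d ->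
  derivable f (x, y) ((1, 0) : R * R) /\ dx f (x, y) = d.
Proof.
have E : (fun h : R => h^-1 *: ((f \o shift ((x, y) : R * R)) (h *: ((1, 0) : R * R)) - f (x, y))) =
  (fun h : R => h^-1 *: (((fun t => f (t, y)) \o shift x) (h *: 1) - f (x, y))).
  apply/funext => h /=; congr (_ *: (f _ - _)).
  by congr pair; rewrite /= ?scaler0 ?add0r.
by rewrite /derivable /dx /derive E => -[H1 H2]; split.
Qed.

Lemma slice_yP f x y (d : R) : is_derive y (1:R) (fun t => f (x, t)) d ->
  derivable f (x, y) ((0, 1) : R * R) /\ dy f (x, y) = d.
Proof.
have E : (fun h : R => h^-1 *: ((f \o shift ((x, y) : R * R)) (h *: ((0, 1) : R * R)) - f (x, y))) =
  (fun h : R => h^-1 *: (((fun t => f (x, t)) \o shift y) (h *: 1) - f (x, y))).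
  apply/funext => h /=; congr (_ *: (f _ - _)).
  by congr pair; rewrite /= ?scaler0 ?add0r.
by rewrite /derivable /dy /derive E => -[H1 H2]; split.
Qed.

Lemma has_partialsE f fx fy : has_partials f fx fy -> dx f = fx /\ dy f = fy.
Proof.
move=> H; split; apply/funext => -[x y]; have [H1 H2] := H x y.
  by case: (slice_xP H1).
by case: (slice_yP H2).
Qed.

Lemma Ck_continuous k f : Ck k f -> continuous f.
Proof. by case: k => [|k] []. Qed.

Lemma Ck_partials k f : Ck k.+1 f -> has_partials f (dx f) (dy f).
Proof.
move=> [cf [Hx Hy _ _]] x y; split; [exact: slice_x|exact: slice_y].
Qed.

Lemma Ck_dx k f : Ck k.+1 f -> Ck k (dx f). Proof. by case=> _ []. Qed.
Lemma Ck_dy k f : Ck k.+1 f -> Ck k (dy f). Proof. by case=> _ []. Qed.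

Lemma Ck_intro k f fx fy : continuous f -> has_partials f fx fy ->
  Ck k fx -> Ck k fy -> Ck k.+1 f.
Proof.
move=> cf H Hx Hy; have [Ex Ey] := has_partialsE H.
split => //; rewrite Ex Ey; split => // -[x y].
  by case: (slice_xP (H x y).1).
by case: (slice_yP (H x y).2).
Qed.

Lemma CkS k f : Ck k.+1 f -> Ck k f.
Proof.
elim: k f => [f [cf _]|k IH f Hf]; first by split.
apply: Ck_intro (Ck_partials Hf) _ _; first exact: Ck_continuous Hf.
  exact: IH (Ck_dx Hf).
exact: IH (Ck_dy Hf).
Qed.

Lemma has_partialsD f fx fy g gx gy : has_partials f fx fy -> has_partials g gx gy ->
  has_partials (fun z => f z + g z) (fun z => fx z + gx z) (fun z => fy z + gy z).
Proof.
by move=> Hf Hg x y; have [? ?] := Hf x y; have [? ?] := Hg x y; split; exact: derive1D.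
Qed.

Lemma has_partialsZ k f fx fy : has_partials f fx fy ->
  has_partials (fun z => k * f z) (fun z => k * fx z) (fun z => k * fy z).
Proof. by move=> Hf x y; have [? ?] := Hf x y; split; exact: derive1Ml. Qed.

Lemma has_partialsM f fx fy g gx gy : has_partials f fx fy -> has_partials g gx gy ->
  has_partials (fun z => f z * g z) (fun z => fx z * g z + f z * gx z)
     (fun z => fy z * g z + f z * gy z).
Proof.
move=> Hf Hg x y; have [H1 H2] := Hf x y; have [H3 H4] := Hg x y; split.
  exact: (derive1M H1 H3).
exact: (derive1M H2 H4).
Qed.

Lemma continuousM2 f g : continuous f -> continuous g -> continuous (fun z => f z * g z).
Proof. by move=> cf cg x; apply: cvgM; [exact: cf|exact: cg]. Qed.

Lemma continuousD2 f g : continuous f -> continuous g -> continuous (fun z => f z + g z).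
Proof. by move=> cf cg x; apply: cvgD; [exact: cf|exact: cg]. Qed.

Lemma continuousZ2 (k : R) f : continuous f -> continuous (fun z => k * f z).
Proof. by move=> cf; apply: continuousM2 => // x; exact: cvg_cst. Qed.

Lemma CkD k f g : Ck k f -> Ck k g -> Ck k (fun z => f z + g z).
Proof.
elim: k f g => [f g [cf _] [cg _]|k IH f g Hf Hg].
  by split => //; exact: continuousD2.
apply: (Ck_intro _ (has_partialsD (Ck_partials Hf) (Ck_partials Hg))).
- by apply: continuousD2; [exact: Ck_continuous Hf|exact: Ck_continuous Hg].
- by apply: IH; exact: Ck_dx.
- by apply: IH; exact: Ck_dy.
Qed.

Lemma CkZ k (c : R) f : Ck k f -> Ck k (fun z => c * f z).
Proof.
elim: k f => [f [cf _]|k IH f Hf]; first by split => //; exact: continuousZ2.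
apply: (Ck_intro _ (has_partialsZ c (Ck_partials Hf))).
- by apply: continuousZ2; exact: Ck_continuous Hf.
- by apply: IH; exact: Ck_dx.
- by apply: IH; exact: Ck_dy.
Qed.

Lemma CkM k f g : Ck k f -> Ck k g -> Ck k (fun z => f z * g z).
Proof.
elim: k f g => [f g [cf _] [cg _]|k IH f g Hf Hg].
  by split => //; exact: continuousM2.
apply: (Ck_intro _ (has_partialsM (Ck_partials Hf) (Ck_partials Hg))).
- by apply: continuousM2; [exact: Ck_continuous Hf|exact: Ck_continuous Hg].
- by apply: CkD; apply: IH; [exact: Ck_dx|exact: CkS|exact: CkS|exact: Ck_dx].
- by apply: CkD; apply: IH; [exact: Ck_dy|exact: CkS|exact: CkS|exact: Ck_dy].
Qed.

Lemma Ck_cst k (c : R) : Ck k (fun _ => c).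
Proof.
elim: k c => [c|k IH c]; first by split => // x; exact: cvg_cst.
apply: (@Ck_intro k _ (fun=> 0) (fun=> 0)) => //; first by move=> x; exact: cvg_cst.
by move=> x y; split; exact: is_derive_cst.
Qed.

Lemma Ck_expR k f : Ck k f -> Ck k (fun z => expR (f z)).
Proof.
have cE g : continuous g -> continuous (fun z => expR (g z)).
  by move=> cg x; apply: continuous_comp; [exact: cg|exact: continuous_expR].
elim: k f => [f [cf _]|k IH f Hf]; first by split => //; exact: cE.
have HE : has_partials (fun z => expR (f z)) (fun z => expR (f z) * dx f z)
    (fun z => expR (f z) * dy f z).
  move=> x y; have [H1 H2] := Ck_partials Hf x y; split.
    exact: (is_derive1_comp (f := expR) (is_derive_expR _) H1).
  exact: (is_derive1_comp (f := expR) (is_derive_expR _) H2).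
apply: (Ck_intro _ HE).
- by apply: cE; exact: Ck_continuous Hf.
- by apply: CkM; [exact/IH/CkS|exact: Ck_dx].
- by apply: CkM; [exact/IH/CkS|exact: Ck_dy].
Qed.

Lemma smooth_dx f : smooth f -> smooth (dx f).
Proof. by move=> sf k; exact: Ck_dx (sf k.+1). Qed.
Lemma smooth_dy f : smooth f -> smooth (dy f).
Proof. by move=> sf k; exact: Ck_dy (sf k.+1). Qed.
Lemma smooth_continuous f : smooth f -> continuous f.
Proof. by move=> sf; exact: Ck_continuous (sf 0%N). Qed.

(** The functions [t ^- k * exp (- 1 / t)] are closed under differentiation up
    to linear combinations, which makes them all smooth at once. *)
Definition flat (k : nat) (t : R) : R :=
  if 0 < t then t^-1 ^+ k * expR (- t^-1) else 0.

Lemma flat_ge0 k t : 0 <= flat k t.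
Proof.
rewrite /flat; case: ifPn => // t0.
by rewrite mulr_ge0 ?exprn_ge0 ?invr_ge0 ?expR_ge0 ?ltW.
Qed.

Lemma flat_gt0 k t : (0 < flat k t) = (0 < t).
Proof.
rewrite /flat; case: ifPn => [t0|_]; last by rewrite ltxx.
by rewrite mulr_gt0 ?exprn_gt0 ?invr_gt0 ?expR_gt0.
Qed.

Lemma flat_le k t : flat k t <= (k.+1)`!%:R * `|t|.
Proof.
rewrite /flat; case: ifPn => [t0|_]; last by rewrite mulr_ge0.
have f0 : 0 < (k.+1)`!%:R :> R by rewrite ltr0n fact_gt0.
have tV : 0 < t^-1 by rewrite invr_gt0.
have := expR_ge1Dxn k (ltW tV) => H.
have {}H : t^-1 ^+ k.+1 / (k.+1)`!%:R <= expR t^-1 by lra.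
rewrite expRN (gtr0_norm t0) ler_pdivrMr ?expR_gt0//.
have E : t^-1 ^+ k = (k.+1)`!%:R * t * (t^-1 ^+ k.+1 / (k.+1)`!%:R).
  set F := (k.+1)`!%:R in f0 *.
  have -> : F * t * (t^-1 ^+ k.+1 / F) = (F / F) * (t / t) * t^-1 ^+ k.
    by rewrite exprS; lra.
  by rewrite !divff ?gt_eqF// !mul1r.
by rewrite {1}E; apply: ler_wpM2l => //; rewrite mulr_ge0 ?ltW.
Qed.

Lemma flat_derive k t : is_derive t (1:R) (flat k) (- k%:R * flat k.+1 t + flat k.+2 t).
Proof.
have [t0|t0|<-] := ltgtP (0 : R) t.
- have N : \near t, t^-1 ^+ k * expR (- t^-1) = flat k t.
    near=> u; rewrite /flat ifT//; near: u; exact: lt_nbhsr.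
  apply: (near_eq_is_derive N).
  have dV : is_derive t (1:R) (fun s : R => s^-1) (- t ^- 2).
    apply: (is_derive_eq (is_deriveV (f := id) _ (is_derive_id _ _))).
      by rewrite gt_eqF.
    by rewrite /GRing.scale /= mulr1.
  have dX : is_derive t (1:R) (fun s : R => s^-1 ^+ k) (k%:R * t^-1 ^+ k.-1 * - t ^- 2).
    exact: derive1X.
  have dE : is_derive t (1:R) (fun s : R => expR (- s^-1)) (expR (- t^-1) * t ^- 2).
    have dN : is_derive t (1:R) (fun s : R => - s^-1) (t ^- 2).
      by apply: (is_derive_eq (is_deriveN dV)); rewrite opprK.
    exact: (is_derive1_comp (f := expR) (is_derive_expR _) dN).
  apply: (is_derive_eq (derive1M dX dE)).
  rewrite /flat t0 -exprVn; case: k {N dX} => [|k] /=; first by rewrite !mul0r oppr0 !mul0r !add0r; lra.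
  by rewrite !exprS; lra.
- have N : \near t, (cst 0 : R -> R) t = flat k t.
    near=> u; rewrite /flat ifF//; apply/negbTE; rewrite -leNgt ltW//; near: u; exact: lt_nbhsl.
  apply: (near_eq_is_derive N).
  apply: (is_derive_eq (is_derive_cst _ _ _)).
  by rewrite /flat !ltNge (ltW t0) /= mulr0 addr0.
- have E : flat k.+1 0 = 0 /\ flat k.+2 0 = 0 by rewrite /flat ltxx.
  rewrite E.1 E.2 mulr0 addr0.
  suff H : (fun h : R => h^-1 *: ((flat k \o shift (0:R)) (h *: (1:R)) - flat k 0)) @ 0^' --> (0 : R).
    by split; [exact: (cvgP _ H)|apply/cvg_lim].
  apply/cvgrPdist_le => e e0.
  have M0 : 0 < (k.+2)`!%:R :> R by rewrite ltr0n fact_gt0.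
  near=> h.
  have hn : h != 0 by near: h; exact: nbhs_dnbhs_neq.
  rewrite sub0r normrN /= /shift /= addr0 {2}/flat ltxx subr0.
  rewrite /GRing.scale /= mulr1.
  have -> : h^-1 * flat k h = flat k.+1 h.
    by rewrite /flat; case: ifPn => // _; rewrite ?mulr0 // mulrA -exprS.
  rewrite ger0_norm ?flat_ge0//; apply: le_trans (flat_le _ _) _.
  rewrite -ler_pdivlMl// mulrC.
  near: h; apply: dnbhs0_le.
  by rewrite divr_gt0.
Unshelve. all: by end_near. Qed.

Lemma flat_continuous k : continuous (flat k).
Proof. exact: derive1_continuous (flat_derive k). Qed.

(** The induction on [n] carries all [k] at once, since a derivative is a
    combination of the functions of indices [k + 1] and [k + 2]. *)
Lemma Ck_flat n k (a b c : R) : Ck n (fun z => flat k (a * z.1 + b * z.2 + c)).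
Proof.
have cA : continuous (fun z : R * R => a * z.1 + b * z.2 + c).
  move=> z; apply: cvgD; last exact: cvg_cst.
  by apply: cvgD; apply: cvgM; [exact: cvg_cst|exact: cvg_fst|exact: cvg_cst|exact: cvg_snd].
have cF j : continuous (fun z : R * R => flat j (a * z.1 + b * z.2 + c)).
  move=> z; apply: (@continuous_comp _ _ _ (fun z : R * R => a * z.1 + b * z.2 + c) (flat j)).
    exact: cA.
  exact: flat_continuous.
elim: n k => [k|n IH k]; first by split.
pose F z := - k%:R * flat k.+1 (a * z.1 + b * z.2 + c) + flat k.+2 (a * z.1 + b * z.2 + c).
have HF : has_partials (fun z => flat k (a * z.1 + b * z.2 + c))
   (fun z => a * F z) (fun z => b * F z).
  move=> x y; rewrite ![_ * F _]mulrC /F /=; split.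
    apply: (is_derive1_comp (f := flat k) (flat_derive k _)).
    have H : is_derive x (1:R) (fun t => a * t + (b * y + c)) (a * 1 + 0).
      by apply: derive1D.
    rewrite (_ : (fun t => _) = (fun t => a * t + (b * y + c))); last by apply/funext => t; lra.
    by apply: (is_derive_eq H); lra.
  apply: (is_derive1_comp (f := flat k) (flat_derive k _)).
  have H : is_derive y (1:R) (fun t => b * t + (a * x + c)) (b * 1 + 0).
    by apply: derive1D.
  rewrite (_ : (fun t => _) = (fun t => b * t + (a * x + c))); last by apply/funext => t; lra.
  by apply: (is_derive_eq H); lra.
apply: (Ck_intro _ HF) => //; apply: CkZ; apply: CkD => //; exact: CkZ.
Qed.

End Smooth.

(** * Test functions: symmetry of second derivatives and energy estimates *)

Section Schwarz.
Context {R : realType}.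
Local Notation T2 := (measurableTypeR R * measurableTypeR R)%type.
Local Notation mu2 := (leb2 R).
Implicit Types (f g : R * R -> R) (A : set (R * R)).

Lemma mu2_crect (a b c d : R) : a <= b -> c <= d ->
  fine (mu2 (crect a b c d)) = (b - a) * (d - c).
Proof.
move=> ab cd; rewrite crectE product_measure1E; [|exact: measurable_itv|exact: measurable_itv].
have H (u v : R) : u <= v -> lebesgue_measure (`[u, v]%classic : set R) = (v - u)%:E.
  move=> uv; rewrite lebesgue_measure_itv /= lte_fin; case: ifPn => [_|]; first by rewrite -EFinB.
  by rewrite -leNgt => vu; congr EFin; lra.
by have := H _ _ ab; have := H _ _ cd => /= -> ->.
Qed.

(** Where [g] is positive it is bounded below on a small square; the same applies
    to [- g]. *)
Lemma cont_rect_eq0 g : continuous g ->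
  (forall a b c d : R, a <= b -> c <= d -> \int[mu2]_(z in crect a b c d) g z = 0) ->
  forall z, g z = 0.
Proof.
suff H h : continuous h ->
  (forall a b c d : R, a <= b -> c <= d -> \int[mu2]_(z in crect a b c d) h z = 0) ->
  forall z, h z <= 0.
  move=> cg ig z; apply/le_anti; rewrite (H g cg ig) /= -oppr_le0.
  apply: (H (fun z => - g z)) => [w|a b c d ab cd]; first by apply: cvgN; exact: cg.
  have mC : measurable (crect a b c d : set T2) by exact: measurable_crect.
  rewrite (_ : (fun z => _) = (fun z => -1 * g z)); last by apply/funext => w; lra.
  rewrite RintegralZl ?ig ?mulr0//.
  exact: (continuous_integrable2 cg mC (@subset_refl _ _)).
move=> ch ih z; rewrite leNgt; apply/negP => hz.
have : nbhs z [set w | h z / 2 < h w].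
  by apply: (ch z [set u | h z / 2 < u]); apply: lt_nbhsr; lra.
rewrite -nbhs_ballE => -[e /= e0 He].
have [k k0 ke] : exists2 k, 0 < k & k < e by exists (e / 2); lra.
pose C := crect (z.1 - k) (z.1 + k) (z.2 - k) (z.2 + k).
have mC : measurable (C : set T2) by exact: measurable_crect.
have Cb : C `<=` [set w | h z / 2 < h w].
  move=> w [/andP[? ?] /andP[? ?]]; apply: He; split; rewrite /ball /= ltr_norml;
   apply/andP; split; lra.
have l1 : z.1 - k <= z.1 + k by lra.
have l2 : z.2 - k <= z.2 + k by lra.
have := ih _ _ _ _ l1 l2; rewrite -/C => I0.
have : \int[mu2]_(w in C) (h z / 2) <= \int[mu2]_(w in C) h w.
  apply: le_Rintegral => //.
  - apply: (continuous_integrable2 _ mC (@subset_refl _ _)) => w; exact: cvg_cst.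
  - exact: (continuous_integrable2 ch mC (@subset_refl _ _)).
  - by move=> w /Cb /ltW.
rewrite I0 Rintegral_cst// mu2_crect//.
have P : 0 < h z / 2 * ((z.1 + k - (z.1 - k)) * (z.2 + k - (z.2 - k))).
  by rewrite !mulr_gt0//; lra.
by rewrite leNgt P.
Qed.

Lemma rect_dxdy f a b c d : a <= b -> c <= d -> Ck 2 f ->
  \int[mu2]_(z in crect a b c d) dx (dy f) z =
  f (b, d) - f (a, d) - f (b, c) + f (a, c).
Proof.
move=> ab cd [cf [dfx dfy _ Hdy]]; rewrite rect_dx//.
have c1 x : continuous (fun y => dy f (x, y)) by apply: continuous_y; case: Hdy.
have c2 : continuous (fun y => dy f (b, y) - dy f (a, y)).
  by move=> x; apply: cvgB; apply: c1.
have H y : is_derive y (1:R) (fun y => f (b, y) - f (a, y)) (dy f (b, y) - dy f (a, y)).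
  by apply: is_deriveB; apply: slice_y.
by rewrite (FTC_R cd c2 H); lra.
Qed.

(** Both mixed derivatives integrate over any rectangle to the alternating sum
    of the corner values, so they coincide. *)
Lemma dx_dyC f : Ck 2 f -> dx (dy f) = dy (dx f).
Proof.
move=> Cf; apply/funext => z; apply/eqP; rewrite -subr_eq0; apply/eqP.
have c1 : continuous (dx (dy f)) := Ck_continuous (Ck_dx (Ck_dy Cf)).
have c2 : continuous (dy (dx f)) := Ck_continuous (Ck_dy (Ck_dx Cf)).
move: z; apply: cont_rect_eq0.
  by move=> z; apply: cvgB; [exact: c1|exact: c2].
move=> a b c d ab cd.
have mC : measurable (crect a b c d : set T2) by exact: measurable_crect.
rewrite RintegralB//.
- have e1 := rect_dxdy ab cd Cf; have e2 := rect_dydx ab cd Cf.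
  exact: (etrans (congr2 (fun u v => u - v) e1 e2) (subrr _)).
- exact: (continuous_integrable2 c1 mC (@subset_refl _ _)).
- exact: (continuous_integrable2 c2 mC (@subset_refl _ _)).
Qed.

Definition supp_in (Omega : set (R * R)) f := exists K : set (R * R),
  [/\ compact K, K `<=` Omega & forall z, ~ K z -> f z = 0].

Lemma test_functionP (Omega : set (R * R)) f :
  test_function Omega f <-> smooth f /\ supp_in Omega f.
Proof.
split => [[sf cf sO]|[sf [K [cK KO fK]]]].
  split => //; exists (closure [set z | f z != 0]); split => // z Hz.
  by apply/eqP; apply: contrapT => /negP H; apply: Hz; exact: subset_closure.
have clK : closed K by apply: compact_closed => //; exact: norm_hausdorff.
have sK : closure [set z | f z != 0] `<=` K.
  move=> z Hc; apply: contrapT => Kz.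
  have [w [/= fw Kw]] := Hc (~` K) (open_nbhs_nbhs (conj (closed_openC clK) Kz)).
  by move: fw; rewrite fK ?eqxx.
split => //; last exact: subset_trans KO.
by apply: subclosed_compact sK => //; exact: closed_closure.
Qed.

Lemma deriv0_off (K : set (R * R)) f : closed K -> (forall z, ~ K z -> f z = 0) ->
  forall z, ~ K z -> dx f z = 0 /\ dy f z = 0.
Proof.
move=> clK fK z Kz.
have N : \near z, cst 0 z = f z.
  have : nbhs z (~` K) by apply: open_nbhs_nbhs; split => //; exact: closed_openC.
  by apply: filterS => w /fK ->.
by rewrite /dx /dy -!(near_eq_derive _ N) !derive_cst.
Qed.

(** Sealed copies of the partial derivatives: distinct derivatives of a function
    are then syntactically rigid. *)
Definition px : (R * R -> R) -> R * R -> R := locked_with seal_key dx.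
Definition py : (R * R -> R) -> R * R -> R := locked_with seal_key dy.
Lemma pxE : px = dx. Proof. by rewrite /px unlock. Qed.
Lemma pyE : py = dy. Proof. by rewrite /py unlock. Qed.

Lemma smooth_px f : smooth f -> smooth (px f).
Proof. by rewrite pxE; exact: smooth_dx. Qed.
Lemma smooth_py f : smooth f -> smooth (py f).
Proof. by rewrite pyE; exact: smooth_dy. Qed.

Lemma supp_in_d (Omega : set (R * R)) f : supp_in Omega f ->
  supp_in Omega (px f) /\ supp_in Omega (py f).
Proof.
move=> [K [cK KO fK]].
have clK : closed K by apply: compact_closed => //; exact: norm_hausdorff.
by rewrite pxE pyE; split; exists K; split => // z Kz; have [] := deriv0_off clK fK Kz.
Qed.

Section Test.
Variable Omega : set (R * R).
Local Notation test := (test_function Omega).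

Lemma test_smooth f : test f -> smooth f. Proof. by case. Qed.
Lemma test_continuous f : test f -> continuous f.
Proof. by move=> /test_smooth/smooth_continuous. Qed.

Lemma test_off f : test f -> forall z, ~ Omega z -> f z = 0.
Proof. by move=> /test_functionP[_ [K [_ KO fK]]] z Oz; apply: fK => /KO. Qed.

Lemma test_px f : test f -> test (px f).
Proof.
move=> /test_functionP[sf sO]; apply/test_functionP; split; first exact: smooth_px.
by case: (supp_in_d sO).
Qed.

Lemma test_py f : test f -> test (py f).
Proof.
move=> /test_functionP[sf sO]; apply/test_functionP; split; first exact: smooth_py.
by case: (supp_in_d sO).
Qed.

Lemma testM f g : smooth f -> test g -> test (fun z => f z * g z).
Proof.
move=> sf /test_functionP[sg [K [cK KO gK]]]; apply/test_functionP.
split; first by move=> k; apply: CkM.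
by exists K; split => // z /gK ->; rewrite mulr0.
Qed.

Lemma testZ c g : test g -> test (fun z => c * g z).
Proof. by move=> tg; apply: testM => // k; exact: Ck_cst. Qed.

Lemma testD f g : test f -> test g -> test (f \+ g).
Proof.
move=> /test_functionP[sf [L [cL LO fL]]] /test_functionP[sg [K [cK KO gK]]].
apply/test_functionP; split; first by move=> k; exact: CkD.
exists (L `|` K); split; first exact: compactU.
  by move=> z [/LO|/KO].
by move=> z /not_orP[/fL fz /gK gz] /=; rewrite fz gz addr0.
Qed.

Lemma testB f g : test f -> test g -> test (f \- g).
Proof.
move=> tf tg; rewrite (_ : f \- g = f \+ (fun z => -1 * g z)); last first.
  by apply/funext => z /=; lra.
by apply: testD => //; exact: testZ.
Qed.

Lemma pxD f g : smooth f -> smooth g -> px (f \+ g) = px f \+ px g.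
Proof.
by move=> sf sg; rewrite ?pxE ?pyE; exact: (has_partialsE (has_partialsD (Ck_partials (sf 1%N)) (Ck_partials (sg 1%N)))).1.
Qed.
Lemma pyD f g : smooth f -> smooth g -> py (f \+ g) = py f \+ py g.
Proof.
by move=> sf sg; rewrite ?pxE ?pyE; exact: (has_partialsE (has_partialsD (Ck_partials (sf 1%N)) (Ck_partials (sg 1%N)))).2.
Qed.
Lemma pxZ c f : smooth f -> px (fun z => c * f z) = (fun z => c * px f z).
Proof. by move=> sf; rewrite ?pxE ?pyE; exact: (has_partialsE (has_partialsZ c (Ck_partials (sf 1%N)))).1. Qed.
Lemma pyZ c f : smooth f -> py (fun z => c * f z) = (fun z => c * py f z).
Proof. by move=> sf; rewrite ?pxE ?pyE; exact: (has_partialsE (has_partialsZ c (Ck_partials (sf 1%N)))).2. Qed.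
Lemma pxM f g : smooth f -> smooth g ->
  px (fun z => f z * g z) = (fun z => px f z * g z + f z * px g z).
Proof.
by move=> sf sg; rewrite ?pxE ?pyE; exact: (has_partialsE (has_partialsM (Ck_partials (sf 1%N)) (Ck_partials (sg 1%N)))).1.
Qed.
Lemma pyM f g : smooth f -> smooth g ->
  py (fun z => f z * g z) = (fun z => py f z * g z + f z * py g z).
Proof.
by move=> sf sg; rewrite ?pxE ?pyE; exact: (has_partialsE (has_partialsM (Ck_partials (sf 1%N)) (Ck_partials (sg 1%N)))).2.
Qed.

Lemma smoothD f g : smooth f -> smooth g -> smooth (f \+ g).
Proof. by move=> sf sg k; exact: CkD. Qed.
Lemma smoothM f g : smooth f -> smooth g -> smooth (fun z => f z * g z).
Proof. by move=> sf sg k; exact: CkM. Qed.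
Lemma smoothZ c f : smooth f -> smooth (fun z => c * f z).
Proof. by move=> sf k; exact: CkZ. Qed.

Lemma smooth_pxpyC f : smooth f -> px (py f) = py (px f).
Proof. by move=> sf; rewrite pxE pyE; exact: dx_dyC. Qed.

Variable r : R.
Hypothesis oO : open Omega.
Hypothesis r0 : 0 < r.
Hypothesis OB : Omega `<=` orect (- r) r (- r) r.
Let mO : measurable (Omega : set T2) := open_measurable2 oO.
Let OBc : Omega `<=` crect (- r) r (- r) r.
Proof.
move=> z /OB [/andP[? ?] /andP[? ?]]; split; apply/andP; split; exact: ltW.
Qed.
Local Notation box := (crect (- r) r (- r) r).
Local Notation ip := (inner mu2 Omega).
Local Notation nrm := (l2norm mu2 Omega).

Lemma cont_integrable f : continuous f -> mu2.-integrable Omega (EFin \o f).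
Proof. by move=> cf; exact: continuous_integrable2 cf mO OBc. Qed.

Lemma cont_sqi f : continuous f -> sqi mu2 Omega f.
Proof.
move=> cf; split; first exact: continuous_measurable2D.
by apply: cont_integrable; exact: continuousM2.
Qed.

Lemma test_sqi f : test f -> sqi mu2 Omega f.
Proof. by move=> /test_continuous/cont_sqi. Qed.

Lemma int_box f : (forall z, ~ Omega z -> f z = 0) ->
  \int[mu2]_(z in Omega) f z = \int[mu2]_(z in box) f z.
Proof.
move=> f0; rewrite Rintegral_mkcond [RHS]Rintegral_mkcond.
apply: eq_Rintegral => z _; rewrite /patch; case: ifPn => [|] Hz.
  by rewrite ifT// inE; apply: OBc; rewrite inE in Hz.
by case: ifPn => // _; rewrite f0//; rewrite notin_setE in Hz.
Qed.

Lemma off_edge f x y : test f -> ~ (- r < x < r /\ - r < y < r) -> f (x, y) = 0.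
Proof. by move=> tf H; apply: (test_off tf) => /OB. Qed.

Lemma int_px0 f : test f -> \int[mu2]_(z in Omega) px f z = 0.
Proof.
move=> tf; rewrite int_box; last exact/test_off/test_px.
have rr : - r <= r by have := r0; lra.
rewrite pxE (rect_dx _ _ rr (test_smooth tf 1)).
rewrite (@eq_Rintegral _ _ _ _ _ (cst 0)); first by rewrite Rintegral_cst// mul0r.
by move=> y _; rewrite !(off_edge tf) ?subrr// => -[]; rewrite ltxx ?andbF.
Qed.

Lemma int_py0 f : test f -> \int[mu2]_(z in Omega) py f z = 0.
Proof.
move=> tf; rewrite int_box; last exact/test_off/test_py.
have rr : - r <= r by have := r0; lra.
rewrite pyE (rect_dy _ _ rr (test_smooth tf 1)).
rewrite (@eq_Rintegral _ _ _ _ _ (cst 0)); first by rewrite Rintegral_cst// mul0r.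
by move=> y _; rewrite !(off_edge tf) ?subrr// => -[_]; rewrite ltxx ?andbF.
Qed.

Lemma ibp_x f g : smooth f -> test g -> ip f (px g) = - ip (px f) g.
Proof.
move=> sf tg; have sg := test_smooth tg.
have := int_px0 (testM sf tg); rewrite pxM// RintegralD//.
- by rewrite -(ipE mu2 Omega (px f) g) -(ipE mu2 Omega f (px g)) => /eqP; rewrite addrC addr_eq0 => /eqP.
- by apply: cont_integrable; apply: continuousM2; apply: smooth_continuous => //; exact: smooth_px.
- by apply: cont_integrable; apply: continuousM2; apply: smooth_continuous => //; exact: smooth_px.
Qed.

Lemma ibp_y f g : smooth f -> test g -> ip f (py g) = - ip (py f) g.
Proof.
move=> sf tg; have sg := test_smooth tg.
have := int_py0 (testM sf tg); rewrite pyM// RintegralD//.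
- by rewrite -(ipE mu2 Omega (py f) g) -(ipE mu2 Omega f (py g)) => /eqP; rewrite addrC addr_eq0 => /eqP.
- by apply: cont_integrable; apply: continuousM2; apply: smooth_continuous => //; exact: smooth_py.
- by apply: cont_integrable; apply: continuousM2; apply: smooth_continuous => //; exact: smooth_py.
Qed.

(** Moving one derivative in each variable across the product. Hence the square
    of the Laplacian integrates to that of the whole Hessian, as in [ip_lap]. *)
Lemma ip_xy f : test f -> ip (py (px f)) (py (px f)) = ip (px (px f)) (py (py f)).
Proof.
move=> tf; have sf := test_smooth tf.
have e1 := ibp_x (smooth_px sf) (test_py (test_py tf)).
have e2 := ibp_y (smooth_px sf) (test_py (test_px tf)).
have E : py (py (px f)) = px (py (py f)).
  by rewrite (smooth_pxpyC (smooth_py sf)) (smooth_pxpyC sf).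
exact: (oppr_inj (etrans (esym e2) (etrans (congr1 (ip (px f)) E) e1))).
Qed.

(** The alternating sum of the corner values is the integral of the mixed
    derivative over the rectangle; Cauchy-Schwarz pairs it with the constant 1. *)
Lemma rect_bound f a b c d : test f -> - r <= a -> a <= b -> b <= r ->
  - r <= c -> c <= d -> d <= r ->
  (f (b, d) - f (a, d) - f (b, c) + f (a, c)) ^+ 2 <=
  (b - a) * (d - c) * ip (py (px f)) (py (px f)).
Proof.
move=> tf ra ab br rc cd dr; have sf := test_smooth tf.
rewrite -(rect_dydx ab cd (sf 2)) -pxE -pyE.
set g := py (px f); have tg : test g by exact/test_py/test_px.
have cg := test_continuous tg.
pose C := crect a b c d.
have mC : measurable (C : set T2) by exact: measurable_crect.
have CB : C `<=` box.
  by move=> z [/andP[? ?] /andP[? ?]]; split; apply/andP; split; lra.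
have sC h : continuous h -> sqi mu2 C h.
  move=> ch; split; first exact: continuous_measurable2D.
  by apply: (continuous_integrable2 _ mC (@subset_refl _ _)); exact: continuousM2.
have c1 : continuous (fun _ : R * R => 1 : R) by move=> z; exact: cvg_cst.
have := ip_CS mC (sC _ c1) (sC _ cg).
have -> : inner mu2 C (fun=> 1) g = \int[mu2]_(z in C) g z.
  by rewrite ipE; apply: eq_Rintegral => z _; rewrite mul1r.
have -> : inner mu2 C (fun=> 1) (fun=> 1) = (b - a) * (d - c).
  rewrite ipE Rintegral_cst// mul1r mu2_crect ?mul1r//.
move/le_trans; apply; apply: ler_wpM2l; first by rewrite mulr_ge0//; lra.
rewrite !ipE (int_box (f := fun z => g z * g z)); last first.
  by move=> z Oz; rewrite (test_off tg Oz) mulr0.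
have cgg : continuous (fun z => g z * g z) by exact: continuousM2.
have mB : measurable (box : set T2) by exact: measurable_crect.
apply: fine_le.
- by apply: integrable_fin_num => //; exact: continuous_integrable2 cgg mC CB.
- by apply: integrable_fin_num => //; exact: continuous_integrable2 cgg mB (@subset_refl _ _).
- apply: ge0_subset_integral => //.
    by apply/measurable_EFinP; exact: continuous_measurable2D.
  by move=> z _; rewrite lee_fin -expr2 sqr_ge0.
Qed.

Lemma sqr_le_norm (u v : R) : u ^+ 2 <= v -> `|u| <= Num.sqrt v.
Proof. by move=> uv; rewrite -sqrtr_sqr ler_wsqrtr. Qed.

(** In the rectangle with opposite corners [(- r, - r)] and [z], the three other
    corners are outside [Omega], so the alternating sum reduces to [f z]. *)
Lemma sup_bound f z : test f -> `|f z| <= 2 * r * nrm (py (px f)).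
Proof.
have r0' := r0.
move=> tf; case: z => x y.
have [Oz|Oz] := pselect (Omega (x, y)); last first.
  by rewrite (test_off tf Oz) normr0 mulr_ge0 ?nrm_ge0//; lra.
have [/= /andP[? ?] /andP[? ?]] := OB Oz.
rewrite -(ler_pXn2r (n:=2))// ?nnegrE ?mulr_ge0 ?nrm_ge0//; last by lra.
rewrite -normrX ger0_norm ?sqr_ge0// exprMn nrm_sqr.
have r1 : - r <= x by lra. have r2 : - r <= y by lra.
have r3 : x <= r by lra. have r4 : y <= r by lra.
have := rect_bound tf (lexx _) r1 r3 (lexx _) r2 r4.
have e1 t : f (- r, t) = 0 by apply: (off_edge tf) => -[]; rewrite ltxx.
have e2 t : f (t, - r) = 0 by apply: (off_edge tf) => -[_]; rewrite ltxx.
rewrite !e1 e2 !subr0 addr0 => /le_trans; apply; apply: ler_wpM2r; first exact: ip_ge0.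
have : (x + r) * (y + r) <= (2 * r) * (2 * r) by apply: ler_pM; lra.
by lra.
Qed.

(** Only two corners of the rectangle below the horizontal segment survive; its
    area tends to 0 with the length of the segment. *)
Lemma equicont_x f x x' y : test f -> - r <= x' -> x' <= x -> x <= r -> - r <= y -> y <= r ->
  `|f (x, y) - f (x', y)| <= Num.sqrt ((x - x') * (2 * r)) * nrm (py (px f)).
Proof.
have r0' := r0.
move=> tf ? ? ? ? ?; rewrite nrmE -sqrtrM; last by rewrite mulr_ge0//; lra.
apply: sqr_le_norm.
have := @rect_bound f x' x (- r) y tf.
have e2 t : f (t, - r) = 0 by apply: (off_edge tf) => -[_]; rewrite ltxx.
rewrite !e2 subr0 addr0 => H; apply: le_trans (H _ _ _ _ _ _) _ => //.
by apply: ler_wpM2r; [exact: ip_ge0|apply: ler_wpM2l; lra].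
Qed.

Lemma equicont_y f x y y' : test f -> - r <= y' -> y' <= y -> y <= r -> - r <= x -> x <= r ->
  `|f (x, y) - f (x, y')| <= Num.sqrt ((y - y') * (2 * r)) * nrm (py (px f)).
Proof.
have r0' := r0.
move=> tf ? ? ? ? ?; rewrite nrmE -sqrtrM; last by rewrite mulr_ge0//; lra.
apply: sqr_le_norm.
have := @rect_bound f (- r) x y' y tf.
have e2 t : f (- r, t) = 0 by apply: (off_edge tf) => -[]; rewrite ltxx.
rewrite !e2 subr0 addr0 => H; apply: le_trans (H _ _ _ _ _ _) _ => //.
apply: ler_wpM2r; first exact: ip_ge0.
by rewrite mulrC; apply: ler_wpM2l; lra.
Qed.

Lemma nrm_sup f M : 0 <= M -> continuous f -> (forall z, Omega z -> `|f z| <= M) ->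
  nrm f <= M * nrm (fun _ => 1).
Proof.
move=> M0 cf fM.
have c1 : continuous (fun _ : R * R => 1 : R) by move=> z; exact: cvg_cst.
rewrite -[X in X * _](ger0_norm M0) -nrmZ//; last exact: cont_sqi.
rewrite !nrmE ler_wsqrtr// !ipE; apply: le_Rintegral => //.
- by apply: cont_integrable; exact: continuousM2.
- by apply: cont_integrable; move=> z; exact: cvg_cst.
- move=> z Oz; rewrite mulr1 -expr2 -[X in _ <= X]expr2 -(ger0_norm (sqr_ge0 _)) normrX.
  by apply: lerXn2r; rewrite ?nnegrE// fM.
Qed.

Definition lap f : R * R -> R := px (px f) \+ py (py f).

Lemma test_lap f : test f -> test (lap f).
Proof. by move=> tf; apply: testD; [exact/test_px/test_px|exact/test_py/test_py]. Qed.

Lemma ip_lap f : test f -> ip (lap f) (lap f) = ip (px (px f)) (px (px f)) +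
  2 * ip (py (px f)) (py (px f)) + ip (py (py f)) (py (py f)).
Proof.
move=> tf; rewrite (ip_xy tf).
have s1 : sqi mu2 Omega (px (px f)) by exact/test_sqi/test_px/test_px.
have s2 : sqi mu2 Omega (py (py f)) by exact/test_sqi/test_py/test_py.
exact: (ip_sqrD mO s1 s2).
Qed.

Lemma nrm_xx f : test f -> nrm (px (px f)) <= nrm (lap f).
Proof.
move=> tf; rewrite !nrmE ler_wsqrtr// (ip_lap tf).
have H (A B C : R) : 0 <= B -> 0 <= C -> A <= A + 2 * B + C by lra.
by apply: H; exact: ip_ge0.
Qed.

Lemma nrm_yy f : test f -> nrm (py (py f)) <= nrm (lap f).
Proof.
move=> tf; rewrite !nrmE ler_wsqrtr// (ip_lap tf).
have H (A B C : R) : 0 <= A -> 0 <= B -> C <= A + 2 * B + C by lra.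
by apply: H; exact: ip_ge0.
Qed.

(** The constant 2 comes from the nonnegativity of the square of [f_xx - f_yy]. *)
Lemma nrm_xy f : test f -> 2 * nrm (py (px f)) <= nrm (lap f).
Proof.
move=> tf.
rewrite -(ler_pXn2r (n:=2))// ?nnegrE ?mulr_ge0 ?nrm_ge0//.
rewrite exprMn !nrm_sqr (ip_lap tf) (ip_xy tf).
have s1 : sqi mu2 Omega (px (px f)) by exact/test_sqi/test_px/test_px.
have s2 : sqi mu2 Omega (py (py f)) by exact/test_sqi/test_py/test_py.
have H (A B C : R) : 0 <= A - 2 * B + C -> 2 ^+ 2 * B <= A + 2 * B + C by lra.
apply: H; rewrite -(ip_sqrB mO s1 s2); exact: ip_ge0.
Qed.

Lemma nrm_x f : test f -> nrm (px f) ^+ 2 <= nrm f * nrm (px (px f)).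
Proof.
move=> tf; rewrite nrm_sqr.
rewrite -[X in X <= _]opprK -(ibp_x (test_smooth tf) (test_px tf)).
apply: le_trans (ler_norm _) _; rewrite normrN; apply: ip_le_nrm => //.
  exact: test_sqi.
by apply: test_sqi; exact/test_px/test_px.
Qed.

Lemma nrm_y f : test f -> nrm (py f) ^+ 2 <= nrm f * nrm (py (py f)).
Proof.
move=> tf; rewrite nrm_sqr.
rewrite -[X in X <= _]opprK -(ibp_y (test_smooth tf) (test_py tf)).
apply: le_trans (ler_norm _) _; rewrite normrN; apply: ip_le_nrm => //.
  exact: test_sqi.
by apply: test_sqi; exact/test_py/test_py.
Qed.

(** Writing [w ^ 4] as [w * w ^ 3], with [w] a derivative of [f], and moving the
    derivative off the first factor leaves [3 f w ^ 2] times a second derivative. *)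
Lemma ip_interp f w w' M : 0 <= M -> test f -> test w -> test w' ->
  (forall z, `|f z| <= M) ->
  ip w (fun z => w z * w z * w z) = - ip f (fun z => 3 * (w z * w z) * w' z) ->
  nrm (fun z => w z * w z) <= 3 * M * nrm w'.
Proof.
move=> M0 tf tw tw' fM E.
have tww : test (fun z => w z * w z) by apply: testM => //; exact: test_smooth.
have s2 := test_sqi tww; have s' := test_sqi tw'.
set q := fun z => w z * w z in s2 *.
have H : nrm q ^+ 2 <= 3 * M * (nrm q * nrm w').
  rewrite nrm_sqr.
  have -> : ip q q = ip w (fun z => w z * w z * w z).
    by apply: ip_eq => z _; rewrite /q; lra.
  rewrite E -mulN1r -ipZl// ?ipE; last 2 first.
  - exact: test_sqi.
  - by apply: test_sqi; apply: testM => //; apply: smoothZ; exact: test_smooth.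
  have iR : mu2.-integrable Omega (EFin \o (fun z => `|q z| * `|w' z|)).
    by apply: sqi_mul => //; exact: sqi_norm.
  apply: (@le_trans _ _ (3 * M * \int[mu2]_(z in Omega) (`|q z| * `|w' z|))).
    rewrite -RintegralZl//; apply: le_Rintegral => //.
    - apply: cont_integrable; apply: continuousM2.
        by apply: continuousZ2; exact: test_continuous.
      apply: test_continuous; apply: testM => //.
      by apply: smoothZ; exact: test_smooth.
    - exact: integrable_RZ.
    - move=> z _; apply: le_trans (ler_norm _) _.
      have -> : -1 * f z * (3 * (w z * w z) * w' z) = - (3 * (f z * (q z * w' z))).
        by rewrite /q; lra.
      have Hb : `|f z * (q z * w' z)| <= M * (`|q z| * `|w' z|).
        rewrite (normrM (f z)) (normrM (q z)).
        by apply: ler_wpM2r; [exact: mulr_ge0|exact: fM].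
      by rewrite normrN (normrM 3) (ger0_norm (ler0n _ 3)) -(mulrA 3 M) ler_wpM2l.
  apply: ler_wpM2l; first by rewrite mulr_ge0.
  have H := ip_le_nrm mO (sqi_norm mO s2) (sqi_norm mO s').
  rewrite !nrm_norm ipE in H.
  by apply: le_trans (ler_norm _) H.
have [->|n0] := eqVneq (nrm q) 0; first by rewrite !mulr_ge0// nrm_ge0.
have np : 0 < nrm q by rewrite lt_def n0 nrm_ge0.
by rewrite -(ler_pM2l np); move: H; rewrite expr2; lra.
Qed.

Lemma interp_x f M : 0 <= M -> test f -> (forall z, `|f z| <= M) ->
  nrm (fun z => px f z * px f z) <= 3 * M * nrm (px (px f)).
Proof.
move=> M0 tf fM; have t1 := test_px tf; have s1 := test_smooth t1.
apply: (ip_interp M0 tf) => //; first exact: test_px.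
have t3 : test (fun z => px f z * px f z * px f z).
  by apply: testM => //; exact: smoothM.
rewrite -[X in X = _]opprK -(ibp_x (test_smooth tf) t3).
congr (- ip _ _); rewrite pxM//; last exact: smoothM.
by rewrite pxM//; apply/funext => z; lra.
Qed.

Lemma interp_y f M : 0 <= M -> test f -> (forall z, `|f z| <= M) ->
  nrm (fun z => py f z * py f z) <= 3 * M * nrm (py (py f)).
Proof.
move=> M0 tf fM; have t1 := test_py tf; have s1 := test_smooth t1.
apply: (ip_interp M0 tf) => //; first exact: test_py.
have t3 : test (fun z => py f z * py f z * py f z).
  by apply: testM => //; exact: smoothM.
rewrite -[X in X = _]opprK -(ibp_y (test_smooth tf) t3).
congr (- ip _ _); rewrite pyM//; last exact: smoothM.
by rewrite pyM//; apply/funext => z; lra.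
Qed.

End Test.
End Schwarz.

(** * The fundamental lemma of the calculus of variations *)

Section Fundamental.
Context {R : realType}.
Local Notation T2 := (measurableTypeR R * measurableTypeR R)%type.
Local Notation mu2 := (leb2 R).
Implicit Types (f g : R * R -> R) (A : set (R * R)).

Definition orects : set (set (R * R)) :=
  [set A | exists a b c d : R, A = orect a b c d].

Lemma orectI (a b c d a' b' c' d' : R) : orect a b c d `&` orect a' b' c' d' =
  orect (Num.max a a') (Num.min b b') (Num.max c c') (Num.min d d').
Proof.
apply/seteqP; split => z; rewrite /orect /= !gt_max !lt_min.
  by move=> [[/andP[-> ->] /andP[-> ->]] [/andP[-> ->] /andP[-> ->]]].
by move=> [/andP[/andP[-> ->] /andP[-> ->]] /andP[/andP[-> ->] /andP[-> ->]]].
Qed.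

Lemma orects_setI : setI_closed orects.
Proof.
move=> _ _ [a [b [c [d ->]]]] [a' [b' [c' [d' ->]]]].
by rewrite orectI; do 4 eexists.
Qed.

Lemma nat_gt (x : R) : exists n : nat, `|x| < n%:R.
Proof.
by exists (Num.trunc `|x|).+1; rewrite truncnS_gt.
Qed.

(** Both coordinates are measurable for the sigma-algebra generated by the open
    rectangles, which therefore contains every measurable product. *)
Lemma measurable_orects A : measurable (A : set T2) -> <<s orects >> A.
Proof.
pose G := g_sigma_algebraType orects.
have mfst : measurable_fun setT (fst : G -> measurableTypeR R).
  apply: (measurability _ (RGenOpens.measurableE R)).
  move=> _ [_ [a [b ->] <-]]; rewrite setTI.
  rewrite (_ : _ @^-1` _ = \bigcup_n orect a b (- n%:R) n%:R); last first.
    apply/seteqP; split => z /=; rewrite in_itv /=.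
      move=> zab; have [n] := nat_gt z.2; rewrite ltr_norml => Hn.
      by exists n.
    by move=> [n _ []].
  by apply: bigcupT_measurable => n; apply: sub_sigma_algebra; do 4 eexists.
have msnd : measurable_fun setT (snd : G -> measurableTypeR R).
  apply: (measurability _ (RGenOpens.measurableE R)).
  move=> _ [_ [a [b ->] <-]]; rewrite setTI.
  rewrite (_ : _ @^-1` _ = \bigcup_n orect (- n%:R) n%:R a b); last first.
    apply/seteqP; split => z /=; rewrite in_itv /=.
      move=> zab; have [n] := nat_gt z.1; rewrite ltr_norml => Hn.
      by exists n.
    by move=> [n _ []].
  by apply: bigcupT_measurable => n; apply: sub_sigma_algebra; do 4 eexists.
rewrite measurable_prod_measurableType; apply: smallest_sub.
  exact: smallest_sigma_algebra.
move=> _ [X mX [Y mY <-]].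
have -> : X `*` Y = (fst @^-1` X) `&` (snd @^-1` Y) by [].
have := @measurableI _ G (setT `&` (fst @^-1` X)) (setT `&` (snd @^-1` Y)).
by rewrite !setTI; apply; [rewrite -[X in measurable X]setTI; exact: mfst|
  rewrite -[X in measurable X]setTI; exact: msnd].
Qed.

(** Rectangles generate the Borel sets and are stable under intersection, so by
    Dynkin's lemma the integral of [g] vanishes over every Borel subset of [D]. *)
Lemma ae_eq0_orect g (a b c d : R) : let D := orect a b c d in
  mu2.-integrable D (EFin \o g) ->
  (forall a' b' c' d' : R,
     (\int[mu2]_(z in D `&` orect a' b' c' d') (g z)%:E = 0)%E) ->
  {ae mu2, forall z, D z -> g z = 0}.
Proof.
move=> D iD I0.
have mD : measurable (D : set T2) by exact: measurable_orect.
pose H := [set E : set (R * R) | measurable (E : set T2) /\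
    (\int[mu2]_(z in D `&` E) (g z)%:E = 0)%E].
have DT : (\int[mu2]_(z in D) (g z)%:E = 0)%E.
  by have := I0 a b c d; rewrite setIid.
have dH : dynkin H.
  split.
  - by split; [exact: measurableT|rewrite setIT].
  - move=> E [mE E0]; split; first exact: measurableC.
    have mDE : measurable (D `&` E : set T2) by exact: measurableI.
    have mDE' : measurable (D `&` ~` E : set T2) by apply: measurableI => //; exact: measurableC.
    have ED : (D `&` E) `|` (D `&` ~` E) = D by rewrite -setIUr setUv setIT.
    have := @integral_setU _ T2 R mu2 (D `&` E) (D `&` ~` E) (EFin \o g) mDE mDE'.
    rewrite ED DT E0 add0e => -> //; first exact: measurable_int iD.
    by rewrite disj_set2E; apply/eqP; rewrite setIACA setICr setI0.
  - move=> F tF HF; split; first by apply: bigcupT_measurable => n; case: (HF n).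
    rewrite setI_bigcupr integral_bigcup//.
    + by rewrite eseries0// => n _ _; case: (HF n).
    + by apply: trivIset_setIl.
    + by move=> n; apply: measurableI => //; case: (HF n).
    + apply: integrableS iD => //.
        by apply: bigcupT_measurable => n; apply: measurableI => //; case: (HF n).
      by move=> z [n _ []].
have GH : orects `<=` H.
  move=> _ [a' [b' [c' [d' ->]]]]; split; [exact: measurable_orect|exact: I0].
have SH : <<s orects >> `<=` H.
  rewrite -(setI_closed_g_dynkin_g_sigma_algebra orects_setI).
  exact: smallest_sub.
have : ae_eq mu2 D (EFin \o g) (cst 0%E).
  apply: integral_ae_eq => //.
  move=> E ED mE; have [_] := SH _ (measurable_orects mE).
  by rewrite (setIidr ED) => ->; rewrite integral0.
by apply: filterS => z /= h Dz; have [] := h Dz.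
Qed.

(** The arguments are written as full affine forms so that [Ck_flat] applies to
    every factor. *)
Definition bump (a b c d : R) z :=
  flat 0 (1 * z.1 + 0 * z.2 + - a) * flat 0 (-1 * z.1 + 0 * z.2 + b) *
  (flat 0 (0 * z.1 + 1 * z.2 + - c) * flat 0 (0 * z.1 + -1 * z.2 + d)) : R.

Lemma smooth_bump a b c d : smooth (bump a b c d).
Proof. by move=> k; apply: CkM; apply: CkM; exact: Ck_flat. Qed.

Lemma bump_ge0 a b c d z : 0 <= bump a b c d z.
Proof. by rewrite /bump !mulr_ge0// flat_ge0. Qed.

Lemma flat_eq0 k (t : R) : t <= 0 -> flat k t = 0.
Proof. by move=> t0; rewrite /flat ltNge t0. Qed.

Lemma bump_off a b c d z : ~ orect a b c d z -> bump a b c d z = 0.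
Proof.
rewrite /orect /= => H; rewrite /bump.
have [h1|h1] := leP z.1 a; first by rewrite (@flat_eq0 _ (1 * _ + _ + _)) ?mul0r//; lra.
have [h2|h2] := leP b z.1; first by rewrite (@flat_eq0 _ (-1 * z.1 + 0 * _ + _)) ?mulr0 ?mul0r//; lra.
have [h3|h3] := leP z.2 c; first by rewrite (@flat_eq0 _ (0 * _ + 1 * _ + _)) ?mul0r ?mulr0//; lra.
have [h4|h4] := leP d z.2; first by rewrite (@flat_eq0 _ (0 * z.1 + -1 * _ + _)) ?mulr0//; lra.
by case: H; rewrite h1 h2 h3 h4.
Qed.

Lemma bump_gt0 a b c d z : orect a b c d z -> 0 < bump a b c d z.
Proof.
by move=> [/andP[? ?] /andP[? ?]]; rewrite /bump !mulr_gt0// flat_gt0; lra.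
Qed.

Lemma bump_off_crect a b c d z : ~ crect a b c d z -> bump a b c d z = 0.
Proof.
move=> H; apply: bump_off => -[/andP[? ?] /andP[? ?]]; apply: H.
by split; apply/andP; split; exact: ltW.
Qed.

(** These functions increase to the indicator function of the rectangle as [n]
    grows. *)
Definition cutoff (n : nat) a b c d z := 1 + -1 * expR (- n%:R * bump a b c d z).

Lemma smooth_cutoff n a b c d : smooth (cutoff n a b c d).
Proof.
move=> k; apply: CkD; first exact: Ck_cst.
by apply: CkZ; apply: Ck_expR; apply: CkZ; exact: smooth_bump.
Qed.

Lemma cutoff_off n a b c d z : ~ orect a b c d z -> cutoff n a b c d z = 0.
Proof. by move=> /bump_off H; rewrite /cutoff H mulr0 expR0; lra. Qed.

Lemma cutoff01 n a b c d z : 0 <= cutoff n a b c d z <= 1.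
Proof.
rewrite /cutoff; have e0 := expR_gt0 (- n%:R * bump a b c d z).
have : expR (- n%:R * bump a b c d z) <= 1.
  by rewrite expR_le1 mulNr oppr_le0 mulr_ge0// bump_ge0.
by move=> ?; apply/andP; split; lra.
Qed.

Lemma cutoff_cvg a b c d z : orect a b c d z ->
  cutoff n a b c d z @[n --> \oo] --> (1 : R).
Proof.
move=> /bump_gt0 b0.
rewrite -[X in _ --> X]addr0 -[X in _ + X](mulr0 (-1)).
apply: cvgD; first exact: cvg_cst.
apply: cvgM; first exact: cvg_cst.
have -> : (fun n : nat => expR (- n%:R * bump a b c d z)) =
    (fun n : nat => expR (- bump a b c d z) ^+ n).
  by apply/funext => n; rewrite -expRM_natl mulNr mulrN.
apply: cvg_expr; rewrite ger0_norm ?expR_ge0//.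
by rewrite expR_lt1 oppr_lt0.
Qed.

Section Om.
Variable Omega : set (R * R).
Hypothesis oO : open Omega.
Let mO : measurable (Omega : set T2) := open_measurable2 oO.

Lemma integrable_supp (K : set (R * R)) f : measurable (K : set T2) -> K `<=` Omega ->
  (forall z, ~ K z -> f z = 0) ->
  mu2.-integrable K (EFin \o f) -> mu2.-integrable Omega (EFin \o f).
Proof.
move=> mK KO fK /(integrable_mkcond _ mK) iK; apply/(integrable_mkcond _ mO).
rewrite (_ : _ \_ Omega = (EFin \o f) \_ K)//.
apply/funext => z; rewrite /patch; case: ifPn => [|] Hz.
  by case: ifPn => //; rewrite notin_setE => /fK /= ->.
by rewrite ifF//; apply/negbTE/negP; rewrite inE => /KO; rewrite notin_setE in Hz.
Qed.

Lemma L1loc_test f g : L1loc Omega f -> test_function Omega g ->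
  mu2.-integrable Omega (EFin \o (fun z => f z * g z)).
Proof.
move=> Lf tg; have cg := test_continuous tg.
have [_ [K [cK KO gK]]] := (test_functionP _ _).1 tg.
have iK := Lf K cK KO.
have mK : measurable (K : set T2).
  by apply: closed_measurable2; apply: compact_closed => //; exact: norm_hausdorff.
have [M M0 HM] : exists2 M, 0 <= M & forall z, K z -> `|g z| <= M.
  have : compact (g @` K) by apply: continuous_compact => //; exact: continuous_subspaceT.
  move=> /compact_bounded [M0 [_ HM]]; exists (`|M0| + 1); first by rewrite addr_ge0.
  move=> z Hz; apply: (HM (`|M0| + 1)); last by exists z.
  by rewrite (le_lt_trans (ler_norm _))// ltrDl.
apply: (integrable_supp mK KO) => [z /gK ->|]; first by rewrite mulr0.
have mf : measurable_fun K f by apply/measurable_EFinP; exact: measurable_int iK.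
apply: (@integrable_le _ T2 _ mu2 K mK _ (fun z => M * `|f z|)).
- apply: measurable_funM => //; exact: continuous_measurable2D.
- by apply: integrable_RZ => //; have := integrable_abse iK.
- by move=> z Kz; rewrite normrM mulrC ler_wpM2r// HM.
Qed.

(** On a rectangle inside [Omega], testing against cutoffs that increase to the
    indicator function shows that all integrals of [g] vanish. Countably many
    rational rectangles cover [Omega]. *)
Lemma fundamental_lemma g : L1loc Omega g ->
  (forall phi, test_function Omega phi -> \int[mu2]_(z in Omega) (g z * phi z) = 0) ->
  ae_zero Omega g.
Proof.
move=> Lg I0.
have key (a b c d : R) : crect a b c d `<=` Omega ->
    {ae mu2, forall z, orect a b c d z -> g z = 0}.
  move=> CO.
  have mC : measurable (crect a b c d : set T2) by exact: measurable_crect.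
  have mD : measurable (orect a b c d : set T2) by exact: measurable_orect.
  have oc : orect a b c d `<=` crect a b c d.
    by move=> z [/andP[? ?] /andP[? ?]]; split; apply/andP; split; exact: ltW.
  have iC := Lg _ (@compact_crect R a b c d) CO.
  have iD : mu2.-integrable (orect a b c d) (EFin \o g) by exact: integrableS iC.
  apply: ae_eq0_orect => // a' b' c' d'; rewrite orectI.
  set a1 := Num.max a a'; set b1 := Num.min b b'; set c1 := Num.max c c'; set d1 := Num.min d d'.
  have sub1 : orect a1 b1 c1 d1 `<=` orect a b c d by rewrite -orectI; exact: subIsetl.
  have mD1 : measurable (orect a1 b1 c1 d1 : set T2) by exact: measurable_orect.
  have iD1 : mu2.-integrable (orect a1 b1 c1 d1) (EFin \o g) by exact: integrableS iD.
  have mg1 : measurable_fun (orect a1 b1 c1 d1) g.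
    by apply/measurable_EFinP; exact: measurable_int iD1.
  have tc n : test_function Omega (cutoff n a1 b1 c1 d1).
    apply/test_functionP; split; first exact: smooth_cutoff.
    exists (crect a b c d); split => //; first exact: compact_crect.
    by move=> z H; apply: cutoff_off => /sub1/oc.
  have J0 n : (\int[mu2]_(z in orect a1 b1 c1 d1) (g z * cutoff n a1 b1 c1 d1 z)%:E = 0)%E.
    have ic := L1loc_test Lg (tc n).
    have := I0 _ (tc n); rewrite /Rintegral => H.
    have : (\int[mu2]_(z in Omega) (g z * cutoff n a1 b1 c1 d1 z)%:E = 0)%E.
      by rewrite -(fineK (integrable_fin_num mO ic)) H.
    move=> <-; rewrite [RHS]integral_mkcond [LHS]integral_mkcond.
    apply: eq_integral => z _; rewrite /patch; case: ifPn => Hz.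
      by rewrite ifT// inE; apply: CO; apply: oc; apply: sub1; rewrite inE in Hz.
    case: ifPn => // _; rewrite cutoff_off ?mulr0//; by rewrite notin_setE in Hz.
  have mcut n : measurable_fun (orect a1 b1 c1 d1 : set T2) (fun z : T2 => g z * cutoff n a1 b1 c1 d1 z).
    by apply: measurable_funM => //; apply: continuous_measurable2D => //; exact/smooth_continuous/smooth_cutoff.
  have hc1 : {ae mu2, forall z, orect a1 b1 c1 d1 z ->
      (g z * cutoff n a1 b1 c1 d1 z)%:E @[n --> \oo] --> (EFin \o g) z}.
    apply: aeW => z Dz; apply: cvg_EFin; first exact: nearW.
    rewrite -[X in _ --> X]mulr1; apply: cvgM; first exact: cvg_cst.
    exact: cutoff_cvg.
  have hc2 : {ae mu2, forall z n, orect a1 b1 c1 d1 z ->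
      (`|(g z * cutoff n a1 b1 c1 d1 z)%:E| <= `|g z|%:E)%E}.
    apply: aeW => z n Dz; rewrite /= lee_fin normrM -[X in _ <= X]mulr1.
    have /andP[h0 h1] := cutoff01 n a1 b1 c1 d1 z.
    by apply: ler_wpM2l => //; rewrite ger0_norm.
  have [_ _ cv] := @dominated_convergence _ T2 R mu2 (orect a1 b1 c1 d1) mD1
    (fun n z => (g z * cutoff n a1 b1 c1 d1 z)%:E) (EFin \o g) (fun z => `|g z|%:E)
    (fun n => (measurable_EFinP _ _).2 (mcut n)) ((measurable_EFinP _ _).2 mg1)
    hc1 (integrable_abse iD1) hc2.
  have cv0 : (fun n => \int[mu2]_(z in orect a1 b1 c1 d1) (g z * cutoff n a1 b1 c1 d1 z)%:E)%E @ \oo --> 0%E.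
    by under eq_fun do rewrite J0; exact: cvg_cst.
  exact: (cvg_unique _ cv cv0).
pose F (n : nat) : set (R * R) := if @unpickle (rat * rat * (rat * rat))%type n is Some i then
  [set z | [/\ orect (ratr i.1.1) (ratr i.1.2) (ratr i.2.1) (ratr i.2.2) z,
    crect (ratr i.1.1) (ratr i.1.2) (ratr i.2.1) (ratr i.2.2) `<=` Omega & g z <> 0]] else set0.
have nF n : mu2.-negligible (F n).
  rewrite /F; case: unpickle => [i|]; last exact: negligible_set0.
  have [CO|CO] := pselect (crect (ratr i.1.1) (ratr i.1.2) (ratr i.2.1) (ratr i.2.2) `<=` Omega).
    have H := key _ _ _ _ CO; apply: negligibleS H => z /= [Dz _ gz] H.
    exact: gz (H Dz).
  by apply: negligibleS (negligible_set0 mu2) => z [].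
have := negligible_bigcup nF; apply: negligibleS => z /= /not_implyP [Oz gz].
have [q1 [q2 [q3 [q4 [H1 H2]]]]] := open_rat_orect oO Oz.
have [i Ei] : exists i : rat * rat * (rat * rat), i = ((q1, q2), (q3, q4)) by eexists.
exists (pickle i); first exact: I.
by rewrite /F pickleK Ei; split.
Qed.

End Om.
End Fundamental.

(** * Weak derivatives *)

Section Weak.
Context {R : realType}.
Local Notation T2 := (measurableTypeR R * measurableTypeR R)%type.
Local Notation mu2 := (leb2 R).
Implicit Types (f g : R * R -> R) (A : set (R * R)).
Variable Omega : set (R * R).
Variable r : R.
Hypothesis oO : open Omega.
Hypothesis r0 : 0 < r.
Hypothesis OB : Omega `<=` orect (- r) r (- r) r.
Let mO : measurable (Omega : set T2) := open_measurable2 oO.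
Local Notation ip := (inner mu2 Omega).
Local Notation nrm := (l2norm mu2 Omega).
Local Notation sqi := (sqi mu2 Omega).
Local Notation test := (test_function Omega).

Lemma aeS (P Q : R * R -> Prop) : (forall z, P z -> Q z) ->
  {ae mu2, forall z, P z} -> {ae mu2, forall z, Q z}.
Proof. by move=> PQ; apply: negligibleS => z /= nQ Pz; exact/nQ/PQ. Qed.

Lemma fine_Lnorm2 f : measurable_fun Omega f ->
  'N[mu2]_2%:E[EFin \o (f \_ Omega)]%E =
  ((\int[mu2]_(z in Omega) (f z * f z)%:E) `^ 2^-1)%E.
Proof.
move=> mf; rewrite unlock; congr (_ `^ _)%E; rewrite [RHS]integral_mkcond.
apply: eq_integral => z _; rewrite /= /patch; case: ifPn => _ /=.
  by rewrite (@powR_mulrn _ _ 2)// expr2 -normrM ger0_norm// -expr2 sqr_ge0.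
by rewrite normr0 powR0.
Qed.

Lemma L2P f : L2 Omega f <-> sqi f.
Proof.
split => [H|[mf fi]].
  have i2 := Lfun2_integrable_sqr H.
  move: H; rewrite /L2 /= inE => /andP[mf _]; move: mf; rewrite inE /= => mf.
  split; first by apply/(measurable_restrictT f mO).
  apply/(integrable_mkcond _ mO); apply: eq_integrable i2 => // z _ /=.
  rewrite /patch /=; case: ifPn => _; first by rewrite expr2.
  by rewrite expr0n.
rewrite /L2 /= inE; apply/andP; split; rewrite inE /=.
  by apply/(measurable_restrictT f mO).
rewrite /finite_norm fine_Lnorm2//; apply: poweR_lty.
rewrite -ge0_fin_numE; first exact: integrable_fin_num.
by apply: integral_ge0 => z _; rewrite lee_fin -expr2 sqr_ge0.
Qed.

Lemma L2normE f : measurable_fun Omega f -> L2norm Omega f = nrm f.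
Proof.
move=> mf; rewrite /L2norm fine_Lnorm2// fine_poweR -[fine _]/(Rintegral mu2 Omega _).
by rewrite -ipE powR12_sqrt ?ip_ge0// nrmE.
Qed.

Lemma sqi_integrable f : sqi f -> mu2.-integrable Omega (EFin \o f).
Proof.
move=> sf; have c1 : continuous (fun _ : R * R => 1 : R) by move=> z; exact: cvg_cst.
have := sqi_mul mO sf (cont_sqi oO OB c1).
by apply: eq_integrable => // z _ /=; rewrite mulr1.
Qed.

Lemma compact_measurable2 (K : set (R * R)) : compact K -> measurable (K : set T2).
Proof.
by move=> cK; apply: closed_measurable2; apply: compact_closed => //; exact: norm_hausdorff.
Qed.

Lemma sqi_L1loc f : sqi f -> L1loc Omega f.
Proof.
move=> /sqi_integrable fi K cK KO; apply: integrableS fi => //.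
exact: compact_measurable2.
Qed.

(** [Omega] is a countable union of compact rectangles, and local integrability
    includes measurability on each of them. *)
Lemma L1loc_measurable f : L1loc Omega f -> measurable_fun Omega f.
Proof.
move=> Lf.
pose F (n : nat) : set (R * R) := if @unpickle (rat * rat * (rat * rat))%type n is Some i then
  [set z | crect (ratr i.1.1) (ratr i.1.2) (ratr i.2.1) (ratr i.2.2) z /\
    crect (ratr i.1.1) (ratr i.1.2) (ratr i.2.1) (ratr i.2.2) `<=` Omega] else set0.
have FE n : F n = set0 \/ (compact (F n) /\ F n `<=` Omega).
  rewrite /F; case: unpickle => [i|]; last by left.
  have [CO|CO] := pselect (crect (ratr i.1.1) (ratr i.1.2) (ratr i.2.1) (ratr i.2.2) `<=` Omega).
    right; rewrite (_ : [set z | _] = crect (ratr i.1.1) (ratr i.1.2) (ratr i.2.1) (ratr i.2.2)).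
      by split => //; exact: compact_crect.
    by apply/seteqP; split => [z []|z].
  by left; apply/seteqP; split => [z []|z].
have -> : Omega = \bigcup_n F n.
  apply/seteqP; split => [z Oz|z [n _]].
    have [q1 [q2 [q3 [q4 [H1 H2]]]]] := open_rat_orect oO Oz.
    have [i Ei] : exists i : rat * rat * (rat * rat), i = ((q1, q2), (q3, q4)) by eexists.
    exists (pickle i); first exact: I.
    rewrite /F pickleK Ei; split => //.
    by case: H1 => /andP[? ?] /andP[? ?]; split; apply/andP; split; exact: ltW.
  by case: (FE n) => [->//|[_]]; apply.
apply/measurable_fun_bigcup => [n|n].
  by case: (FE n) => [->|[/compact_measurable2]]; first exact: measurable0.
case: (FE n) => [->|[cF FO]]; first exact: measurable_fun_set0.
by apply/measurable_EFinP; exact: measurable_int (Lf _ cF FO).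
Qed.

Lemma L1locD f g : L1loc Omega f -> L1loc Omega g -> L1loc Omega (f \+ g).
Proof.
by move=> Lf Lg K cK KO; apply: (integrable_RD (compact_measurable2 cK) (Lf K cK KO) (Lg K cK KO)).
Qed.

Lemma L1locZ (c : R) f : L1loc Omega f -> L1loc Omega (fun z => c * f z).
Proof.
by move=> Lf K cK KO; apply: (integrable_RZ (compact_measurable2 cK) c (Lf K cK KO)).
Qed.

Lemma is_wderivE i j v g : is_wderiv Omega i j v g <-> [/\ L1loc Omega v, L1loc Omega g &
  forall phi, test phi -> ip v (pderiv i j phi) = (-1) ^+ (i + j) * ip g phi].
Proof.
by split=> -[Lv Lg H]; split => // phi tphi; have := H phi tphi; rewrite !ipE.
Qed.

Definition pd (i j : nat) f := iter i px (iter j py f).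

Lemma pdE i j f : pd i j f = pderiv i j f.
Proof. by rewrite /pd /pderiv pxE pyE. Qed.

Lemma test_pd i j f : test f -> test (pd i j f).
Proof.
move=> tf; rewrite /pd; elim: i => [|i IH] /=; last exact: test_px.
by elim: j => [|j IH] //=; exact: test_py.
Qed.

Lemma ip_L1locB f g phi : L1loc Omega f -> L1loc Omega g -> test phi ->
  ip (f \- g) phi = ip f phi - ip g phi.
Proof.
move=> Lf Lg tphi; rewrite !ipE -RintegralB//; last 2 first.
- exact: L1loc_test.
- exact: L1loc_test.
by apply: eq_Rintegral => z _ /=; rewrite mulrBl.
Qed.

Lemma ip_L1locZ c f phi : L1loc Omega f -> test phi ->
  ip (fun z => c * f z) phi = c * ip f phi.
Proof.
move=> Lf tphi; rewrite !ipE -RintegralZl//; last exact: L1loc_test.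
by apply: eq_Rintegral => z _ /=; rewrite mulrA.
Qed.

Lemma L1locB f g : L1loc Omega f -> L1loc Omega g -> L1loc Omega (f \- g).
Proof.
move=> Lf /(L1locZ (-1)) Lg; have := L1locD Lf Lg.
by congr (L1loc _ _); apply/funext => z /=; rewrite mulN1r.
Qed.

Lemma is_wderivB i j v g v' g' : is_wderiv Omega i j v g -> is_wderiv Omega i j v' g' ->
  is_wderiv Omega i j (v \- v') (g \- g').
Proof.
move=> /is_wderivE[Lv Lg H] /is_wderivE[Lv' Lg' H']; apply/is_wderivE.
split; [exact: L1locB|exact: L1locB|move=> phi tphi].
have tp : test (pderiv i j phi) by rewrite -pdE; exact: test_pd.
by rewrite !ip_L1locB// H// H'// mulrBr.
Qed.

Lemma is_wderivZ i j c v g : is_wderiv Omega i j v g ->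
  is_wderiv Omega i j (fun z => c * v z) (fun z => c * g z).
Proof.
move=> /is_wderivE[Lv Lg H]; apply/is_wderivE.
split; [exact: L1locZ|exact: L1locZ|move=> phi tphi].
have tp : test (pderiv i j phi) by rewrite -pdE; exact: test_pd.
by rewrite !ip_L1locZ// H// mulrCA.
Qed.

Lemma is_wderiv_unique i j v g g' : is_wderiv Omega i j v g -> is_wderiv Omega i j v g' ->
  {ae mu2, forall z, Omega z -> g z = g' z}.
Proof.
move=> /is_wderivE[Lv Lg H] /is_wderivE[_ Lg' H'].
have : ae_zero Omega (g \- g').
  apply: fundamental_lemma => //; first exact: L1locB.
  move=> phi tphi; rewrite -ipE ip_L1locB//.
  have : (-1) ^+ (i + j) * ip g phi = (-1) ^+ (i + j) * ip g' phi by rewrite -H// -H'.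
  by move/(mulfI _) => ->; rewrite ?subrr// signr_eq0.
by apply: aeS => z E Oz; apply/eqP; rewrite -subr_eq0; apply/eqP; exact: E.
Qed.

Lemma wderivP i j v g : is_wderiv Omega i j v g -> is_wderiv Omega i j v (wderiv Omega i j v).
Proof.
move=> H; have [] // := @xgetPex _ (fun=> 0) [set g | is_wderiv Omega i j v g].
by exists g.
Qed.

Lemma wderiv_ae i j v g : is_wderiv Omega i j v g ->
  {ae mu2, forall z, Omega z -> wderiv Omega i j v z = g z}.
Proof. by move=> H; exact: (is_wderiv_unique (wderivP H) H). Qed.

Lemma is_wderiv_sqi i j v g : is_wderiv Omega i j v g -> sqi g -> sqi (wderiv Omega i j v).
Proof.
move=> H sg; apply: (sqi_ae mO sg).
  by have [_ L _] := wderivP H; exact: L1loc_measurable.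
by apply: aeS (wderiv_ae H) => z E Oz; rewrite E.
Qed.

Lemma ip_iter_px i f g : smooth f -> test g ->
  ip f (iter i px g) = (-1) ^+ i * ip (iter i px f) g.
Proof.
move=> sf tg; elim: i g tg => [|i IH] g tg; first by rewrite expr0 mul1r.
rewrite iterSr IH; last exact: test_px.
rewrite (ibp_x oO r0 OB) //; last by elim: {IH} i => //= i; exact: smooth_px.
by rewrite /= exprS mulrN -mulN1r mulrA.
Qed.

Lemma ip_iter_py i f g : smooth f -> test g ->
  ip f (iter i py g) = (-1) ^+ i * ip (iter i py f) g.
Proof.
move=> sf tg; elim: i g tg => [|i IH] g tg; first by rewrite expr0 mul1r.
rewrite iterSr IH; last exact: test_py.
rewrite (ibp_y oO r0 OB) //; last by elim: {IH} i => //= i; exact: smooth_py.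
by rewrite /= exprS mulrN -mulN1r mulrA.
Qed.

Lemma smooth_iter_px i f : smooth f -> smooth (iter i px f).
Proof. by move=> sf; elim: i => //= i; exact: smooth_px. Qed.
Lemma smooth_iter_py i f : smooth f -> smooth (iter i py f).
Proof. by move=> sf; elim: i => //= i; exact: smooth_py. Qed.

Lemma iter_pC i j f : smooth f -> iter j py (iter i px f) = iter i px (iter j py f).
Proof.
move=> sf; elim: j => //= j ->; elim: i => //= i IH.
by rewrite -smooth_pxpyC ?IH//; apply: smooth_iter_px; exact: smooth_iter_py.
Qed.

Lemma is_wderiv_test i j f : test f -> is_wderiv Omega i j f (pd i j f).
Proof.
move=> tf; have sf := test_smooth tf; apply/is_wderivE; split.
- by apply: sqi_L1loc; exact: test_sqi oO OB _ tf.
- by apply: sqi_L1loc; exact: (test_sqi oO OB (test_pd i j tf)).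
move=> phi tphi; rewrite -pdE /pd ip_iter_px//; last first.
  by elim: j => //= j IH; exact: test_py.
rewrite ip_iter_py//; last exact: smooth_iter_px.
by rewrite iter_pC// exprD mulrA.
Qed.

End Weak.

(** * Convergence in mean square *)

Section L2cvg.
Context d (T : measurableType d) (R : realType).
Variables (mu : {measure set T -> \bar R}) (D : set T).
Hypothesis mD : measurable D.
Local Notation ip := (inner mu D).
Local Notation nrm := (l2norm mu D).
Local Notation sqi := (sqi mu D).

Lemma cvg0_le (u v : nat -> R) : (forall n, 0 <= u n <= v n) ->
  v @ \oo --> (0 : R) -> u @ \oo --> (0 : R).
Proof.
move=> uv /cvgrPdist_le cv; apply/cvgrPdist_le => e e0.
have [N _ HN] := cv e e0; exists N => // n /HN /=; rewrite !sub0r !normrN; apply: le_trans.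
by have /andP[u0 /le_trans] := uv n; rewrite (ger0_norm u0); apply; exact: ler_norm.
Qed.

Lemma nrm_cvg (f : nat -> T -> R) F : (forall n, sqi (f n)) -> sqi F ->
  nrm (f n \- F) @[n --> \oo] --> (0 : R) -> nrm (f n) @[n --> \oo] --> nrm F.
Proof.
move=> sf sF cf; apply/cvgrPdist_le => e e0.
have [N _ HN] := (cvgrPdist_le _ _).1 cf e e0; exists N => // n /HN /=.
rewrite sub0r normrN (ger0_norm (nrm_ge0 _ _ _)); apply: le_trans.
by rewrite distrC; exact: (nrm_dist mD).
Qed.

Lemma nrm_cvgD (f g : nat -> T -> R) F G : (forall n, sqi (f n)) -> (forall n, sqi (g n)) ->
  sqi F -> sqi G ->
  nrm (f n \- F) @[n --> \oo] --> (0 : R) -> nrm (g n \- G) @[n --> \oo] --> (0 : R) ->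
  nrm ((f n \+ g n) \- (F \+ G)) @[n --> \oo] --> (0 : R).
Proof.
move=> sf sg sF sG cf cg.
apply: (cvg0_le (v := fun n => nrm (f n \- F) + nrm (g n \- G))) => [n|].
  rewrite nrm_ge0 /=.
  have -> : (f n \+ g n) \- (F \+ G) = (f n \- F) \+ (g n \- G).
    by apply/funext => z /=; lra.
  by apply: nrmD => //; exact: sqiB.
by rewrite -[X in _ --> X]addr0; exact: cvgD.
Qed.

Lemma ip_cvg (f g : nat -> T -> R) F G : (forall n, sqi (f n)) -> (forall n, sqi (g n)) ->
  sqi F -> sqi G ->
  nrm (f n \- F) @[n --> \oo] --> (0 : R) -> nrm (g n \- G) @[n --> \oo] --> (0 : R) ->
  ip (f n) (g n) @[n --> \oo] --> ip F G.
Proof.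
move=> sf sg sF sG cf cg.
suff H : `|ip (f n) (g n) - ip F G| @[n --> \oo] --> (0 : R).
  apply/cvgrPdist_le => e e0.
  have [N _ HN] := (cvgrPdist_le _ _).1 H e e0; exists N => // n /HN /=.
  by rewrite sub0r normrN normr_id distrC.
apply: (cvg0_le (v := fun n => nrm (f n \- F) * nrm (g n) + nrm F * nrm (g n \- G))) => [n|].
  rewrite normr_ge0 /=.
  have -> : ip (f n) (g n) - ip F G = ip (f n \- F) (g n) + ip F (g n \- G).
    by rewrite ipBl// [ip F (_ \- _)]ipC ipBl// (ipC _ _ (g n) F) (ipC _ _ G F); lra.
  apply: le_trans (ler_normD _ _) _; apply: lerD; apply: ip_le_nrm => //; exact: sqiB.
rewrite -[X in _ --> X](addr0 0); apply: cvgD.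
  rewrite -[X in _ --> X](mul0r (nrm G)); apply: cvgM => //; exact: nrm_cvg.
by rewrite -[X in _ --> X](mulr0 (nrm F)); apply: cvgM => //; exact: cvg_cst.
Qed.

Lemma nrm_mul_le (f g : T -> R) : sqi (fun z => f z * f z) -> sqi (fun z => g z * g z) ->
  nrm (fun z => f z * g z) ^+ 2 <= nrm (fun z => f z * f z) * nrm (fun z => g z * g z).
Proof.
move=> sf sg; rewrite nrm_sqr.
have -> : ip (fun z => f z * g z) (fun z => f z * g z) =
   ip (fun z => f z * f z) (fun z => g z * g z) by apply: ip_eq => z _; lra.
by apply: le_trans (ler_norm _) _; exact: (ip_le_nrm mD).
Qed.

Lemma nrm_mul_le_sq (f g : T -> R) (e K : R) : 0 <= e -> 0 <= K ->
  sqi (fun z => f z * f z) -> sqi (fun z => g z * g z) ->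
  nrm (fun z => f z * f z) <= e ^+ 2 -> nrm (fun z => g z * g z) <= K ^+ 2 ->
  nrm (fun z => f z * g z) <= e * K.
Proof.
move=> e0 K0 sf sg ne nK.
rewrite -(ler_pXn2r (n:=2))// ?nnegrE ?mulr_ge0 ?nrm_ge0// exprMn.
apply: le_trans (nrm_mul_le sf sg) _; apply: ler_pM => //; exact: nrm_ge0.
Qed.

End L2cvg.

(** * Approximation by test functions *)

Section Sobolev2.
Context {R : realType}.
Local Notation T2 := (measurableTypeR R * measurableTypeR R)%type.
Local Notation mu2 := (leb2 R).
Implicit Types (f g v w : R * R -> R).
Variable Omega : set (R * R).
Variable r : R.
Hypothesis oO : open Omega.
Hypothesis r0 : 0 < r.
Hypothesis OB : Omega `<=` orect (- r) r (- r) r.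
Let mO : measurable (Omega : set T2) := open_measurable2 oO.
Local Notation ip := (inner mu2 Omega).
Local Notation nrm := (l2norm mu2 Omega).
Local Notation sqi := (sqi mu2 Omega).
Local Notation test := (test_function Omega).
Let tsq := fun f => @test_sqi R Omega r oO OB f.

Lemma pxB f g : smooth f -> smooth g -> px (f \- g) = px f \- px g.
Proof.
move=> sf sg; rewrite (_ : f \- g = f \+ (fun z => -1 * g z)).
  by rewrite pxD ?pxZ//; [apply/funext => z /=; lra|exact: smoothZ].
by apply/funext => z /=; lra.
Qed.
Lemma pyB f g : smooth f -> smooth g -> py (f \- g) = py f \- py g.
Proof.
move=> sf sg; rewrite (_ : f \- g = f \+ (fun z => -1 * g z)).
  by rewrite pyD ?pyZ//; [apply/funext => z /=; lra|exact: smoothZ].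
by apply/funext => z /=; lra.
Qed.

Lemma pdB i j f g : smooth f -> smooth g -> pd i j (f \- g) = pd i j f \- pd i j g.
Proof.
move=> sf sg; rewrite /pd.
have -> : iter j py (f \- g) = iter j py f \- iter j py g.
  by elim: j => //= j ->; rewrite pyB//; exact: smooth_iter_py.
by elim: i => //= i ->; rewrite pxB//; apply: smooth_iter_px; exact: smooth_iter_py.
Qed.

Lemma lapB f g : smooth f -> smooth g -> lap (f \- g) = lap f \- lap g.
Proof.
move=> sf sg; rewrite /lap pxB// pyB// pxB ?pyB//; try by [exact: smooth_px|exact: smooth_py].
by apply/funext => z /=; lra.
Qed.

(** Second derivatives are controlled through integration by parts, values
    through the sup bound, and first derivatives by interpolation between them. *)
Lemma pd_bound i j : (i + j <= 2)%N ->
  exists2 C, 0 <= C & forall f, test f -> nrm (pd i j f) <= C * nrm (lap f).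
Proof.
pose c := r * nrm (fun _ => 1).
have c0 : 0 <= c by rewrite mulr_ge0 ?nrm_ge0// ltW.
have b00 f : test f -> nrm f <= c * nrm (lap f).
  move=> tf; have /= H := nrm_xy oO r0 OB tf.
  have S z : `|f z| <= r * nrm (lap f).
    have S0 := sup_bound r0 OB z tf.
    apply: (le_trans S0).
    by rewrite (mulrC 2) -mulrA ler_wpM2l// ltW.
  have := @nrm_sup R Omega r oO OB f (r * nrm (lap f)).
  move=> K; apply: le_trans (K _ _ _) _ => //.
  - by rewrite mulr_ge0 ?nrm_ge0// ltW.
  - exact: test_continuous tf.
  - by rewrite /c mulrAC.
have sq (x y : R) : 0 <= x -> 0 <= y -> x ^+ 2 <= c * y ^+ 2 -> x <= Num.sqrt c * y.
  move=> x0 y0 H; rewrite -(ler_pXn2r (n:=2))// ?nnegrE ?mulr_ge0 ?sqrtr_ge0//.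
  by rewrite exprMn sqr_sqrtr.
case: i => [|[|[|i]]]; case: j => [|[|[|j]]] //= _.
- by exists c.
- exists (Num.sqrt c) => [|f tf]; first exact: sqrtr_ge0.
  apply: sq; rewrite ?nrm_ge0//; apply: le_trans (nrm_y oO r0 OB tf) _.
  rewrite expr2 mulrA; apply: ler_pM; rewrite ?nrm_ge0//; first exact: b00.
  exact: (nrm_yy oO r0 OB tf).
- by exists 1 => // f tf; rewrite mul1r; exact: (nrm_yy oO r0 OB tf).
- exists (Num.sqrt c) => [|f tf]; first exact: sqrtr_ge0.
  apply: sq; rewrite ?nrm_ge0//; apply: le_trans (nrm_x oO r0 OB tf) _.
  rewrite expr2 mulrA; apply: ler_pM; rewrite ?nrm_ge0//; first exact: b00.
  exact: (nrm_xx oO r0 OB tf).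
- exists 1 => // f tf; rewrite mul1r /pd /= smooth_pxpyC; last exact: test_smooth tf.
  have := nrm_xy oO r0 OB tf; have := nrm_ge0 mu2 Omega (py (px f)).
  have H (a b : R) : 0 <= a -> 2 * a <= b -> a <= b by lra.
  exact: H.
- by exists 1 => // f tf; rewrite mul1r; exact: (nrm_xx oO r0 OB tf).
Qed.

Lemma W22_wderiv v i j : W22 Omega v -> (i + j <= 2)%N ->
  is_wderiv Omega i j v (wderiv Omega i j v) /\ sqi (wderiv Omega i j v).
Proof.
move=> Wv ij; have [g Hg /(L2P oO) sg] := Wv i j ij.
split; first exact: wderivP Hg.
exact: (is_wderiv_sqi oO Hg sg).
Qed.

Lemma W22_of v (G : nat -> nat -> R * R -> R) :
  (forall i j, (i + j <= 2)%N -> is_wderiv Omega i j v (G i j) /\ sqi (G i j)) ->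
  W22 Omega v /\ (forall i j, (i + j <= 2)%N ->
    {ae mu2, forall z, Omega z -> wderiv Omega i j v z = G i j z}).
Proof.
move=> H; split => i j ij; have [H1 H2] := H i j ij.
  by exists (G i j) => //; exact/(L2P oO).
exact: (wderiv_ae oO H1).
Qed.

Lemma W22_test f : test f -> W22 Omega f.
Proof.
move=> tf; have [] // := @W22_of f (fun i j => pd i j f).
by move=> i j _; split; [exact: (is_wderiv_test oO r0 OB)|exact/tsq/test_pd].
Qed.

Lemma W22B v w : W22 Omega v -> W22 Omega w -> W22 Omega (v \- w) /\
  forall i j, (i + j <= 2)%N -> {ae mu2, forall z, Omega z ->
     wderiv Omega i j (v \- w) z = wderiv Omega i j v z - wderiv Omega i j w z}.
Proof.
move=> Wv Ww; apply: (@W22_of _ (fun i j => wderiv Omega i j v \- wderiv Omega i j w)).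
move=> i j ij; have [H1 H2] := W22_wderiv Wv ij; have [H3 H4] := W22_wderiv Ww ij.
by split; [exact: (is_wderivB oO)|exact: (sqiB mO)].
Qed.

Lemma W22Z c v : W22 Omega v -> W22 Omega (fun z => c * v z) /\
  forall i j, (i + j <= 2)%N -> {ae mu2, forall z, Omega z ->
     wderiv Omega i j (fun z => c * v z) z = c * wderiv Omega i j v z}.
Proof.
move=> Wv; apply: (@W22_of _ (fun i j z => c * wderiv Omega i j v z)).
move=> i j ij; have [H1 H2] := W22_wderiv Wv ij.
by split; [exact: (is_wderivZ oO)|exact: (sqiZ mO)].
Qed.

Lemma W22normE v : W22 Omega v -> W22norm Omega v =
  Num.sqrt (\sum_(i < 3) \sum_(j < 3 | (i + j <= 2)%N) nrm (wderiv Omega i j v) ^+ 2).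
Proof.
move=> Wv; congr Num.sqrt; apply: eq_bigr => i _; apply: eq_bigr => j ij.
by rewrite L2normE//; have [_ []] := W22_wderiv Wv ij.
Qed.

Lemma nrm_le_W22norm v i j : W22 Omega v -> (i + j <= 2)%N ->
  nrm (wderiv Omega i j v) <= W22norm Omega v.
Proof.
move=> Wv ij; rewrite W22normE//.
have i3 : (i < 3)%N by rewrite ltnS (leq_trans _ ij)// leq_addr.
have j3 : (j < 3)%N by rewrite ltnS (leq_trans _ ij)// leq_addl.
rewrite -[X in X <= _]ger0_norm ?nrm_ge0// -sqrtr_sqr ler_wsqrtr//.
rewrite (bigD1 (Ordinal i3))//= (bigD1 (Ordinal j3))//= -addrA lerDl.
apply: addr_ge0; first by apply: sumr_ge0 => k _; exact: sqr_ge0.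
by apply: sumr_ge0 => k _; apply: sumr_ge0 => l _; exact: sqr_ge0.
Qed.

Lemma W22norm_le v e : W22 Omega v -> 0 <= e ->
  (forall i j, (i + j <= 2)%N -> nrm (wderiv Omega i j v) <= e) -> W22norm Omega v <= 3 * e.
Proof.
move=> Wv e0 H; rewrite W22normE// -[X in _ <= X]ger0_norm; last by rewrite mulr_ge0.
rewrite -sqrtr_sqr ler_wsqrtr//.
apply: (@le_trans _ _ (\sum_(i < 3) \sum_(j < 3) e ^+ 2)).
  apply: ler_sum => i _; rewrite big_mkcond; apply: ler_sum => j _.
  case: ifP => [ij|_]; last exact: sqr_ge0.
  by apply: lerXn2r; rewrite ?nnegrE ?nrm_ge0//; exact: H.
by rewrite !sumr_const !card_ord -mulrnA -mulr_natl exprMn; lra.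
Qed.

(** Convergence of test functions to [v] together with all derivatives of order at
    most two: the form in which membership in [W220] is used. *)
Definition approx (phi : nat -> R * R -> R) v := [/\ forall n, test (phi n), W22 Omega v &
  forall i j, (i + j <= 2)%N ->
    nrm (pd i j (phi n) \- wderiv Omega i j v) @[n --> \oo] --> (0 : R)].

Lemma wderiv_measurable v i j : W22 Omega v -> (i + j <= 2)%N ->
  measurable_fun Omega (wderiv Omega i j v).
Proof. by move=> Wv ij; have [_ []] := W22_wderiv Wv ij. Qed.

Lemma wderivB_test v f i j : W22 Omega v -> test f -> (i + j <= 2)%N ->
  nrm (wderiv Omega i j (v \- f)) = nrm (pd i j f \- wderiv Omega i j v).
Proof.
move=> Wv tf ij; have Wf := W22_test tf; have [WB HB] := W22B Wv Wf.
have mv := wderiv_measurable Wv ij; have mp := (tsq (test_pd i j tf)).1.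
rewrite (nrmBC mu2 Omega); apply: nrm_ae => //.
- exact: wderiv_measurable.
- exact: measurable_funB.
- have H2 := wderiv_ae oO (is_wderiv_test oO r0 OB i j tf).
  have H1 := HB i j ij.
  apply: negligibleS (negligibleU H1 H2) => z /= /not_implyP[Oz nz'].
  apply: contrapT => /not_orP [/contrapT E1 /contrapT E2].
  by apply: nz' => /=; rewrite E1// E2.
Qed.

Lemma W220_approx v : W220 Omega v -> exists phi, approx phi v.
Proof.
move=> [Wv H].
have ex n : exists phi, test phi /\ W22norm Omega (v \- phi) < n.+1%:R^-1.
  by have [|phi tphi Hp] := H n.+1%:R^-1; [rewrite invr_gt0|exists phi].
pose phi n := sval (cid (ex n)).
have Hphi n : test (phi n) /\ W22norm Omega (v \- phi n) < n.+1%:R^-1 := svalP (cid (ex n)).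
exists phi; split => // [n|i j ij]; first by case: (Hphi n).
apply: (cvg0_le (v := fun n => n.+1%:R^-1)) => [n|]; last exact: cvg_harmonic.
rewrite nrm_ge0 /=; have [tp /ltW] := Hphi n; apply: le_trans.
rewrite -wderivB_test//; apply: nrm_le_W22norm => //.
by case: (W22B Wv (W22_test tp)).
Qed.

Lemma approx_W220 phi v : approx phi v -> W220 Omega v.
Proof.
move=> [tp Wv H]; split => // e e0.
have e4 : 0 < e / 4 by rewrite divr_gt0.
have ex i j : exists N, forall n, (N <= n)%N -> (i + j <= 2)%N ->
    nrm (pd i j (phi n) \- wderiv Omega i j v) <= e / 4.
  have [ij|ij] := boolP (i + j <= 2)%N; last by exists 0%N.
  have [N _ HN] := (cvgrPdist_le _ _).1 (H i j ij) _ e4; exists N => n /HN /=.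
  by rewrite sub0r normrN ger0_norm ?nrm_ge0.
pose N i j := sval (cid (ex i j)).
have HN i j n : (N i j <= n)%N -> (i + j <= 2)%N ->
  nrm (pd i j (phi n) \- wderiv Omega i j v) <= e / 4 := svalP (cid (ex i j)) n.
pose n := \max_(i < 3) \max_(j < 3) N i j.
exists (phi n) => //.
have [WB _] := W22B Wv (W22_test (tp n)).
apply: (@le_lt_trans _ _ (3 * (e / 4))); last by lra.
apply: W22norm_le => //; first exact: ltW.
move=> i j ij; rewrite wderivB_test//; apply: HN => //.
have i3 : (i < 3)%N by rewrite ltnS (leq_trans _ ij)// leq_addr.
have j3 : (j < 3)%N by rewrite ltnS (leq_trans _ ij)// leq_addl.
apply: leq_trans (leq_bigmax (Ordinal i3)).
exact: (@leq_bigmax _ (fun j : 'I_3 => N i j) (Ordinal j3)).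
Qed.

(** By [pd_bound] the derivatives of order at most two are Cauchy as well, and
    the defining identity of weak derivatives passes to their limits. *)
Lemma approx_of_cauchy (phi : nat -> R * R -> R) : (forall n, test (phi n)) ->
  (forall e, 0 < e -> exists N, forall n m, (N <= n)%N -> (N <= m)%N ->
     nrm (lap (phi n \- phi m)) <= e) ->
  exists v, approx phi v.
Proof.
move=> tp Cp.
have ex i j : exists g, (i + j <= 2)%N ->
    sqi g /\ nrm (pd i j (phi n) \- g) @[n --> \oo] --> (0 : R).
  have [ij|ij] := boolP (i + j <= 2)%N; last by exists (fun=> 0).
  have [C C0 HC] := pd_bound ij.
  have [||g sg cg] := @sqi_complete _ T2 R mu2 Omega mO (fun n => pd i j (phi n)).
  - by move=> n; exact/tsq/test_pd.
  - move=> e e0.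
    have e1 : 0 < e / (C + 1) by rewrite divr_gt0//; lra.
    have [N HN] := Cp _ e1; exists N => n m Nn Nm.
    rewrite -pdB; try by exact: test_smooth (tp _).
    apply: le_trans (HC _ (testB (tp n) (tp m))) _.
    apply: (@le_trans _ _ (C * (e / (C + 1)))); first by rewrite ler_wpM2l// HN.
    by rewrite mulrA ler_pdivrMr; lra.
  - by exists g.
pose G i j := sval (cid (ex i j)).
have HG i j : (i + j <= 2)%N -> sqi (G i j) /\
   nrm (pd i j (phi n) \- G i j) @[n --> \oo] --> (0 : R) := svalP (cid (ex i j)).
have [s0 c0] := HG 0%N 0%N isT.
have HW i j : (i + j <= 2)%N -> is_wderiv Omega i j (G 0%N 0%N) (G i j) /\ sqi (G i j).
  move=> ij; have [sg cg] := HG i j ij; split => //; apply/is_wderivE; split.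
  - exact: (sqi_L1loc oO OB s0).
  - exact: (sqi_L1loc oO OB sg).
  - move=> psi tpsi.
    have sp f : sqi f -> nrm (f \- f) = 0.
      move=> sf; rewrite nrmE (_ : ip _ _ = 0) ?sqrtr0// ipBl// ?subrr//; exact: sqiB.
    have tq : test (pderiv i j psi) by rewrite -pdE; exact: test_pd.
    have c1 : ip (phi n) (pderiv i j psi) @[n --> \oo] --> ip (G 0%N 0%N) (pderiv i j psi).
      apply: (ip_cvg mO) => //; try by [move=> n; exact: tsq|exact: tsq].
      by rewrite (sp _ (tsq tq)); exact: cvg_cst.
    have c2 : ip (phi n) (pderiv i j psi) @[n --> \oo] --> (-1) ^+ (i + j) * ip (G i j) psi.
      have -> : (fun n => ip (phi n) (pderiv i j psi)) =
          (fun n => (-1) ^+ (i + j) * ip (pd i j (phi n)) psi).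
        apply/funext => n.
        by have /is_wderivE[_ _ ->] := is_wderiv_test oO r0 OB i j (tp n).
      apply: cvgM; first exact: cvg_cst.
      apply: (ip_cvg mO) => //; try by [move=> n; exact/tsq/test_pd|move=> n; exact: tsq|exact: tsq].
      by rewrite (sp _ (tsq tpsi)); exact: cvg_cst.
    exact: (cvg_unique _ c1 c2).
have [Wv Ev] := W22_of HW.
exists (G 0%N 0%N); split => // i j ij.
have [sg cg] := HG i j ij.
have -> : (fun n => nrm (pd i j (phi n) \- wderiv Omega i j (G 0%N 0%N))) =
   (fun n => nrm (pd i j (phi n) \- G i j)); last by [].
apply/funext => n; have mp := (tsq (test_pd i j (tp n))).1.
have mw := wderiv_measurable Wv ij; have mg := sg.1.
apply: nrm_ae => //; try by exact: measurable_funB.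
by apply: aeS (Ev i j ij) => z E Oz /=; rewrite E.
Qed.

End Sobolev2.

(** * Continuity of the cubic and quartic functionals *)

Lemma mul_halves (R : realType) (a b x y : R) : 0 <= a -> 0 <= b ->
  2 * a <= y -> 2 * b <= x -> a * b <= 4^-1 * (x * y).
Proof.
move=> a0 b0 ay bx.
have : 2 * a * (2 * b) <= y * x by apply: ler_pM => //; exact: mulr_ge0.
by lra.
Qed.

Section Functionals.
Context {R : realType}.
Local Notation T2 := (measurableTypeR R * measurableTypeR R)%type.
Local Notation mu2 := (leb2 R).
Implicit Types (f g v w : R * R -> R).
Variable Omega : set (R * R).
Variable r : R.
Hypothesis oO : open Omega.
Hypothesis r0 : 0 < r.
Hypothesis OB : Omega `<=` orect (- r) r (- r) r.
Let mO : measurable (Omega : set T2) := open_measurable2 oO.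
Local Notation ip := (inner mu2 Omega).
Local Notation nrm := (l2norm mu2 Omega).
Local Notation sqi := (sqi mu2 Omega).
Local Notation test := (test_function Omega).
Local Notation N f := (l2norm mu2 Omega (lap f)).
Let tsq := fun f => @test_sqi R Omega r oO OB f.

(** Both first derivatives under one name, so that estimates of their products are
    proved once; likewise for [gw]. *)
Definition gr (b : bool) f : R * R -> R := if b then px f else py f.
Definition gg (b c : bool) f : R * R -> R := fun z => gr b f z * gr c f z.
Definition cub f : R := ip (gg true false f) (pd 1 1 f).
Definition quart f : R := ip (gg true true f \+ gg false false f) (gg true true f \+ gg false false f).
Definition quartW v : R := \int[mu2]_(z in Omega)
    ((wderiv Omega 1 0 v z ^+ 2 + wderiv Omega 0 1 v z ^+ 2) ^+ 2).

Lemma test_gr b f : test f -> test (gr b f).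
Proof. by case: b; [exact: test_px|exact: test_py]. Qed.

Lemma test_gg b c f : test f -> test (gg b c f).
Proof. by move=> tf; apply: testM; [exact/test_smooth/test_gr/tf|exact: test_gr]. Qed.

Lemma grB b f g : smooth f -> smooth g -> gr b (f \- g) = gr b f \- gr b g.
Proof. by case: b; [exact: pxB|exact: pyB]. Qed.

Lemma gr_interp b f M : 0 <= M -> test f -> (forall z, `|f z| <= M) ->
  nrm (gg b b f) <= 3 * M * N f.
Proof.
move=> M0 tf fM; have M3 : 0 <= 3 * M by rewrite mulr_ge0.
case: b.
  apply: le_trans (interp_x oO r0 OB M0 tf fM) _; apply: ler_wpM2l => //.
  exact: (nrm_xx oO r0 OB tf).
apply: le_trans (interp_y oO r0 OB M0 tf fM) _; apply: ler_wpM2l => //.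
exact: (nrm_yy oO r0 OB tf).
Qed.

Lemma sup_N f : test f -> forall z, `|f z| <= r * N f.
Proof.
move=> tf z; have S0 := sup_bound r0 OB z tf; apply: (le_trans S0).
rewrite (mulrC 2) -mulrA; apply: ler_wpM2l; first exact: ltW.
exact: (nrm_xy oO r0 OB tf).
Qed.

Lemma gr_bound b f : test f -> nrm (gg b b f) <= (Num.sqrt (3 * r) * N f) ^+ 2.
Proof.
move=> tf; have rN : 0 <= r * N f by rewrite mulr_ge0 ?nrm_ge0// ltW.
apply: le_trans (gr_interp b rN tf (sup_N tf)) _.
rewrite exprMn sqr_sqrtr; last by rewrite mulr_ge0// ltW.
by rewrite mulrA expr2 mulrA.
Qed.

Lemma NB f g : test f -> test g -> N (f \- g) <= N f + N g.
Proof.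
move=> tf tg; rewrite lapB; [|exact: test_smooth tf|exact: test_smooth tg].
have sf := tsq (test_lap tf); have sg := tsq (test_lap tg).
have := nrmD mO sf (sqiN mO sg); by rewrite nrmN.
Qed.

(** Compactness enters the nonlinear terms here: when [f - g] is uniformly small
    while the second derivatives stay bounded, [gr_interp] makes the gradient of
    [f - g] small in L4, whereas the other factor stays bounded in L4. *)
Lemma gr_prod_small (L e : R) : 0 <= L -> 0 < e -> exists2 eta, 0 < eta &
  forall b c f g, test f -> test g -> N f <= L -> N g <= L ->
    (forall z, `|f z - g z| <= eta) -> nrm (gg b c f \- gg b c g) <= e.
Proof.
move=> L0 e0.
pose K := Num.sqrt (3 * r) * L.
have K0 : 0 <= K by rewrite mulr_ge0 ?sqrtr_ge0.
pose A := 2 * (Num.sqrt (6 * L) * K).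
have A0 : 0 <= A by rewrite !mulr_ge0 ?sqrtr_ge0.
have [s s0 sA] : exists2 s, 0 < s & s * (A + 1) = e.
  by exists (e / (A + 1)); [rewrite divr_gt0//; lra|rewrite divfK// gt_eqF//; lra].
exists (s ^+ 2) => [|b c f g tf tg fL gL fg]; first by rewrite exprn_gt0.
have tfg := testB tf tg.
have sf := test_smooth tf; have sg := test_smooth tg.
pose E := Num.sqrt (6 * L) * s.
have E0 : 0 <= E by rewrite mulr_ge0 ?sqrtr_ge0 ?ltW.
have EE : E ^+ 2 = 6 * L * s ^+ 2.
  by rewrite /E exprMn sqr_sqrtr// mulr_ge0.
have bE b' : nrm (gg b' b' (f \- g)) <= E ^+ 2.
  apply: le_trans (gr_interp b' (sqr_ge0 s) tfg fg) _.
  rewrite EE.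
  have H : N (f \- g) <= 2 * L by apply: le_trans (NB tf tg) _; lra.
  have p : 0 <= 3 * s ^+ 2 by rewrite mulr_ge0 ?sqr_ge0.
  by apply: le_trans (ler_wpM2l p H) _; lra.
have bK b' h : test h -> N h <= L -> nrm (gg b' b' h) <= K ^+ 2.
  move=> th hL; apply: le_trans (gr_bound b' th) _.
  apply: lerXn2r; rewrite ?nnegrE ?mulr_ge0 ?sqrtr_ge0 ?nrm_ge0//.
  by apply: ler_wpM2l => //; exact: sqrtr_ge0.
have sgg b' h : test h -> sqi (fun z => gr b' h z * gr b' h z).
  by move=> th; exact: (tsq (test_gg b' b' th)).
have -> : gg b c f \- gg b c g = (fun z => gr b (f \- g) z * gr c f z) \+
   (fun z => gr b g z * gr c (f \- g) z).
  by rewrite !grB//; apply/funext => z; rewrite /gg /=; lra.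
have t1 : test (fun z => gr b (f \- g) z * gr c f z).
  by apply: testM; [exact/test_smooth/test_gr/tfg|exact: test_gr].
have t2 : test (fun z => gr b g z * gr c (f \- g) z).
  by apply: testM; [exact/test_smooth/test_gr/tg|exact: test_gr].
apply: le_trans (nrmD mO (tsq t1) (tsq t2)) _.
have H1 : nrm (fun z => gr b (f \- g) z * gr c f z) <= E * K.
  by apply: (nrm_mul_le_sq mO E0 K0); [exact: sgg|exact: sgg|exact: bE|exact: bK].
have H2 : nrm (fun z => gr b g z * gr c (f \- g) z) <= K * E.
  by apply: (nrm_mul_le_sq mO K0 E0); [exact: sgg|exact: sgg|exact: bK|exact: bE].
apply: (@le_trans _ _ (A * s)).
  by apply: le_trans (lerD H1 H2) _; rewrite /A /E; lra.
by rewrite -sA; lra.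
Qed.

Lemma laplacian_sqi v : W22 Omega v -> sqi (laplacian Omega v).
Proof.
move=> Wv; apply: (sqiD mO); [exact: (W22_wderiv oO Wv (i := 2) (j := 0) isT).2|
  exact: (W22_wderiv oO Wv (i := 0) (j := 2) isT).2].
Qed.

Lemma norm220E v : W22 Omega v -> norm220 Omega v = nrm (laplacian Omega v).
Proof. by move=> Wv; rewrite /norm220 L2normE//; case: (laplacian_sqi Wv). Qed.

Lemma int_laplacian v : W22 Omega v ->
  \int[mu2]_(z in Omega) (laplacian Omega v z ^+ 2) = norm220 Omega v ^+ 2.
Proof.
by move=> Wv; rewrite norm220E// nrm_sqr ipE; apply: eq_Rintegral => z _; rewrite expr2.
Qed.

Lemma approx_lap phi v : approx Omega phi v ->
  nrm (lap (phi n) \- laplacian Omega v) @[n --> \oo] --> (0 : R).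
Proof.
move=> [tp Wv H].
have s20 := (W22_wderiv oO Wv (i := 2) (j := 0) isT).2.
have s02 := (W22_wderiv oO Wv (i := 0) (j := 2) isT).2.
exact: (@nrm_cvgD _ T2 R mu2 Omega mO (fun n => pd 2 0 (phi n)) (fun n => pd 0 2 (phi n))
  _ _ (fun n => tsq (test_pd 2 0 (tp n))) (fun n => tsq (test_pd 0 2 (tp n)))
  s20 s02 (H 2%N 0%N isT) (H 0%N 2%N isT)).
Qed.

Lemma approx_N phi v : approx Omega phi v -> N (phi n) @[n --> \oo] --> norm220 Omega v.
Proof.
move=> Ha; have [tp Wv _] := Ha; rewrite norm220E//.
apply: (nrm_cvg mO _ (laplacian_sqi Wv) (approx_lap Ha)) => n.
exact/tsq/test_lap.
Qed.

Lemma approx_cauchy phi v : approx Omega phi v -> forall e, 0 < e ->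
  exists M, forall n m, (M <= n)%N -> (M <= m)%N -> N (phi n \- phi m) <= e.
Proof.
move=> Ha e e0; have [tp Wv _] := Ha; have sv := laplacian_sqi Wv.
have e2 : 0 < e / 2 by rewrite divr_gt0.
have [M _ HM] := (cvgrPdist_le _ _).1 (approx_lap Ha) _ e2; exists M => n m Mn Mm.
have := HM n Mn; have := HM m Mm; rewrite /= !sub0r !normrN !ger0_norm ?nrm_ge0// => h1 h2.
rewrite lapB; [|exact: test_smooth (tp n)|exact: test_smooth (tp m)].
have sn := tsq (test_lap (tp n)); have sm := tsq (test_lap (tp m)).
apply: le_trans (nrmB_tri mO sn sv sm) _; rewrite (nrmBC mu2 Omega (laplacian Omega v)).
have -> : e = e / 2 + e / 2 by lra.
exact: lerD.
Qed.

Lemma approx_bounded phi v : approx Omega phi v -> exists M, forall n, (M <= n)%N ->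
  N (phi n) <= norm220 Omega v + 1.
Proof.
move=> Ha; have [M _ HM] := (cvgrPdist_le _ _).1 (approx_N Ha) 1 ltr01.
exists M => n /HM /=; rewrite ler_norml => /andP[h1 h2].
have H (a b : R) : -1 <= a - b -> b <= a + 1 by lra.
exact: H.
Qed.

Definition gw (b : bool) v : R * R -> R := if b then wderiv Omega 1 0 v else wderiv Omega 0 1 v.

(** By [gr_prod_small] the products form a Cauchy sequence; [sqi_mul_cvg] then
    identifies the limit. *)
Lemma approx_gg b c phi v : approx Omega phi v ->
  sqi (fun z => gw b v z * gw c v z) /\
  nrm (gg b c (phi n) \- (fun z => gw b v z * gw c v z)) @[n --> \oo] --> (0 : R).
Proof.
move=> Ha; have [tp Wv H] := Ha.
have c1 : continuous (fun _ : R * R => 1 : R) by move=> z; exact: cvg_cst.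
have gwP b' : sqi (gw b' v) /\ nrm (gr b' (phi n) \- gw b' v) @[n --> \oo] --> (0 : R).
  case: b'; split.
  - exact: (W22_wderiv oO Wv (i := 1) (j := 0) isT).2.
  - exact: (H 1%N 0%N isT).
  - exact: (W22_wderiv oO Wv (i := 0) (j := 1) isT).2.
  - exact: (H 0%N 1%N isT).
have [sb cb] := gwP b; have [sc cc] := gwP c.
apply: (sqi_mul_cvg mO (cont_sqi oO OB c1) _ _ sb sc _ cb cc).
- by move=> n; exact/tsq/test_gr.
- by move=> n; exact/tsq/test_gr.
- by move=> n; exact/tsq/test_gg.
move=> e e0.
have [M1 HM1] := approx_bounded Ha.
have L0 : 0 <= norm220 Omega v + 1 by rewrite addr_ge0// norm220E// nrm_ge0.
have [eta eta0 Heta] := gr_prod_small L0 e0.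
have er : 0 < eta / r by rewrite divr_gt0.
have [M2 HM2] := approx_cauchy Ha er.
exists (M1 + M2)%N => n m Mn Mm.
have n1 : (M1 <= n)%N := leq_trans (leq_addr _ _) Mn.
have n2 : (M2 <= n)%N := leq_trans (leq_addl _ _) Mn.
have m1 : (M1 <= m)%N := leq_trans (leq_addr _ _) Mm.
have m2 : (M2 <= m)%N := leq_trans (leq_addl _ _) Mm.
apply: Heta => //; [exact: HM1|exact: HM1|move=> z].
apply: le_trans (sup_N (testB (tp n) (tp m)) z) _.
have := HM2 n m n2 m2; rewrite ler_pdivlMr// mulrC; exact.
Qed.

Lemma approx_cub phi v : approx Omega phi v -> cub (phi n) @[n --> \oo] --> cubic Omega v.
Proof.
move=> Ha; have [tp Wv H] := Ha.
have [sg cg] := approx_gg true false Ha.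
have s11 := (W22_wderiv oO Wv (i := 1) (j := 1) isT).2.
rewrite (_ : cubic Omega v = ip (fun z => gw true v z * gw false v z) (wderiv Omega 1 1 v)).
  exact: (@ip_cvg _ T2 R mu2 Omega mO (fun n => gg true false (phi n))
    (fun n => pd 1 1 (phi n)) _ _ (fun n => tsq (test_gg true false (tp n)))
    (fun n => tsq (test_pd 1 1 (tp n))) sg s11 cg (H 1%N 1%N isT)).
by rewrite ipE.
Qed.

Lemma approx_quart phi v : approx Omega phi v ->
  sqi (fun z => wderiv Omega 1 0 v z ^+ 2 + wderiv Omega 0 1 v z ^+ 2) /\
  quart (phi n) @[n --> \oo] --> quartW v.
Proof.
move=> Ha; have [tp Wv H] := Ha.
have [s1 c1] := approx_gg true true Ha; have [s2 c2] := approx_gg false false Ha.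
have E : (fun z => wderiv Omega 1 0 v z ^+ 2 + wderiv Omega 0 1 v z ^+ 2) =
  (fun z => gw true v z * gw true v z) \+ (fun z => gw false v z * gw false v z).
  by apply/funext => z; exact: (congr2 +%R (expr2 (wderiv Omega 1 0 v z)) (expr2 (wderiv Omega 0 1 v z))).
have sE := sqiD mO s1 s2.
split; first by rewrite E.
rewrite (_ : quartW v = ip ((fun z => gw true v z * gw true v z) \+ (fun z => gw false v z * gw false v z))
  ((fun z => gw true v z * gw true v z) \+ (fun z => gw false v z * gw false v z))); last first.
  rewrite ipE -E; apply: eq_Rintegral => z _; exact: expr2.
have sn n : sqi (gg true true (phi n) \+ gg false false (phi n)).
  by apply: (sqiD mO); exact/tsq/test_gg.
have cn : nrm ((gg true true (phi n) \+ gg false false (phi n)) \-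
   ((fun z => gw true v z * gw true v z) \+ (fun z => gw false v z * gw false v z))) @[n --> \oo] --> (0 : R).
  exact: (@nrm_cvgD _ T2 R mu2 Omega mO (fun n => gg true true (phi n))
    (fun n => gg false false (phi n)) _ _ (fun n => tsq (test_gg true true (tp n)))
    (fun n => tsq (test_gg false false (tp n))) s1 s2 c1 c2).
exact: (ip_cvg mO sn sn sE sE cn cn).
Qed.

(** The pointwise bound [2 |f_x f_y| <= |grad f| ^ 2] and the estimate of the mixed
    derivative each contribute one factor [1 / 2]. *)
Lemma cub_quart f : test f -> `|cub f| <= 4^-1 * (N f * Num.sqrt (quart f)).
Proof.
move=> tf; have t1 := test_gg true false tf; have t2 := test_pd 1 1 tf.
apply: le_trans (ip_le_nrm mO (tsq t1) (tsq t2)) _.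
have H2 : 2 * nrm (pd 1 1 f) <= N f.
  by rewrite /pd /= (smooth_pxpyC (test_smooth tf)); exact: (nrm_xy oO r0 OB tf).
have tq : test (gg true true f \+ gg false false f) by apply: testD; exact: test_gg.
have H0 (a b : R) : 2 * (a * b) * (2 * (a * b)) <= (a * a + b * b) * (a * a + b * b).
  by have := sqr_ge0 (a * a - b * b); rewrite expr2; lra.
have H1 : 2 * nrm (gg true false f) <= Num.sqrt (quart f).
  have e2 : 0 <= (2 : R) by [].
  rewrite -(ger0_norm e2) -(nrmZ mO _ (tsq t1)) nrmE ler_wsqrtr// /quart !ipE.
  have c1 := test_continuous t1; have cq := test_continuous tq.
  apply: le_Rintegral => //.
  - by apply: (cont_integrable oO OB); apply: continuousM2; exact: continuousZ2.
  - by apply: (cont_integrable oO OB); exact: continuousM2.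
  - move=> z _; exact: H0 (px f z) (py f z).
have p1 := nrm_ge0 mu2 Omega (gg true false f); have p2 := nrm_ge0 mu2 Omega (pd 1 1 f).
exact: mul_halves.
Qed.

Lemma quart_bound f : test f -> Num.sqrt (quart f) <= 6 * r * N f ^+ 2.
Proof.
move=> tf; rewrite /quart -nrmE.
apply: le_trans (nrmD mO (tsq (test_gg true true tf)) (tsq (test_gg false false tf))) _.
have := lerD (gr_bound true tf) (gr_bound false tf).
rewrite exprMn sqr_sqrtr; last by rewrite mulr_ge0// ltW.
have H (a b c : R) : c <= 3 * r * a + 3 * r * a -> c <= 6 * r * a by lra.
exact: H.
Qed.

Lemma quart_ge0 f : 0 <= quart f. Proof. exact: ip_ge0. Qed.

Lemma lapZ c f : smooth f -> lap (fun z => c * f z) = (fun z => c * lap f z).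
Proof.
move=> sf; rewrite /lap pxZ// pyZ// pxZ ?pyZ//; try by [exact: smooth_px|exact: smooth_py].
by apply/funext => z /=; lra.
Qed.

Lemma lapD f g : smooth f -> smooth g -> lap (f \+ g) = lap f \+ lap g.
Proof.
move=> sf sg; rewrite /lap pxD// pyD// pxD ?pyD//; try by [exact: smooth_px|exact: smooth_py].
by apply/funext => z /=; lra.
Qed.

Lemma grZ b c f : smooth f -> gr b (fun z => c * f z) = (fun z => c * gr b f z).
Proof. by case: b => sf; [exact: pxZ|exact: pyZ]. Qed.

Lemma ggZ b b' c f : smooth f -> gg b b' (fun z => c * f z) = (fun z => c ^+ 2 * gg b b' f z).
Proof.
by move=> sf; rewrite /gg !grZ//; apply/funext => z; rewrite expr2; lra.
Qed.

Lemma pd11Z c f : smooth f -> pd 1 1 (fun z => c * f z) = (fun z => c * pd 1 1 f z).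
Proof. by move=> sf; rewrite /pd /= pyZ// pxZ//; exact: smooth_py. Qed.

Lemma NZ c f : test f -> N (fun z => c * f z) = `|c| * N f.
Proof.
move=> tf; rewrite lapZ; last exact: test_smooth tf.
by rewrite (nrmZ mO)//; exact/tsq/test_lap.
Qed.

Lemma cubZ c f : test f -> cub (fun z => c * f z) = c ^+ 3 * cub f.
Proof.
move=> tf; have sf := test_smooth tf; rewrite /cub ggZ// pd11Z//.
have t1 := tsq (test_gg true false tf); have t2 := tsq (test_pd 1 1 tf).
rewrite (ipZl mO)//; last exact: (sqiZ mO).
by rewrite ipC (ipZl mO)// ipC mulrA -exprSr.
Qed.

Lemma quartZ c f : test f -> quart (fun z => c * f z) = c ^+ 4 * quart f.
Proof.
move=> tf; have sf := test_smooth tf.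
have s := tsq (testD (test_gg true true tf) (test_gg false false tf)).
rewrite /quart !ggZ//.
rewrite (_ : _ \+ _ = (fun z => c ^+ 2 * (gg true true f \+ gg false false f) z)); last first.
  by apply/funext => z /=; lra.
rewrite (ipZl mO)//; last exact: (sqiZ mO).
by rewrite ipC (ipZl mO)// mulrA -exprD.
Qed.

End Functionals.

(** * Compactness and existence of maximisers *)

(** Here [x] and [y] are the norms of two near-maximisers of a functional of
    degree [k + 2] on the unit ball, [m] that of their midpoint and [d] that of
    their difference. Since the midpoint nearly attains [M], its norm is close to
    1, and the parallelogram identity leaves no room for [d]. *)
Lemma near_max_close (R : realType) (k : nat) (M eps e Tu Tw Tm x y m d : R) :
  0 < M -> 0 <= e -> eps = e ^+ 2 * M / 8 ->
  M - eps <= Tu -> M - eps <= Tw -> 2^-1 * (Tu + Tw) - eps <= Tm ->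
  Tm <= M * m ^+ k.+2 -> 0 <= x -> x <= 1 -> 0 <= y -> y <= 1 -> 0 <= m -> 0 <= d ->
  d ^+ 2 = 2 * x ^+ 2 + 2 * y ^+ 2 - 4 * m ^+ 2 -> d <= e.
Proof.
move=> M0 e0 Ee hu hw hT hm x0 x1 y0 y1 m0 d0 P.
have sx : x ^+ 2 <= 1 by rewrite expr_le1.
have sy : y ^+ 2 <= 1 by rewrite expr_le1.
have sd := sqr_ge0 d.
have sm : m ^+ 2 <= 1 by lra.
have m1 : m <= 1 by rewrite -(expr_le1 (n := 2)).
have mk : m ^+ k.+2 <= m ^+ 2.
  by rewrite -addn2 exprD -[X in _ <= X]mul1r ler_wpM2r ?sqr_ge0// exprn_ile1.
have mM : M * m ^+ k.+2 <= M * m ^+ 2 by rewrite ler_pM2l.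
have : M * (1 - m ^+ 2) <= M * (e ^+ 2 / 4) by lra.
rewrite ler_pM2l// => h.
by rewrite -(ler_pXn2r (n := 2))// P; lra.
Qed.

Section Maximizer.
Context {R : realType}.
Local Notation T2 := (measurableTypeR R * measurableTypeR R)%type.
Local Notation mu2 := (leb2 R).
Implicit Types (f g v w : R * R -> R).
Variable Omega : set (R * R).
Variable r : R.
Hypothesis oO : open Omega.
Hypothesis r0 : 0 < r.
Hypothesis OB : Omega `<=` orect (- r) r (- r) r.
Let mO : measurable (Omega : set T2) := open_measurable2 oO.
Local Notation ip := (inner mu2 Omega).
Local Notation nrm := (l2norm mu2 Omega).
Local Notation sqi := (sqi mu2 Omega).
Local Notation test := (test_function Omega).
Local Notation N f := (l2norm mu2 Omega (lap f)).
Let tsq := fun f => @test_sqi R Omega r oO OB f.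

Definition unit_test : set (R * R -> R) := [set f | test f /\ N f <= 1].

(** A horizontal step followed by a vertical one. *)
Lemma equicont f z p (h : R) : unit_test f -> Omega z -> - r <= p.1 <= z.1 -> - r <= p.2 <= z.2 ->
  z.1 - p.1 <= h -> z.2 - p.2 <= h -> `|f z - f p| <= Num.sqrt (h * (2 * r)).
Proof.
case: z => x y; case: p => x' y' [tf f1] Oz /= /andP[h1 h2] /andP[h3 h4] h5 h6.
have [/= /andP[_ h7] /andP[_ h8]] := OB Oz.
have r2 : 0 <= 2 * r by rewrite mulr_ge0// ltW.
have h9 : - r <= y := le_trans h3 h4.
have h10 : x' <= r := le_trans h2 (ltW h7).
have e1 := equicont_x r0 OB tf h1 h2 (ltW h7) h9 (ltW h8).
have e2 := equicont_y r0 OB tf h3 h4 (ltW h8) h1 h10.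
have h0 : 0 <= h by apply: le_trans h5; rewrite subr_ge0.
have n0 := nrm_ge0 mu2 Omega (py (px f)).
have nxy := nrm_xy oO r0 OB tf.
have s1 : Num.sqrt ((x - x') * (2 * r)) <= Num.sqrt (h * (2 * r)).
  by rewrite ler_wsqrtr// ler_wpM2r.
have s2 : Num.sqrt ((y - y') * (2 * r)) <= Num.sqrt (h * (2 * r)).
  by rewrite ler_wsqrtr// ler_wpM2r.
have e1' := le_trans e1 (ler_wpM2r n0 s1); have e2' := le_trans e2 (ler_wpM2r n0 s2).
have -> : f (x, y) - f (x', y') = (f (x, y) - f (x', y)) + (f (x', y) - f (x', y')) by lra.
apply: le_trans (ler_normD _ _) _; apply: le_trans (lerD e1' e2') _.
rewrite -mulrDr -[X in _ <= X]mulr1; apply: ler_wpM2l; first exact: sqrtr_ge0.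
apply: le_trans f1; apply: le_trans nxy.
by rewrite mulr_natl mulr2n.
Qed.

Section Ultra.
Variable U : set_system (R * R -> R).
Hypothesis UU : UltraFilter U.
Hypothesis U1 : U unit_test.

(** The values at [z] stay in the compact interval [[- r, r]] by [sup_N]. *)
Lemma ultra_limit z : exists l : R, forall e, 0 < e -> U [set f | `|f z - l| < e].
Proof.
pose F := fmap (fun f : R * R -> R => f z) U.
have FF : ProperFilter F by exact: fmap_proper_filter.
have FI : F `[- r, r]%classic.
  rewrite /F /fmap /=; apply: filterS U1 => f [tf f1] /=; rewrite in_itv/= -ler_norml.
  apply: le_trans (sup_N oO r0 OB tf z) _.
  by rewrite -[X in _ <= X]mulr1 ler_wpM2l// ltW.
have [l [_ cl]] := @segment_compact R (- r) r F FF FI.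
exists l => e e0.
have [//|H] := in_ultra_setVsetC [set f : R * R -> R | `|f z - l| < e] UU.
have Hn : nbhs l [set y | `|y - l| < e].
  by apply: filterS (near_ball l e e0) => y; rewrite /ball /= distrC.
have FH : F (~` [set y | `|y - l| < e]) by exact: H.
by have [y [/= Hy1 Hy2]] := cl _ _ FH Hn.
Qed.

(** An ultrafilter on the unit ball contains sets of arbitrarily small diameter
    in the sup norm: it converges at each point of a fine finite grid, and
    equicontinuity controls the values in between. *)
Lemma ultra_small (eta : R) : 0 < eta -> exists2 A, U A &
  forall f g, A f -> A g -> forall z, `|f z - g z| <= eta.
Proof.
move=> eta0; have [n Hn] := nat_gt (4 * r ^+ 2 / (eta / 4) ^+ 2).
have e4 : 0 < eta / 4 by rewrite divr_gt0.
(* the mesh of the grid, fine enough for [equicont] to give [eta / 4] *)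
pose h := 2 * r / n.+1%:R.
have n1 : 0 < n.+1%:R :> R by rewrite ltr0n.
have h0 : 0 < h by rewrite divr_gt0// mulr_gt0.
have hn : h * n.+1%:R = 2 * r by rewrite /h divfK// gt_eqF.
have hs : Num.sqrt (h * (2 * r)) <= eta / 4.
  rewrite -[X in _ <= X]ger0_norm ?(ltW e4)// -sqrtr_sqr ler_wsqrtr//.
  move: (le_lt_trans (ler_norm _) Hn).
  rewrite ltr_pdivrMr ?exprn_gt0// => /ltW {}Hn.
  rewrite -(ler_pM2r n1) mulrAC hn.
  apply: (@le_trans _ _ (4 * r ^+ 2)); first by rewrite expr2; lra.
  apply: le_trans Hn _; rewrite mulrC ler_wpM2l ?sqr_ge0// ler_nat//.
pose p (i j : 'I_n.+1) : R * R := (- r + i%:R * h, - r + j%:R * h).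
pose l i j := sval (cid (ultra_limit (p i j))).
have Hl i j e : 0 < e -> U [set f | `|f (p i j) - l i j| < e] := svalP (cid (ultra_limit (p i j))) e.
exists (unit_test `&` [set f | forall i j, `|f (p i j) - l i j| < eta / 4]).
  apply: filterI => //; apply: filter_forall => i; apply: filter_forall => j; exact: Hl.
move=> f g [uf fl] [ug gl] z.
have [Oz|Oz] := pselect (Omega z); last first.
  by rewrite (test_off uf.1 Oz) (test_off ug.1 Oz) subrr normr0 ltW.
have idx (x : R) : - r < x < r -> exists i : 'I_n.+1,
    - r <= - r + i%:R * h <= x /\ x - (- r + i%:R * h) <= h.
  move=> /andP[x1 x2].
  have q0 : 0 <= (x + r) / h by rewrite divr_ge0 ?(ltW h0)//; lra.
  have /andP[t1 t2] := truncn_itv q0.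
  have lt : (Num.trunc ((x + r) / h) < n.+1)%N.
    rewrite -(ltr_nat R); apply: le_lt_trans t1 _; rewrite ltr_pdivrMr// mulrC hn; lra.
  exists (Ordinal lt) => /=.
  move: t1 t2; rewrite -natr1 ler_pdivlMr// ltr_pdivrMr// => t1 t2.
  have t3 : 0 <= (Num.trunc ((x + r) / h))%:R * h by rewrite mulr_ge0// ltW.
  by split; [apply/andP; split; lra|lra].
have [zx zy] := OB Oz.
have [i [i1 i2]] := idx _ zx; have [j [j1 j2]] := idx _ zy.
have ef := le_trans (@equicont f z (p i j) h uf Oz i1 j1 i2 j2) hs.
have eg := le_trans (@equicont g z (p i j) h ug Oz i1 j1 i2 j2) hs.
have := fl i j; have := gl i j; move: ef eg; rewrite !ler_norml !ltr_norml.
move=> /andP[? ?] /andP[? ?] /andP[? ?] /andP[? ?]; apply/andP; split; lra.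
Qed.

End Ultra.

(** Relative compactness of the unit ball for the sup norm: an ultrafilter that
    contains all the [S n] plays the role of a convergent subsequence. *)
Lemma sup_cauchy_selection (S : nat -> set (R * R -> R)) :
  (forall n, S n !=set0) -> (forall n m, (n <= m)%N -> S m `<=` S n) ->
  (forall n, S n `<=` unit_test) ->
  exists2 u : nat -> R * R -> R, (forall n, S n (u n)) &
    forall eta, 0 < eta -> exists M, forall n m, (M <= n)%N -> (M <= m)%N ->
      forall z, `|u n z - u m z| <= eta.
Proof.
move=> S0 Sd Su.
pose F := filter_from [set: nat] S.
have FF : ProperFilter F.
  apply: filter_from_proper; last by move=> n _; exact: S0.
  apply: filter_from_filter; first by exists 0%N.
  move=> i j _ _; exists (i + j)%N => // f Hf.
  by split; [exact: (Sd _ _ (leq_addr _ _) _ Hf)|exact: (Sd _ _ (leq_addl _ _) _ Hf)].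
have [U [UU FU]] := ultraFilterLemma FF.
have US n : U (S n) by apply: FU; exists n.
have U1 : U unit_test by apply: filterS (US 0%N); exact: Su.
have ex n : exists A, U A /\ forall f g, A f -> A g -> forall z, `|f z - g z| <= n.+1%:R^-1.
  have e0 : 0 < n.+1%:R^-1 :> R by rewrite invr_gt0.
  by have [A UA HA] := ultra_small UU U1 e0; exists A.
pose A n := sval (cid (ex n)).
have HA n : U (A n) /\ forall f g, A n f -> A n g -> forall z, `|f z - g z| <= n.+1%:R^-1
  := svalP (cid (ex n)).
have UB n : U [set f | forall k, (k <= n)%N -> A k f].
  elim: n => [|n IH]; first by apply: filterS (HA 0%N).1 => f Af k; rewrite leqn0 => /eqP ->.
  apply: filterS (filterI IH (HA n.+1).1) => f [H1 H2] k.
  by rewrite leq_eqVlt => /orP[/eqP -> //|]; rewrite ltnS; exact: H1.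
have exu n : exists f, S n f /\ forall k, (k <= n)%N -> A k f.
  by have [f [H1 H2]] := filter_ex (filterI (US n) (UB n)); exists f.
exists (fun n => sval (cid (exu n))) => [n|eta eta0]; first by case: (svalP (cid (exu n))).
have [M HM] := nat_gt eta^-1.
exists M => n m Mn Mm z.
have [_ H1] := svalP (cid (exu n)); have [_ H2] := svalP (cid (exu m)).
apply: le_trans ((HA M).2 _ _ (H1 M Mn) (H2 M Mm) z) _.
rewrite -[X in _ <= X]invrK lef_pV2 ?posrE ?invr_gt0//.
apply: le_trans (ltW (le_lt_trans (ler_norm _) HM)) _.
by rewrite ler_nat.
Qed.

Definition mid f g : R * R -> R := fun z => 2^-1 * (f \+ g) z.

Lemma test_mid f g : test f -> test g -> test (mid f g).
Proof. by move=> tf tg; apply: testZ; exact: testD. Qed.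

Lemma N_parallelogram f g : test f -> test g ->
  N (f \- g) ^+ 2 = 2 * N f ^+ 2 + 2 * N g ^+ 2 - 4 * N (mid f g) ^+ 2.
Proof.
move=> tf tg; have sf := test_smooth tf; have sg := test_smooth tg.
have tfg := testD tf tg.
rewrite (NZ oO OB)// lapB// lapD// exprMn !nrm_sqr.
have s1 := tsq (test_lap tf); have s2 := tsq (test_lap tg).
rewrite (ip_sqrB mO s1 s2) (ip_sqrD mO s1 s2).
have -> : `|2^-1| ^+ 2 = 4^-1 :> R by rewrite ger0_norm//; lra.
have H (a b c : R) : a - 2 * b + c = 2 * a + 2 * c - 4 * (4^-1 * (a + 2 * b + c)) by lra.
exact: H.
Qed.

(** Near-maximisers whose midpoints are again near-maximisers must be close in
    energy, by the parallelogram identity, so compactness in the sup norm alone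
    yields a maximising sequence that converges in energy. *)
Lemma maximizer (Theta : (R * R -> R) -> R) (k : nat) (C : R) f0 :
  (forall c f, test f -> Theta (fun z => c * f z) = c ^+ k.+2 * Theta f) ->
  (forall f, unit_test f -> Theta f <= C) ->
  test f0 -> 0 < Theta f0 ->
  (forall e, 0 < e -> exists2 eta, 0 < eta & forall f g, unit_test f -> unit_test g ->
     (forall z, `|f z - g z| <= eta) -> 2^-1 * (Theta f + Theta g) - e <= Theta (mid f g)) ->
  exists M phi v, [/\ 0 < M, (forall f, test f -> Theta f <= M * N f ^+ k.+2),
    approx Omega phi v, Theta (phi n) @[n --> \oo] --> M & forall n, N (phi n) <= 1].
Proof.
move=> hom bnd tf0 T0 hmid.
have N00 f : test f -> N f = 0 -> Theta f = 0.
  move=> tf Nf; rewrite (_ : f = (fun z => 0 * f z)); first by rewrite hom// expr0n mul0r.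
  apply/funext => z; rewrite mul0r; apply/eqP; rewrite -normr_le0.
  by have := sup_N oO r0 OB tf z; rewrite Nf mulr0.
have normed f : test f -> 0 < N f ->
    unit_test (fun z => (N f)^-1 * f z) /\ Theta f = N f ^+ k.+2 * Theta (fun z => (N f)^-1 * f z).
  move=> tf Nf; split.
    split; first exact: testZ.
    by rewrite (NZ oO OB)// ger0_norm ?invr_ge0 ?nrm_ge0// mulVf// gt_eqF.
  by rewrite hom// mulrA -exprMn divff ?expr1n ?mul1r// gt_eqF.
pose E := [set Theta f | f in unit_test].
have Nf0 : 0 < N f0.
  by rewrite lt_def nrm_ge0 andbT; apply/eqP => /(N00 _ tf0) E0; move: T0; rewrite E0 ltxx.
have [u0 E0] := normed f0 tf0 Nf0.
have hE : has_sup E.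
  split; first by exists (Theta (fun z => (N f0)^-1 * f0 z)); exists (fun z => (N f0)^-1 * f0 z).
  by exists C => _ [f uf <-]; exact: bnd.
pose M := sup E.
have ubM f : unit_test f -> Theta f <= M.
  by move=> uf; apply: sup_upper_bound => //; exists f.
have M0 : 0 < M.
  apply: lt_le_trans (ubM _ u0); move: T0; rewrite E0 pmulr_rgt0// exprn_gt0//.
have HM f : test f -> Theta f <= M * N f ^+ k.+2.
  move=> tf; have [Nf|Nf] := eqVneq (N f) 0.
    by rewrite N00// mulr_ge0 ?(ltW M0)// exprn_ge0// nrm_ge0.
  have Np : 0 < N f by rewrite lt_def Nf nrm_ge0.
  have [uf ->] := normed f tf Np.
  by rewrite mulrC; apply: ler_wpM2r; [rewrite exprn_ge0// nrm_ge0|exact: ubM].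
pose S n := [set f | unit_test f /\ M - n.+1%:R^-1 < Theta f].
have [||| u Su uC] := @sup_cauchy_selection S.
- move=> n; have e0 : 0 < n.+1%:R^-1 :> R by rewrite invr_gt0.
  have [_ [f uf <-] Hf] := sup_adherent e0 hE.
  by exists f; split.
- move=> n m nm f [uf Hf]; split => //; apply: le_lt_trans Hf.
  by rewrite lerD2l lerN2 lef_pV2 ?posrE// ler_nat ltnS.
- by move=> n f [].
have tu n : test (u n) by case: (Su n) => -[].
have u1 n : unit_test (u n) by case: (Su n).
have cM : Theta (u n) @[n --> \oo] --> M.
  have : (M - Theta (u n)) @[n --> \oo] --> (0 : R).
    apply: (cvg0_le (v := fun n => n.+1%:R^-1)) => [n|]; last exact: cvg_harmonic.
    have [uf Hf] := Su n; rewrite subr_ge0 ubM//=.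
    have H (a b c : R) : a - b < c -> a - c <= b by lra.
    exact: H.
  move=> H; have H2 : (M - (M - Theta (u n))) @[n --> \oo] --> M - 0.
    by apply: cvgB => //; exact: cvg_cst.
  rewrite subr0 in H2.
  have -> : (fun n => Theta (u n)) = (fun n => M - (M - Theta (u n))).
    by apply/funext => n; rewrite opprB addrC subrK.
  exact: H2.
have [|v Hv] := @approx_of_cauchy R Omega r oO r0 OB u tu.
  move=> e e0.
  (* the constant required by [near_max_close] *)
  pose eps := e ^+ 2 * M / 8.
  have eps0 : 0 < eps by rewrite divr_gt0// mulr_gt0// exprn_gt0.
  have [eta eta0 Heta] := hmid _ eps0.
  have [M1 HM1] := uC _ eta0.
  have [M2 HM2] := nat_gt eps^-1.
  exists (M1 + M2)%N => n m Mn Mm.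
  have low j : (M1 + M2 <= j)%N -> M - eps <= Theta (u j).
    move=> Mj; have [_ /ltW] := Su j; apply: le_trans; rewrite lerD2l lerN2.
    rewrite -[X in _ <= X]invrK lef_pV2 ?posrE ?invr_gt0//.
    apply: le_trans (ltW (le_lt_trans (ler_norm _) HM2)) _.
    by rewrite ler_nat (leq_trans _ (leqnSn _))// (leq_trans _ Mj)// leq_addl.
  have n1 : (M1 <= n)%N := leq_trans (leq_addr _ _) Mn.
  have m1 : (M1 <= m)%N := leq_trans (leq_addr _ _) Mm.
  have Hmid := Heta _ _ (u1 n) (u1 m) (HM1 n m n1 m1).
  have tm := test_mid (tu n) (tu m).
  have ln := low n Mn; have lm := low m Mm.
  have le2 := HM _ tm.
  have Nn := (u1 n).2; have Nm := (u1 m).2.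
  have P := N_parallelogram (tu n) (tu m).
  have p1 := nrm_ge0 mu2 Omega (lap (u n)); have p2 := nrm_ge0 mu2 Omega (lap (u m)).
  have p3 := nrm_ge0 mu2 Omega (lap (mid (u n) (u m))).
  have p4 := nrm_ge0 mu2 Omega (lap (u n \- u m)).
  exact: (near_max_close M0 (ltW e0) erefl ln lm Hmid le2 p1 Nn p2 Nm p3 p4 P).
exists M, u, v; split => // n; by case: (u1 n).
Qed.

End Maximizer.

(** * The two extremal problems *)

Lemma aeS2 (R : realType) (P Q S : R * R -> Prop) : (forall z, P z -> Q z -> S z) ->
  {ae leb2 R, forall z, P z} -> {ae leb2 R, forall z, Q z} -> {ae leb2 R, forall z, S z}.
Proof.
move=> PQS aP aQ; apply: negligibleS (negligibleU aP aQ) => z /= nS.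
by apply/not_andP => -[Pz Qz]; exact/nS/PQS.
Qed.

Lemma sqr_close (R : realType) (e1 r x y : R) : 0 <= e1 -> 0 <= x -> 0 <= y ->
  x <= 6 * r -> y <= 6 * r -> - (e1 + e1) <= x - y ->
  y ^+ 2 - e1 * (24 * r) <= x ^+ 2.
Proof.
move=> e0 x0 y0 xr yr xy.
have : 0 <= (x - y + e1 + e1) * (x + y) by rewrite mulr_ge0; lra.
have : 0 <= e1 * (12 * r - x - y) by rewrite mulr_ge0; lra.
by rewrite !expr2; lra.
Qed.

Section Extremal.
Context {R : realType}.
Local Notation T2 := (measurableTypeR R * measurableTypeR R)%type.
Local Notation mu2 := (leb2 R).
Implicit Types (f g v w : R * R -> R).
Variable Omega : set (R * R).
Variable r : R.
Hypothesis oO : open Omega.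
Hypothesis r0 : 0 < r.
Hypothesis OB : Omega `<=` orect (- r) r (- r) r.
Let mO : measurable (Omega : set T2) := open_measurable2 oO.
Local Notation ip := (inner mu2 Omega).
Local Notation nrm := (l2norm mu2 Omega).
Local Notation sqi := (sqi mu2 Omega).
Local Notation test := (test_function Omega).
Local Notation N f := (l2norm mu2 Omega (lap f)).
Let tsq := fun f => @test_sqi R Omega r oO OB f.

Lemma unit_mid f g : unit_test Omega f -> unit_test Omega g -> unit_test Omega (mid f g).
Proof.
move=> [tf f1] [tg g1]; have sf := test_smooth tf; have sg := test_smooth tg.
split; first exact: test_mid.
rewrite (NZ oO OB); last exact: testD.
rewrite lapD// ger0_norm ?invr_ge0//.
have := nrmD mO (tsq (test_lap tf)) (tsq (test_lap tg)).
have H (a b c : R) : a <= 1 -> b <= 1 -> c <= a + b -> 2^-1 * c <= 1 by lra.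
exact: H.
Qed.

Lemma mid_dist f g eta : 0 <= eta -> (forall z, `|f z - g z| <= eta) ->
  (forall z, `|mid f g z - f z| <= eta) /\ (forall z, `|mid f g z - g z| <= eta).
Proof.
have H (a b e : R) : 0 <= e -> `|a - b| <= e -> `|2^-1 * (a + b) - a| <= e /\ `|2^-1 * (a + b) - b| <= e.
  by rewrite !ler_norml => e0 /andP[? ?]; split; apply/andP; split; lra.
by move=> e0 fg; split=> z; have [] := H _ _ _ e0 (fg z).
Qed.

Lemma nrm_pd11 f : unit_test Omega f -> nrm (pd 1 1 f) <= 1.
Proof.
move=> [tf f1]; rewrite /pd /= (smooth_pxpyC (test_smooth tf)).
have H (a b : R) : 0 <= a -> 2 * a <= b -> b <= 1 -> a <= 1 by lra.
exact: (H _ _ (nrm_ge0 _ _ _) (nrm_xy oO r0 OB tf) f1).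
Qed.

Lemma pd11D f g : smooth f -> smooth g -> pd 1 1 (f \+ g) = pd 1 1 f \+ pd 1 1 g.
Proof. by move=> sf sg; rewrite /pd /= pyD// pxD//; exact: smooth_py. Qed.

(** If [f] and [g] are uniformly close, the product of first derivatives of the
    midpoint is close to that of [f] and to that of [g], and the remaining factor,
    the mixed derivative, is linear. *)
Lemma cub_mid e : 0 < e -> exists2 eta, 0 < eta & forall f g,
  unit_test Omega f -> unit_test Omega g -> (forall z, `|f z - g z| <= eta) ->
  2^-1 * (cub Omega f + cub Omega g) - e <= cub Omega (mid f g).
Proof.
move=> e0; have [eta eta0 Heta] := gr_prod_small oO r0 OB ler01 e0.
exists eta => // f g uf ug fg; have um := unit_mid uf ug.
have [df dg] := mid_dist (ltW eta0) fg.
have [tf f1] := uf; have [tg g1] := ug; have [tm m1] := um.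
have Hf := Heta true false _ _ tm tf m1 f1 df.
have Hg := Heta true false _ _ tm tg m1 g1 dg.
have G t : test t -> sqi (gg true false t) by move=> tt; exact: tsq (test_gg true false tt).
have P t : test t -> sqi (pd 1 1 t) by move=> tt; exact: tsq (test_pd 1 1 tt).
have low t : unit_test Omega t -> nrm (gg true false (mid f g) \- gg true false t) <= e ->
    cub Omega t - e <= ip (gg true false (mid f g)) (pd 1 1 t).
  move=> ut Ht; have tt := ut.1.
  have := ip_le_nrm mO (sqiB mO (G _ tm) (G _ tt)) (P _ tt).
  rewrite (ipBl mO (G _ tm) (G _ tt) (P _ tt)) ler_norml => /andP[+ _].
  have : nrm (gg true false (mid f g) \- gg true false t) * nrm (pd 1 1 t) <= e * 1.
    by apply: ler_pM => //; [exact: nrm_ge0|exact: nrm_ge0|exact: nrm_pd11].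
  have H (a b c d : R) : a <= e * 1 -> - a <= b - c -> c - e <= b by lra.
  exact: H.
have E : pd 1 1 (mid f g) = (fun z => 2^-1 * (pd 1 1 f \+ pd 1 1 g) z).
  rewrite -(pd11D (test_smooth tf) (test_smooth tg)).
  exact: (pd11Z _ (smoothD (test_smooth tf) (test_smooth tg))).
rewrite [cub Omega (mid f g)]/cub E.
have sPP := sqiD mO (P _ tf) (P _ tg).
rewrite ipC (ipZl mO _ sPP (G _ tm)) (ipDl mO (P _ tf) (P _ tg) (G _ tm)).
rewrite (ipC mu2 Omega (pd 1 1 f) (gg true false (mid f g))).
rewrite (ipC mu2 Omega (pd 1 1 g) (gg true false (mid f g))).
have := low f uf Hf; have := low g ug Hg.
have H (a b c d : R) : b - e <= d -> a - e <= c -> 2^-1 * (a + b) - e <= 2^-1 * (c + d) by lra.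
exact: H.
Qed.

Let dens f := gg true true f \+ gg false false f.

(** The quartic functional involves no second derivative, so for uniformly close
    functions its value at the midpoint is close to both values. *)
Lemma quart_mid e : 0 < e -> exists2 eta, 0 < eta & forall f g,
  unit_test Omega f -> unit_test Omega g -> (forall z, `|f z - g z| <= eta) ->
  2^-1 * (quart Omega f + quart Omega g) - e <= quart Omega (mid f g).
Proof.
move=> e0; pose e1 := e / (24 * r).
have r24 : 0 < 24 * r by rewrite mulr_gt0.
have e10 : 0 < e1 by rewrite divr_gt0.
have Ee : e1 * (24 * r) = e by rewrite /e1 divfK// gt_eqF.
have [eta eta0 Heta] := gr_prod_small oO r0 OB ler01 e10.
exists eta => // f g uf ug fg; have um := unit_mid uf ug.
have [df dg] := mid_dist (ltW eta0) fg.
have tm := um.1; have m1 := um.2.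
have sd t : test t -> sqi (dens t).
  by move=> tt; apply: (sqiD mO); exact: tsq (test_gg _ _ tt).
have bd t : unit_test Omega t -> nrm (dens t) <= 6 * r.
  move=> [tt t1]; rewrite nrmE; apply: le_trans (quart_bound oO r0 OB tt) _.
  rewrite -[X in _ <= X]mulr1; apply: ler_wpM2l; first by rewrite mulr_ge0// ltW.
  by rewrite expr_le1 ?nrm_ge0.
have low t : unit_test Omega t -> (forall z, `|mid f g z - t z| <= eta) ->
    quart Omega t - e <= quart Omega (mid f g).
  move=> ut dt; have [tt t1] := ut.
  have h1 := Heta true true _ _ tm tt m1 t1 dt.
  have h2 := Heta false false _ _ tm tt m1 t1 dt.
  have E : dens (mid f g) \- dens t = (gg true true (mid f g) \- gg true true t) \+
     (gg false false (mid f g) \- gg false false t).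
    by apply/funext => z /=; rewrite opprD addrACA.
  have h3 : nrm (dens (mid f g) \- dens t) <= e1 + e1.
    rewrite E; apply: le_trans (nrmD mO _ _) (lerD h1 h2).
      by apply: (sqiB mO); exact: tsq (test_gg _ _ _).
    by apply: (sqiB mO); exact: tsq (test_gg _ _ _).
  have := nrm_dist mO (sd _ tm) (sd _ tt); move=> /le_trans /(_ h3).
  rewrite ler_norml => /andP[+ _].
  have := bd _ ut; have := bd _ um.
  have := nrm_ge0 mu2 Omega (dens t); have := nrm_ge0 mu2 Omega (dens (mid f g)).
  rewrite /quart -!nrm_sqr -/(dens t) -/(dens (mid f g)) -Ee.
  exact: (sqr_close (ltW e10)).
have := low f uf df; have := low g ug dg.
have H (a b c : R) : b - e <= c -> a - e <= c -> 2^-1 * (a + b) - e <= c by lra.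
exact: H.
Qed.

Lemma cub_le_unit f : unit_test Omega f -> cub Omega f <= 4^-1 * (6 * r).
Proof.
move=> [tf f1]; apply: le_trans (ler_norm _) _; apply: le_trans (cub_quart oO r0 OB tf) _.
apply: ler_wpM2l; first by rewrite invr_ge0.
have q := quart_bound oO r0 OB tf.
have r6 : 0 <= 6 * r by rewrite mulr_ge0// ltW.
rewrite -[X in _ <= X]mul1r; apply: ler_pM; rewrite ?nrm_ge0 ?sqrtr_ge0//.
apply: (le_trans q); rewrite -[X in _ <= X]mulr1; apply: ler_wpM2l => //.
by rewrite expr_le1 ?nrm_ge0.
Qed.

Lemma quart_le_unit f : unit_test Omega f -> quart Omega f <= (6 * r) ^+ 2.
Proof.
move=> [tf f1]; have q := quart_bound oO r0 OB tf.
have r6 : 0 <= 6 * r by rewrite mulr_ge0// ltW.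
rewrite -[X in X <= _]sqr_sqrtr; last exact: quart_ge0.
apply: lerXn2r; rewrite ?nnegrE ?sqrtr_ge0//.
apply: (le_trans q); rewrite -[X in _ <= X]mulr1; apply: ler_wpM2l => //.
by rewrite expr_le1 ?nrm_ge0.
Qed.

(** A zero integral would force zero integrals over all rectangles. *)
Lemma int_pos h z0 : test h -> (forall z, 0 <= h z) -> 0 < h z0 ->
  0 < \int[mu2]_(z in Omega) h z.
Proof.
move=> th h0 hz; have ch := test_continuous th.
rewrite lt_def Rintegral_ge0 ?andbT//; apply/eqP => I0.
suff : h z0 = 0 by move=> E; rewrite E ltxx in hz.
move: z0 {hz}; apply: (cont_rect_eq0 ch) => a b c d ab cd.
have mC : measurable (crect a b c d : set T2) by exact: measurable_crect.
apply/le_anti; rewrite Rintegral_ge0 ?andbT// -I0.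
have iC := continuous_integrable2 ch mC (@subset_refl _ _).
have iO := cont_integrable oO OB ch.
apply: fine_le; [exact: integrable_fin_num|exact: integrable_fin_num|].
rewrite [X in (X <= _)%E](_ : _ = (\int[mu2]_(z in crect a b c d `&` Omega) (h z)%:E)%E).
  apply: ge0_subset_integral => //; first exact: measurableI.
  - by apply/measurable_EFinP; exact: continuous_measurable2D.
  - by move=> z _; rewrite lee_fin.
rewrite [RHS]integral_mkcondr; apply: eq_integral => z _; rewrite /patch.
by case: ifPn => //; rewrite notin_setE => /(test_off th) ->.
Qed.

(** A product bump [A(x) B(y)] satisfies [f_x f_y = f f_xy], so its cubic
    integral is the integral of the nonnegative function [f f_xy ^ 2]. *)
Lemma bump_cub a b c d : a < b -> c < d -> crect a b c d `<=` Omega ->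
  test (bump a b c d) /\ 0 < cub Omega (bump a b c d).
Proof.
move=> ab cd CO.
have tb : test (bump a b c d).
  apply/test_functionP; split; first exact: smooth_bump.
  exists (crect a b c d); split => //; first exact: compact_crect.
  exact: bump_off_crect.
split => //.
pose A (z : R * R) : R := flat 0 (1 * z.1 + 0 * z.2 + - a) * flat 0 (-1 * z.1 + 0 * z.2 + b).
pose B (z : R * R) : R := flat 0 (0 * z.1 + 1 * z.2 + - c) * flat 0 (0 * z.1 + -1 * z.2 + d).
have sA : smooth A by move=> k; apply: CkM; exact: Ck_flat.
have sB : smooth B by move=> k; apply: CkM; exact: Ck_flat.
have A1 x y : A (x, y) = A (x, 0) by rewrite /A /= !mul0r.
have B2 x y : B (x, y) = B (0, y) by rewrite /B /= !mul0r.
have yA : py A = fun=> 0.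
  apply/funext => -[x y]; rewrite pyE; apply: (slice_yP _).2.
  rewrite (_ : (fun t => A (x, t)) = cst (A (x, 0))); last by apply/funext => t; rewrite A1.
  exact: is_derive_cst.
have xB : px B = fun=> 0.
  apply/funext => -[x y]; rewrite pxE; apply: (slice_xP _).2.
  rewrite (_ : (fun t => B (t, y)) = cst (B (0, y))); last by apply/funext => t; rewrite B2.
  exact: is_derive_cst.
have p0 : px (fun=> 0 : R) = (fun=> 0) /\ py (fun=> 0 : R) = (fun=> 0).
  by rewrite pxE pyE; apply: has_partialsE => x y; split; exact: is_derive_cst.
have E : bump a b c d = (fun z => A z * B z) by [].
have Ex : px (bump a b c d) = (fun z => px A z * B z).
  by rewrite E pxM// xB; apply/funext => z; rewrite mulr0 addr0.
have Ey : py (bump a b c d) = (fun z => A z * py B z).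
  by rewrite E pyM// yA; apply/funext => z; rewrite mul0r add0r.
have Exy : pd 1 1 (bump a b c d) = (fun z => px A z * py B z).
  rewrite /pd /= Ey pxM//; last exact: smooth_py.
  rewrite (smooth_pxpyC sB) xB p0.2; apply/funext => z; by rewrite mulr0 addr0.
have [x /andP[x1 x2] Hx] : exists2 x, a < x < b & px A (x, 0) != 0.
  pose m := (a + b) / 2.
  have am : a < m by rewrite /m; lra.
  have mb : m < b by rewrite /m; lra.
  have dA t : is_derive t (1:R) (fun t => A (t, 0)) (px A (t, 0)).
    by rewrite pxE; exact: (Ck_partials (sA 1%N) t 0).1.
  have [|x /[!in_itv]/= /andP[x1 x2] Ex2] := @MVT R (fun t => A (t, 0)) (fun t => px A (t, 0)) a m am (fun t _ => dA t).
    apply: continuous_subspaceT; exact: continuous_x (smooth_continuous sA).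
  exists x; first by rewrite x1 (lt_trans x2 mb).
  have Am : 0 < A (m, 0) by rewrite /A /= mulr_gt0// flat_gt0; lra.
  have Aa : A (a, 0) = 0 by rewrite /A /= (@flat_eq0 _ _ (1 * a + _ + _)) ?mul0r//; lra.
  apply/eqP => px0; rewrite px0 mul0r Aa subr0 in Ex2.
  by rewrite Ex2 ltxx in Am.
have [y /andP[y1 y2] Hy] : exists2 y, c < y < d & py B (0, y) != 0.
  pose m := (c + d) / 2.
  have am : c < m by rewrite /m; lra.
  have mb : m < d by rewrite /m; lra.
  have dB t : is_derive t (1:R) (fun t => B (0, t)) (py B (0, t)).
    by rewrite pyE; exact: (Ck_partials (sB 1%N) 0 t).2.
  have [|y /[!in_itv]/= /andP[x1' x2'] Ex2] := @MVT R (fun t => B (0, t)) (fun t => py B (0, t)) c m am (fun t _ => dB t).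
    apply: continuous_subspaceT; exact: continuous_y (smooth_continuous sB).
  exists y; first by rewrite x1' (lt_trans x2' mb).
  have Bm : 0 < B (0, m) by rewrite /B /= mulr_gt0// flat_gt0; lra.
  have Bc : B (0, c) = 0 by rewrite /B /= (@flat_eq0 _ _ (_ + 1 * c + _)) ?mul0r//; lra.
  apply/eqP => py0; rewrite py0 mul0r Bc subr0 in Ex2.
  by rewrite Ex2 ltxx in Bm.
have HxE : px A (x, y) = px A (x, 0).
  have H1 := (Ck_partials (sA 1%N) x y).1; have H2 := (Ck_partials (sA 1%N) x 0).1.
  rewrite pxE; case: H1 => _ <-; case: H2 => _ <-.
  by congr ('D_1 _ x); apply/funext => t; exact: A1.
have HyE : py B (x, y) = py B (0, y).
  have H1 := (Ck_partials (sB 1%N) x y).2; have H2 := (Ck_partials (sB 1%N) 0 y).2.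
  rewrite pyE; case: H1 => _ <-; case: H2 => _ <-.
  by congr ('D_1 _ y); apply/funext => t; exact: B2.
pose h z := bump a b c d z * ((px A z * py B z) * (px A z * py B z)).
have th : test h.
  rewrite (_ : h = (fun z => ((px A z * py B z) * (px A z * py B z)) * bump a b c d z)); last first.
    by apply/funext => z; rewrite /h mulrC.
  have sAB := smoothM (smooth_px sA) (smooth_py sB).
  exact: (testM (smoothM sAB sAB) tb).
have -> : cub Omega (bump a b c d) = \int[mu2]_(z in Omega) h z.
  rewrite /cub ipE; apply: eq_Rintegral => z _; rewrite /gg /gr Ex Ey Exy /h E.
  have H (p q s t : R) : p * s * (q * t) * (p * t) = q * s * (p * t * (p * t)) by lra.
  exact: H.
apply: (int_pos (z0 := (x, y)) th) => [z|]; rewrite /h.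
  by rewrite mulr_ge0 ?bump_ge0// -expr2 sqr_ge0.
apply: mulr_gt0; first by apply: bump_gt0; split; rewrite /= ?x1 ?y1 ?x2 ?y2.
by rewrite -expr2 exprn_even_gt0//= HxE HyE mulf_neq0.
Qed.

Lemma pdZ i j c f : smooth f -> pd i j (fun z => c * f z) = (fun z => c * pd i j f z).
Proof.
move=> sf; rewrite /pd.
have -> : iter j py (fun z => c * f z) = (fun z => c * iter j py f z).
  by elim: j => //= j ->; rewrite pyZ//; exact: smooth_iter_py.
by elim: i => //= i ->; rewrite pxZ//; apply: smooth_iter_px; exact: smooth_iter_py.
Qed.

Lemma approxZ c phi v : approx Omega phi v ->
  approx Omega (fun n z => c * phi n z) (fun z => c * v z).
Proof.
move=> [tp Wv H]; have [Wc Hc] := W22Z oO c Wv; split; [|exact: Wc|].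
  by move=> n; exact: testZ.
move=> i j ij; have [_ sw] := W22_wderiv oO Wv ij.
have sp n := tsq (test_pd i j (tp n)).
have -> : (fun n => nrm (pd i j (fun z => c * phi n z) \- wderiv Omega i j (fun z => c * v z))) =
   (fun n => `|c| * nrm (pd i j (phi n) \- wderiv Omega i j v)).
  apply/funext => n; rewrite -(nrmZ mO); last exact: (sqiB mO).
  rewrite pdZ; last exact: test_smooth (tp n).
  have mw : measurable_fun Omega (wderiv Omega i j (fun z => c * v z)).
    exact: (wderiv_measurable oO Wc ij).
  have mp := (sp n).1.
  apply: nrm_ae => //.
  - by apply: measurable_funB => //; exact: measurable_funM.
  - by apply: measurable_funM => //; apply: measurable_funB => //; case: sw.
  - by apply: aeS (Hc i j ij) => z E Oz /=; rewrite E// mulrBr.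
rewrite -[X in _ --> X](mulr0 `|c|); apply: cvgM; first exact: cvg_cst.
exact: H.
Qed.

Lemma W220Z c v : W220 Omega v -> [/\ W220 Omega (fun z => c * v z),
  norm220 Omega (fun z => c * v z) = `|c| * norm220 Omega v &
  cubic Omega (fun z => c * v z) = c ^+ 3 * cubic Omega v].
Proof.
move=> /(W220_approx oO r0 OB)[phi Ha]; have Hc := approxZ c Ha.
have [tp _ _] := Ha; split; first exact: (approx_W220 oO r0 OB Hc).
- have h1 := approx_N oO OB Hc.
  have h2 : N (fun z => c * phi n z) @[n --> \oo] --> `|c| * norm220 Omega v.
    have -> : (fun n => N (fun z => c * phi n z)) = (fun n => `|c| * N (phi n)).
      by apply/funext => n; rewrite (NZ oO OB).
    by apply: cvgM; [exact: cvg_cst|exact: (approx_N oO OB Ha)].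
  exact: (cvg_unique _ h1 h2).
- have h1 := approx_cub oO r0 OB Hc.
  have h2 : cub Omega (fun z => c * phi n z) @[n --> \oo] --> c ^+ 3 * cubic Omega v.
    have -> : (fun n => cub Omega (fun z => c * phi n z)) = (fun n => c ^+ 3 * cub Omega (phi n)).
      by apply/funext => n; rewrite (cubZ oO OB).
    by apply: cvgM; [exact: cvg_cst|exact: (approx_cub oO r0 OB Ha)].
  exact: (cvg_unique _ h1 h2).
Qed.

Lemma norm220_ge0 v : W22 Omega v -> 0 <= norm220 Omega v.
Proof. by move=> Wv; rewrite (norm220E oO Wv) nrm_ge0. Qed.

Lemma norm220_dist v w : W220 Omega v -> W220 Omega w ->
  `|norm220 Omega v - norm220 Omega w| <= norm220 Omega (v \- w).
Proof.
move=> [Wv _] [Ww _]; have [WB HB] := W22B oO Wv Ww.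
rewrite !(norm220E oO)//.
have sv := laplacian_sqi oO Wv; have sw := laplacian_sqi oO Ww.
rewrite (_ : nrm (laplacian Omega (v \- w)) = nrm (laplacian Omega v \- laplacian Omega w)).
  exact: (nrm_dist mO).
apply: nrm_ae => //; first by case: (laplacian_sqi oO WB).
  by apply: measurable_funB; [case: sv|case: sw].
have H1 := HB 2%N 0%N isT; have H2 := HB 0%N 2%N isT.
apply: aeS2 H1 H2 => z E1 E2 Oz.
have H (p q s t x y : R) : x = p - q -> y = s - t -> x + y = (p + s) - (q + t).
  by move=> -> ->; rewrite opprD addrACA.
exact: (H _ _ _ _ _ _ (E1 Oz) (E2 Oz)).
Qed.

Lemma ip0l h : ip (fun=> 0) h = 0.
Proof.
rewrite ipE (@eq_Rintegral _ _ _ _ _ (cst 0)) ?Rintegral_cst ?mul0r// => z _.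
by rewrite mul0r.
Qed.

Lemma ae_zero_is_wderiv i j v : W22 Omega v -> ae_zero Omega v -> is_wderiv Omega i j v (fun=> 0).
Proof.
move=> Wv v0; have [H00 _] := W22_wderiv oO Wv (i := 0) (j := 0) isT.
have [Lv _ _] := H00.
have c0 : continuous (fun _ : R * R => 0 : R) by move=> z; exact: cvg_cst.
have s0 := cont_sqi oO OB c0.
apply/is_wderivE; split => //; first exact: (sqi_L1loc oO OB s0).
move=> psi tpsi; have tp : test (pderiv i j psi) by rewrite -pdE; exact: test_pd.
have z0 := ip0l.
rewrite z0 mulr0 -[RHS](z0 (pderiv i j psi)).
apply: ip_ae_l => //; first exact: (L1loc_measurable oO Lv).
by case: (tsq tp).
Qed.

Lemma laplacian_ae0 v : W22 Omega v -> is_wderiv Omega 2 0 v (fun=> 0) ->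
  is_wderiv Omega 0 2 v (fun=> 0) -> norm220 Omega v = 0.
Proof.
move=> Wv H20 H02; rewrite (norm220E oO Wv).
have c0 : continuous (fun _ : R * R => 0 : R) by move=> z; exact: cvg_cst.
have s0 := cont_sqi oO OB c0.
rewrite (_ : nrm (laplacian Omega v) = nrm (fun=> 0)).
  by rewrite nrmE ip0l sqrtr0.
apply: nrm_ae; [exact: mO|by case: (laplacian_sqi oO Wv)|by case: s0|].
apply: aeS2 (wderiv_ae oO H20) (wderiv_ae oO H02) => z E1 E2 Oz.
have H (x y : R) : x = 0 -> y = 0 -> x + y = 0 by move=> -> ->; rewrite addr0.
exact: (H _ _ (E1 Oz) (E2 Oz)).
Qed.

Lemma ae_zero_norm220 v : W22 Omega v -> ae_zero Omega v -> norm220 Omega v = 0.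
Proof. by move=> Wv v0; apply: laplacian_ae0 => //; exact: ae_zero_is_wderiv. Qed.

(** By [pd_bound] at order 0, approximating test functions tend to 0 as soon as
    their Laplacians do. *)
Lemma norm220_eq0 v : W220 Omega v -> norm220 Omega v = 0 -> ae_zero Omega v.
Proof.
move=> Wv0 n0; have Wv := Wv0.1.
have [phi Ha] := W220_approx oO r0 OB Wv0; have [tp _ H] := Ha.
have [H00 s00] := W22_wderiv oO Wv (i := 0) (j := 0) isT.
have [C C0 HC] := pd_bound oO r0 OB (i := 0) (j := 0) isT.
have c1 : nrm (phi n) @[n --> \oo] --> (0 : R).
  apply: (cvg0_le (v := fun n => C * N (phi n))) => [n|].
    by rewrite nrm_ge0 /=; exact: (HC _ (tp n)).
  rewrite -[X in _ --> X](mulr0 C) -n0; apply: cvgM; first exact: cvg_cst.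
  exact: (approx_N oO OB Ha).
have c2 : nrm (phi n) @[n --> \oo] --> nrm (wderiv Omega 0 0 v).
  exact: (nrm_cvg mO (fun n => tsq (tp n)) s00 (H 0%N 0%N isT)).
have Z : {ae mu2, forall z, Omega z -> wderiv Omega 0 0 v z = 0}.
  exact: (nrm_eq0 mO s00 (cvg_unique _ c2 c1)).
have Hv : is_wderiv Omega 0 0 v v.
  apply/is_wderivE; have [Lv _ _] := H00; split => // psi tpsi.
  by rewrite expr0 mul1r.
have W := wderiv_ae oO Hv.
by apply: aeS2 Z W => z E1 E2 Oz; rewrite -E2// E1.
Qed.

(** A vanishing integrand means a vanishing weak gradient; the weak derivatives
    of that gradient are then zero too, and with them the Laplacian. *)
Lemma quartW_eq0 v : W220 Omega v -> quartW Omega v = 0 -> ae_zero Omega v.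
Proof.
move=> Wv0 q0; have Wv := Wv0.1; apply: norm220_eq0 => //.
have [phi Ha] := W220_approx oO r0 OB Wv0.
have [sq _] := approx_quart oO r0 OB Ha.
have [H10 s10] := W22_wderiv oO Wv (i := 1) (j := 0) isT.
have [H01 s01] := W22_wderiv oO Wv (i := 0) (j := 1) isT.
have Z : {ae mu2, forall z, Omega z -> wderiv Omega 1 0 v z ^+ 2 + wderiv Omega 0 1 v z ^+ 2 = 0}.
  apply: (nrm_eq0 mO sq); rewrite nrmE ipE.
  suff -> : \int[mu2]_(z in Omega) ((wderiv Omega 1 0 v z ^+ 2 + wderiv Omega 0 1 v z ^+ 2) *
    (wderiv Omega 1 0 v z ^+ 2 + wderiv Omega 0 1 v z ^+ 2)) = 0 by rewrite sqrtr0.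
  rewrite -[RHS]q0 /quartW; apply: eq_Rintegral => z _.
  have H (x : R) : x * x = x ^+ 2 by rewrite expr2.
  exact: H.
have sq0 (a b : R) : a ^+ 2 + b ^+ 2 = 0 -> a = 0 /\ b = 0.
  move=> /eqP; rewrite paddr_eq0 ?sqr_ge0// !sqrf_eq0 => /andP[/eqP -> /eqP ->] //.
have c0 : continuous (fun _ : R * R => 0 : R) by move=> z; exact: cvg_cst.
have s0 := cont_sqi oO OB c0.
have z0 := ip0l.
have Zx h : sqi h -> ip (wderiv Omega 1 0 v) h = 0.
  move=> sh; rewrite -[RHS](z0 h); apply: ip_ae_l; [exact: mO|exact: s10.1|exact: s0.1|exact: sh.1|].
  by apply: aeS Z => z E Oz; exact: (sq0 _ _ (E Oz)).1.
have Zy h : sqi h -> ip (wderiv Omega 0 1 v) h = 0.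
  move=> sh; rewrite -[RHS](z0 h); apply: ip_ae_l; [exact: mO|exact: s01.1|exact: s0.1|exact: sh.1|].
  by apply: aeS Z => z E Oz; exact: (sq0 _ _ (E Oz)).2.
have [Lv _ _] := H10.
have L0 := sqi_L1loc oO OB s0.
apply: (laplacian_ae0 Wv); apply/is_wderivE; split; [exact: Lv|exact: L0| |exact: Lv|exact: L0|].
- move=> psi tpsi; rewrite z0 mulr0 -pdE /pd /=.
  have /is_wderivE[_ _ /(_ _ (test_px tpsi))] := H10.
  by rewrite -pdE /pd /= Zx ?mulr0//; exact/tsq/test_px.
- move=> psi tpsi; rewrite z0 mulr0 -pdE /pd /=.
  have /is_wderivE[_ _ /(_ _ (test_py tpsi))] := H01.
  by rewrite -pdE /pd /= Zy ?mulr0//; exact/tsq/test_py.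
Qed.

End Extremal.

(** * The mountain pass level *)

Lemma cvg_pow (R : realType) (u : nat -> R) (a : R) k :
  u n @[n --> \oo] --> a -> u n ^+ k @[n --> \oo] --> a ^+ k.
Proof.
move=> ua; elim: k => [|k IH]; first by rewrite expr0; exact: cvg_cst.
rewrite exprS (_ : (fun n => u n ^+ k.+1) = (fun n => u n * u n ^+ k)).
  exact: cvgM.
by apply/funext => n; rewrite exprS.
Qed.

Lemma cvg_le_lim (R : realType) (u w : nat -> R) (a b : R) :
  u n @[n --> \oo] --> a -> w n @[n --> \oo] --> b -> (forall n, u n <= w n) -> a <= b.
Proof.
move=> ua wb uw; rewrite -subr_ge0.
apply: (cvgr_to_ge (cvgB wb ua)).
by apply: nearW => n /=; rewrite subr_ge0.
Qed.

Lemma ray_max (R : realType) (s : R) : 0 <= s -> 2^-1 * s ^+ 2 - s ^+ 3 <= 54^-1.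
Proof.
move=> s0; have H : 0 <= (s - 3^-1) ^+ 2 * (s + 6^-1).
  by rewrite mulr_ge0 ?sqr_ge0// addr_ge0.
rewrite -subr_ge0; apply: (le_trans H); rewrite (exprS s 2) !expr2; lra.
Qed.

Lemma continuous_within_dist (R : realType) (A : set R) (g : R -> R) (d : R -> R -> R) :
  (forall s t, A s -> A t -> `|g t - g s| <= d t s) ->
  (forall s, A s -> d t s @[t --> within A (nbhs s)] --> (0 : R)) ->
  {within A, continuous g}.
Proof.
move=> gd cd; apply/subspace_continuousP => s hs; apply/cvgrPdist_le => e e0.
have := (cvgrPdist_le _ _).1 (cd s hs) e e0; rewrite !near_withinE.
move=> H; apply: (filterS _ (H _)) => t ht At; have := ht At; rewrite sub0r normrN => /(le_trans (ler_norm _)).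
by rewrite distrC; exact/le_trans/gd.
Qed.

Lemma ray_scale (R : realType) (a b c : R) :
  2^-1 * (b * a) - c * a = a * (2^-1 * b - c).
Proof. lra. Qed.

Lemma ray_value (R : realType) (a : R) :
  a / 54 + 3^-1 ^+ 3 * a <= 2^-1 * (3^-1 ^+ 2 * a).
Proof. rewrite !exprS !expr0; lra. Qed.

Lemma cube_value (R : realType) (M : R) : 0 < M ->
  M ^- 2 / 54 + M * (3^-1 * M^-1) ^+ 3 <= 2^-1 * (3^-1 * M^-1) ^+ 2.
Proof.
move=> M0; rewrite -exprVn 2!exprMn (exprS M^-1 2) (mulrCA (3^-1 ^+ 3)) (mulrA M).
by rewrite divff ?mul1r ?gt_eqF//; exact: ray_value.
Qed.

Lemma ray_zero (R : realType) (M x : R) : 0 < M -> 0 <= x -> x < (2 * M)^-1 ->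
  M * x ^+ 3 <= 2^-1 * x ^+ 2.
Proof.
move=> M0 x0; rewrite -div1r ltr_pdivlMr ?mulr_gt0// => /ltW h.
rewrite exprS mulrA; apply: ler_wpM2r; first exact: sqr_ge0.
by lra.
Qed.

Lemma quarter_sqr (R : realType) (A B : R) : A <= 4^-1 ^+ 2 * B -> 16 * A <= B.
Proof. rewrite expr2; lra. Qed.

Lemma embedding_const (R : realType) (a b : R) : a <= 16^-1 * b -> 8 / 27 * a <= b / 54.
Proof. lra. Qed.

Section MountainPass.
Context {R : realType}.
Local Notation T2 := (measurableTypeR R * measurableTypeR R)%type.
Local Notation mu2 := (leb2 R).
Implicit Types (f g v w : R * R -> R).
Variable Omega : set (R * R).
Variable r : R.
Hypothesis oO : open Omega.
Hypothesis r0 : 0 < r.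
Hypothesis OB : Omega `<=` orect (- r) r (- r) r.
Local Notation test := (test_function Omega).
Local Notation N f := (l2norm mu2 Omega (lap f)).
Local Notation n v := (norm220 Omega v).

(** The optimal constant of the homogeneous inequality extends from test
    functions to [W220]. Applied to the limit [v] of the maximising sequence, this
    inequality excludes a loss of norm, since [ThetaW v] is the constant itself. *)
Lemma attained (Theta ThetaW : (R * R -> R) -> R) (k : nat) (C : R) f0 :
  (forall c f, test f -> Theta (fun z => c * f z) = c ^+ k.+2 * Theta f) ->
  (forall f, unit_test Omega f -> Theta f <= C) ->
  test f0 -> 0 < Theta f0 ->
  (forall e, 0 < e -> exists2 eta, 0 < eta & forall f g, unit_test Omega f -> unit_test Omega g ->
     (forall z, `|f z - g z| <= eta) -> 2^-1 * (Theta f + Theta g) - e <= Theta (mid f g)) ->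
  (forall phi v, approx Omega phi v -> Theta (phi j) @[j --> \oo] --> ThetaW v) ->
  exists M v, [/\ 0 < M, W220 Omega v, n v = 1, ThetaW v = M &
    forall w, W220 Omega w -> ThetaW w <= M * n w ^+ k.+2].
Proof.
move=> hom bnd tf0 T0 hmid cT.
have [M [phi [v [M0 HM Ha cM N1]]]] := maximizer oO r0 OB hom bnd tf0 T0 hmid.
have up w : W220 Omega w -> ThetaW w <= M * n w ^+ k.+2.
  move=> /(W220_approx oO r0 OB)[psi Hw]; have [tpsi _ _] := Hw.
  apply: (cvg_le_lim (cT _ _ Hw) (w := fun j => M * N (psi j) ^+ k.+2)).
    by apply: cvgM; [exact: cvg_cst|exact: cvg_pow (approx_N oO OB Hw)].
  by move=> j; exact: HM.
have W := approx_W220 oO r0 OB Ha.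
have TM : ThetaW v = M by exact: (cvg_unique _ (cT _ _ Ha) cM).
have n0 := norm220_ge0 oO W.1.
have n1 : n v <= 1 by exact: (cvg_le_lim (approx_N oO OB Ha) (cvg_cst _) N1).
exists M, v; split => //; apply/le_anti; rewrite n1 /=.
have := up _ W; rewrite TM -[X in X <= _]mulr1 ler_pM2l// => h.
by rewrite -(ler_pXn2r (n := k.+2)) ?nnegrE// expr1n.
Qed.

Lemma JE w : W220 Omega w -> J Omega w = 2^-1 * n w ^+ 2 - cubic Omega w.
Proof. by move=> [Ww _]; rewrite /J (int_laplacian oO Ww). Qed.

(** The squared form of [cub_quart], both sides of which pass to the limit. *)
Lemma cubic_quartW w : W220 Omega w -> 16 * cubic Omega w ^+ 2 <= n w ^+ 2 * quartW Omega w.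
Proof.
move=> /(W220_approx oO r0 OB)[phi Ha]; have [tphi _ _] := Ha.
apply: (cvg_le_lim (u := fun j => 16 * cub Omega (phi j) ^+ 2) (w := fun j => N (phi j) ^+ 2 * quart Omega (phi j))).
- by apply: cvgM; [exact: cvg_cst|exact: cvg_pow (approx_cub oO r0 OB Ha)].
- apply: cvgM; first exact: cvg_pow (approx_N oO OB Ha).
  by have [] := approx_quart oO r0 OB Ha.
move=> j; have h := cub_quart oO r0 OB (tphi j).
have h2 : `|cub Omega (phi j)| ^+ 2 <= (4^-1 * (N (phi j) * Num.sqrt (quart Omega (phi j)))) ^+ 2.
  by apply: lerXn2r => //; rewrite nnegrE mulr_ge0 ?invr_ge0// mulr_ge0 ?nrm_ge0 ?sqrtr_ge0.
move: h2; rewrite real_normK ?num_real// !exprMn sqr_sqrtr ?quart_ge0//.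
exact: quarter_sqr.
Qed.

Section Level.
Variables (M : R) (v : R * R -> R).
Hypothesis M0 : 0 < M.
Hypothesis Wv : W220 Omega v.
Hypothesis nv : n v = 1.
Hypothesis cv : cubic Omega v = M.
Hypothesis cM : forall w, W220 Omega w -> cubic Omega w <= M * n w ^+ 3.

(** The inequality [cM] bounds the norm on [B] from below, and a multiple of the
    maximiser realises the bound. *)
Lemma min_B : is_min [set norm220 Omega v ^+ 6 / 54 | v in B Omega] (M ^- 2 / 54).
Proof.
split; last first.
  move=> _ [w [Ww w1] <-]; rewrite ler_pM2r ?invr_gt0//.
  have := cM Ww; rewrite w1 => h.
  have h3 : M^-1 <= n w ^+ 3 by rewrite -[X in X <= _]mulr1 ler_pdivrMl.
  rewrite (_ : n w ^+ 6 = (n w ^+ 3) ^+ 2); last by rewrite -exprM.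
  by rewrite -exprVn; apply: lerXn2r; rewrite ?nnegrE ?invr_ge0 ?(ltW M0)// exprn_ge0 ?(norm220_ge0 oO Ww.1).
(* scaling by the cube root of [1 / M] brings the cubic integral to 1 *)
pose t := M^-1 `^ 3^-1.
have t3 : t ^+ 3 = M^-1.
  by rewrite -powR_mulrn ?powR_ge0// -powRrM mulVf// powRr1// invr_ge0 ltW.
have t0 : 0 <= t by exact: powR_ge0.
have [Wt nt ct] := W220Z oO r0 OB t Wv.
exists (fun z => t * v z); first by split; rewrite // ct cv t3 mulVf// gt_eqF.
have t6 : t ^+ 6 = M ^- 2 by rewrite (exprM t 3 2) t3 exprVn.
by rewrite nt nv mulr1 ger0_norm// t6.
Qed.

(** With this parametrisation the maximum over the ray is at [s = 1 / 3], by
    [ray_max], and [J] is already negative at [s = 1]. *)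
Lemma ray_J s : 0 <= s -> J Omega (fun z => s / M * v z) = M ^- 2 * (2^-1 * s ^+ 2 - s ^+ 3).
Proof.
move=> s0; have [Wt nt ct] := W220Z oO r0 OB (s / M) Wv.
have sM : 0 <= s / M by rewrite divr_ge0// ltW.
rewrite (JE Wt) nt ct nv cv mulr1 ger0_norm//.
have MV : M^-1 * M = 1 by rewrite mulVf// gt_eqF.
have -> : (s / M) ^+ 3 * M = s ^+ 3 * M^-1 ^+ 2.
  by rewrite exprMn (exprSr M^-1 2) -!mulrA MV mulr1.
by rewrite exprMn -exprVn ray_scale.
Qed.

Lemma ray_Gamma : Gamma Omega (fun s z => s / M * v z).
Proof.
split.
- by move=> s _; have [] := W220Z oO r0 OB (s / M) Wv.
- move=> s _.
  have -> : (fun t => n ((fun z => t / M * v z) \- (fun z => s / M * v z))) =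
            (fun t => `|t - s| / M).
    apply/funext => t.
    rewrite (_ : _ \- _ = (fun z => (t - s) / M * v z)); last first.
      by apply/funext => z /=; rewrite -mulrBl -mulrBl.
    have [_ -> _] := W220Z oO r0 OB ((t - s) / M) Wv.
    by rewrite nv mulr1 normrM (ger0_norm (_ : 0 <= M^-1))// invr_ge0 ltW.
  apply: cvg_within_filter.
  apply/cvgrPdist_le => e e0; exists (e * M) => /=; first by rewrite mulr_gt0.
  move=> t /= ts; rewrite sub0r normrN ger0_norm; last by rewrite divr_ge0// ltW.
  by rewrite ler_pdivrMr// distrC ltW.
- by apply: aeW => z _ /=; rewrite !mul0r.
- rewrite ray_J// !expr1n pmulr_rlt0; last by rewrite invr_gt0 exprn_gt0.
  by lra.
Qed.

(** As [J w >= n w ^ 2 / 2 - M * n w ^ 3], the energy is nonnegative in the ball of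
    radius [1 / (2 M)]. A path of negative final energy leaves this ball and so
    crosses the sphere of radius [1 / (3 M)], on which the lower bound has its
    largest value [M ^- 2 / 54]. *)
Lemma path_level gamma : Gamma Omega gamma ->
  exists2 s, `[0, 1]%classic s & M ^- 2 / 54 <= J Omega (gamma s).
Proof.
move=> [Wg cg g0 J1].
have W s : 0 <= s -> s <= 1 -> W220 Omega (gamma s).
  by move=> s0 s1; apply: Wg; rewrite /= in_itv/= s0.
have W0 := W 0 (lexx _) ler01; have W1 := W 1 ler01 (lexx _).
have n0 : n (gamma 0) = 0 by exact: (ae_zero_norm220 oO OB W0.1 g0).
have n1 : (2 * M)^-1 <= n (gamma 1).
  have ge0 := norm220_ge0 oO W1.1.
  rewrite leNgt; apply/negP => lt1; have := J1; rewrite (JE W1) ltNge => /negP; apply.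
  by rewrite subr_ge0; apply: le_trans (cM W1) _; exact: ray_zero.
have cn : {within `[0, 1]%classic, continuous (fun s => n (gamma s))}.
  apply: (@continuous_within_dist R _ _ (fun t s => n (gamma t \- gamma s))) => [s t hs ht|]; last exact: cg.
  exact: (norm220_dist oO (Wg _ ht) (Wg _ hs)).
have V : Num.min (n (gamma 0)) (n (gamma 1)) <= (3 * M)^-1 <= Num.max (n (gamma 0)) (n (gamma 1)).
  have h0 : 0 <= (3 * M)^-1 by rewrite invr_ge0 mulr_ge0// ltW.
  have h1 : (3 * M)^-1 <= n (gamma 1).
    apply: le_trans n1; rewrite lef_pV2 ?posrE ?mulr_gt0// ler_wpM2r ?(ltW M0)//.
    by rewrite ler_nat.
  by rewrite n0 ge_min h0 /= le_max h1 orbT.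
have [s hs Es] := IVT ler01 cn V.
exists s => //; have Ws : W220 Omega (gamma s) by exact: Wg.
rewrite (JE Ws) Es lerBrDr; apply: le_trans (lerD (lexx _) (cM Ws)) _; rewrite Es.
have -> : (3 * M)^-1 = 3^-1 * M^-1 by rewrite invfM.
exact: cube_value.
Qed.

Lemma level : mountain_pass_level Omega = (M ^- 2 / 54)%:E.
Proof.
apply/le_anti/andP; split.
  apply: ge_ereal_inf; eexists; first by exists (fun s z => s / M * v z); [exact: ray_Gamma|].
  apply: ge_ereal_sup => _ [s /= /[!in_itv]/= /andP[s0 _] <-].
  rewrite lee_fin ray_J// ler_pM2l ?invr_gt0 ?exprn_gt0//; exact: ray_max.
apply: le_ereal_inf_tmp => _ [gamma Hg <-].
have [s hs Hs] := path_level Hg.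
apply: (@le_trans _ _ (J Omega (gamma s))%:E); first by rewrite lee_fin.
by apply: ereal_sup_ubound; exists s.
Qed.

Section Embedding.
Variables (M' : R) (v' : R * R -> R).
Hypothesis M'0 : 0 < M'.
Hypothesis Wv' : W220 Omega v'.
Hypothesis nv' : n v' = 1.
Hypothesis qv' : quartW Omega v' = M'.
Hypothesis qM : forall w, W220 Omega w -> quartW Omega w <= M' * n w ^+ 4.

Lemma embeddingE w : W220 Omega w -> embedding_quotient Omega w = n w ^+ 4 / quartW Omega w.
Proof.
by move=> [Ww _]; rewrite /embedding_quotient (int_laplacian oO Ww) -exprM.
Qed.

Lemma min_embedding : is_min [set embedding_quotient Omega v
            | v in [set v | W220 Omega v /\ ~ ae_zero Omega v]] M'^-1.
Proof.
split.
  exists v'; last by rewrite embeddingE// nv' qv' expr1n mul1r.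
  split => // /(ae_zero_norm220 oO OB Wv'.1); rewrite nv' => /eqP.
  by rewrite oner_eq0.
move=> _ [w [Ww w0] <-]; rewrite embeddingE//.
have q0 : 0 < quartW Omega w.
  rewrite lt_def; apply/andP; split; last first.
    by apply: Rintegral_ge0 => z _; exact: sqr_ge0.
  by apply/eqP => /(quartW_eq0 oO r0 OB Ww).
by rewrite ler_pdivlMr// mulrC ler_pdivrMr// mulrC qM.
Qed.

(** At the maximiser of the cubic functional, [cubic_quartW] reads
    [16 * M ^ 2 <= M']. *)
Lemma level_embedding : ((8 / 27 * M'^-1)%:E <= mountain_pass_level Omega)%E.
Proof.
rewrite level lee_fin.
have h1 := cubic_quartW Wv; have h2 := qM Wv.
rewrite cv nv expr1n mul1r in h1; rewrite nv expr1n mulr1 in h2.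
have h3 := le_trans h1 h2.
have : M'^-1 <= (16 * M ^+ 2)^-1.
  by rewrite lef_pV2 ?posrE// mulr_gt0// exprn_gt0.
by rewrite invfM; exact: embedding_const.
Qed.

End Embedding.

End Level.

End MountainPass.

Theorem theorem2p6 (R : realType) (Omega : set (R * R))
    (hOmega : smooth_bounded_domain Omega) :
  (exists m : R,
     is_min [set norm220 Omega v ^+ 6 / 54 | v in B Omega] m /\
     mountain_pass_level Omega = m%:E) /\
  (exists m : R,
     is_min [set embedding_quotient Omega v
            | v in [set v | W220 Omega v /\ ~ ae_zero Omega v]] m /\
     ((8 / 27 * m)%:E <= mountain_pass_level Omega)%E).
Proof.
have [oO [z0 Oz0] _ bO _] := hOmega.
have [r [r0 OB]] : exists r : R, 0 < r /\ Omega `<=` orect (- r) r (- r) r.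
  have [A [_ HA]] := bO.
  exists (`|A| + 2); split; first by have := normr_ge0 A; lra.
  move=> z Oz; have hA : A < `|A| + 1 by have := ler_norm A; lra.
  have : `|z| <= `|A| + 1 := HA _ hA z Oz; rewrite prod_normE ge_max => /andP[].
  rewrite !ler_norml => /andP[h1 h2] /andP[h3 h4].
  by split; apply/andP; split; lra.
have [q1 [q2 [q3 [q4 [[/andP[a1 a2] /andP[c1 c2]] CO]]]]] := open_rat_orect oO Oz0.
have [tb cb] := bump_cub oO OB (lt_trans a1 a2) (lt_trans c1 c2) CO.
have qb : 0 < quart Omega (bump (ratr q1 : R) (ratr q2) (ratr q3) (ratr q4)).
  rewrite lt_def quart_ge0 andbT; apply/eqP => q0.
  have := cub_quart oO r0 OB tb; rewrite q0 sqrtr0 !mulr0 normr_le0 => /eqP E.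
  by rewrite E ltxx in cb.
have [M [v [M0 Wv nv cv cM]]] := attained oO r0 OB (k := 1) (ThetaW := cubic Omega)
  (@cubZ _ _ _ oO OB) (cub_le_unit oO r0 OB) tb cb (cub_mid oO r0 OB) (approx_cub oO r0 OB).
have [M' [v' [M'0 Wv' nv' cv' qM]]] := attained oO r0 OB (k := 2) (ThetaW := quartW Omega)
  (@quartZ _ _ _ oO OB) (quart_le_unit oO r0 OB) tb qb (quart_mid oO r0 OB)
  (fun phi v h => (approx_quart oO r0 OB h).2).
split.
  exists (M ^- 2 / 54); split; first exact: (min_B oO r0 OB M0 Wv nv cv cM).
  exact: (level oO r0 OB M0 Wv nv cv cM).
exists M'^-1; split; first exact: (min_embedding oO r0 OB M'0 Wv' nv' cv' qM).
exact: (level_embedding oO r0 OB M0 Wv nv cv cM M'0 qM).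
Qed.
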